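(* The Riemann xi function has the infinite series representation $$\Xi(t)=\sum_{n=0}^\infty(-1)^nc_{2n}f_{2n}\left(\frac t2\right),$$ which converges uniformly on compacts for all $t\in\mathbb{C}$. More precisely, for any compact set $K\subset\mathbb{C}$ there exist constants $C_1,C_2>0$ depending on $K$ such that $$\left|\Xi(t)-\sum_{n=0}^N(-1)^nc_{2n}f_{2n}\left(\frac t2\right)\right|\le C_1e^{-C_2\sqrt N}$$ holds for all $N\ge0$ and $t\in K$.
   Context: The Riemann xi function is $\xi(s)=\frac12 s(s-1)\pi^{-s/2}\Gamma(s/2)\zeta(s)$ (extended to an entire function), and $\Xi(t)=\xi\left(\frac12+it\right)$ for $t\in\mathbb{C}$. For $x>0$ let $\omega(x)=\sum_{m=1}^\infty(2\pi^2m^4x^2-3\pi m^2x)e^{-\pi m^2x}$. For $n\ge0$ define $$c_n=2\sqrt2\int_0^\infty\frac{\omega(x)}{(x+1)^{3/2}}\left(\frac{x-1}{x+1}\right)^n\,dx$$ (an absolutely convergent integral). The polynomials $f_n$ (Meixner--Pollaczek polynomials $P_n^{(3/4)}(x;\pi/2)$) are $$f_n(x)=\frac{(3/2)_n}{n!}\,i^n\,{}_2F_1\left(-n,\tfrac34+ix;\tfrac32;2\right),$$ where $(a)_n=a(a+1)\cdots(a+n-1)$ is the Pochhammer symbol and ${}_2F_1$ is the Gauss hypergeometric series (here a terminating sum). *)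

(* Defs.v *)
From mathcomp Require Import all_boot all_order all_algebra.
From mathcomp Require Export complex.
From mathcomp Require Import all_classical all_reals all_analysis.
Export numFieldNormedType.Exports.

Set Implicit Arguments.
Unset Strict Implicit.
Unset Printing Implicit Defensive.

Import Order.TTheory GRing.Theory Num.Theory.
Local Open Scope classical_set_scope.
Local Open Scope ring_scope.
Local Open Scope complex_scope.

(* R[i]^o, unlike R[i], carries the topology and the norm of the complex
   plane; derivatives at points of R[i]^o are complex derivatives. *)

Definition cexp (R : realType) (z : R[i]^o) : R[i]^o :=
  (expR (complex.Re z) * cos (complex.Im z)) +i*
  (expR (complex.Re z) * sin (complex.Im z)).

(* Principal power x^z of a positive real x. *)
Definition cpow (R : realType) (x : R) (z : R[i]^o) : R[i]^o :=
  cexp (z * (ln x)%:C).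

Definition cintegral (R : realType) (D : set R) (g : R -> R[i]^o) : R[i]^o :=
  (\int[lebesgue_measure]_(x in D) complex.Re (g x)) +i*
  (\int[lebesgue_measure]_(x in D) complex.Im (g x)).

(* Euler's integral, which is Gamma(z) for Re z > 0. *)
Definition cGamma (R : realType) (z : R[i]^o) : R[i]^o :=
  cintegral `]0, +oo[ (fun x : R => cpow x (z - 1) * (expR (- x))%:C).

(* The Dirichlet series, which is zeta(s) for Re s > 1. *)
Definition czeta (R : realType) (s : R[i]^o) : R[i]^o :=
  limn (series (fun m : nat => cpow (m.+1%:R : R) (- s))).

Definition entire (R : realType) (g : R[i]^o -> R[i]^o) : Prop :=
  forall z : R[i]^o, derivable g z 1.

(* The entire function given for Re s > 1 by the defining formula of xi: there
   is exactly one, by analytic continuation and the identity theorem.  The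
   default value of xget is irrelevant. *)
Definition is_riemann_xi (R : realType) (g : R[i]^o -> R[i]^o) : Prop :=
  entire g /\
  forall s : R[i]^o, 1 < complex.Re s ->
    g s = 2^-1 * s * (s - 1) * cpow pi (- (s / 2)) * cGamma (s / 2) * czeta s.

Definition riemann_xi (R : realType) : R[i]^o -> R[i]^o :=
  xget (fun=> 0) [set g | is_riemann_xi g].

Definition riemann_Xi (R : realType) (t : R[i]^o) : R[i]^o :=
  riemann_xi (2^-1 + ('i : R[i]^o) * t).

Definition omega (R : realType) (x : R) : R :=
  limn (series (fun k : nat => let m : R := k.+1%:R in
    (2 * pi ^+ 2 * m ^+ 4 * x ^+ 2 - 3 * pi * m ^+ 2 * x)
    * expR (- (pi * m ^+ 2 * x)))).

Definition c_coef (R : realType) (n : nat) : R :=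
  2 * Num.sqrt 2 *
  \int[lebesgue_measure]_(x in `]0, +oo[)
    (omega x / (x + 1) `^ (3 / 2) * ((x - 1) / (x + 1)) ^+ n).

Definition pochhammer (R : realType) (a : R[i]^o) (n : nat) : R[i]^o :=
  \prod_(i < n) (a + i%:R).

Definition hyp2F1 (R : realType) (a b c z : R[i]^o) : R[i]^o :=
  limn (series (fun k : nat =>
    pochhammer a k * pochhammer b k / (pochhammer c k * (k`!)%:R) * z ^+ k)).

Definition f_poly (R : realType) (n : nat) (x : R[i]^o) : R[i]^o :=
  pochhammer (3 / 2 : R[i]^o) n / (n`!)%:R * ('i : R[i]^o) ^+ n
  * hyp2F1 (- n%:R) (3 / 4 + ('i : R[i]^o) * x) (3 / 2) 2.

Definition Xi_term (R : realType) (t : R[i]^o) (n : nat) : R[i]^o :=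
  (-1) ^+ n * (c_coef R n.*2)%:C * f_poly n.*2 (t / 2).

(* Main.v *)
Require Import Defs.
From mathcomp Require Import all_boot all_order all_algebra.
From mathcomp Require Import all_classical all_reals all_analysis.
From mathcomp Require Import measurable_realfun.
From mathcomp Require Import ring lra zify.

(** The integral [xi_mellin s], of [omega x * x^(s/2 - 1)] over [x > 0], is at
    once the entire function xi and the integral that the series expands.

    It is entire since [omega x = O(exp (- (x + 1/x) / 2))]. At infinity this is
    the size of the defining series; at 0 it follows from
    [omega (1/x) = sqrt x * omega x] ([omega_inv]), which is obtained by
    differentiating Jacobi's transformation formula of the theta constant
    ([theta_half_inv]) twice. Jacobi's formula is obtained in Polya's way: the
    average of [(2 cos)^(2M)] over the multiples of [pi / N] is the sum of the
    binomial coefficients of order [2M] at distances divisible by [N] from the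
    centre ([polya_identity]), and both sides tend to theta series when [N] grows
    like [r * sqrt M].

    For Re s > 1 the series of [omega] may be integrated term by term, and the
    [k]-th term is a rescaled Gamma integral, so that [xi_mellin] satisfies the
    defining formula of xi ([xi_mellin_zeta]). As an entire function is
    determined by its values for Re s > 1 ([entire_halfplane_eq0]), it is xi.
    This uniqueness comes from Cauchy's theorem on a square: against a steep
    Gaussian kernel centred at [a], the integral of a function vanishing for
    Re s > 1 along the vertical line through [a] is negligible, although the
    kernel concentrates at [a].

    Let now [s = 1/2 + i t], [tau = t / 2] and [u = (x - 1) / (x + 1)]. Then
    [x^(s/2 - 1) = x^(- 3/4 + i tau)] is [2 sqrt 2 * (x + 1)^(- 3/2)] times
    [(1 + u)^(- 3/4 + i tau) * (1 - u)^(- 3/4 - i tau)], and the latter is the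
    generating function, in [u], of the numbers [i^n f_n(tau)]. Integration
    against [omega] gives [Xi t = \sum_n i^n c_n f_n(t / 2)], and [c_n = 0] for
    odd [n] by the symmetry of [omega] under [x -> 1/x].

    The error after [m] terms is estimated through a differential equation
    ([mp_sum_ode]): the truncated generating function satisfies the equation of
    the full one up to its two top terms, so that its quotient by
    [x^(- 3/4 + i tau)], which is 1 at [x = 1], has a derivative of order
    [|u|^m] times powers of [m] and of [Y = x + 1/x] ([cayley_approx_le]). As
    [|u| <= 1 - 1/Y], the product of [|u|^m] with [omega] is at most
    [exp (- m/Y - Y/4)] up to an integrable factor, hence
    [exp (- sqrt m)] ([omega_geometric_le]); this is the rate of convergence, and
    the bounds are uniform for bounded [t] ([xi_mellin_expansion]). *)

Import Order.TTheory GRing.Theory Num.Theory.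
Local Open Scope classical_set_scope.
Local Open Scope ring_scope.
Local Open Scope complex_scope.

Set Implicit Arguments.
Unset Strict Implicit.
Unset Printing Implicit Defensive.

(** * Modulus, derivative and exponential of complex numbers *)

Section ComplexModulus.
Variable R : realType.
Implicit Types z w : R[i]^o.

(** The norm [`|z|] is itself a complex number; estimates need a real one. *)
Definition cmod z : R := Num.sqrt (complex.Re z ^+ 2 + complex.Im z ^+ 2).

Lemma normcmodE z : `|z| = (cmod z)%:C.
Proof. exact: normc_def. Qed.

Lemma cmod_ge0 z : 0 <= cmod z.
Proof. exact: sqrtr_ge0. Qed.

Lemma cmod_le z r : (`|z| <= r%:C) = (cmod z <= r).
Proof. by rewrite normcmodE lecR. Qed.

Lemma cmodM z w : cmod (z * w) = cmod z * cmod w.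
Proof. by apply: complexI; rewrite rmorphM/= -!normcmodE normrM. Qed.

Lemma cmodD z w : cmod (z + w) <= cmod z + cmod w.
Proof. by rewrite -lecR rmorphD/= -!normcmodE ler_normD. Qed.

Lemma cmodN z : cmod (- z) = cmod z.
Proof. by apply: complexI; rewrite -!normcmodE normrN. Qed.

Lemma cmod0 : cmod 0 = 0.
Proof. by apply: complexI; rewrite -normcmodE normr0. Qed.

Lemma cmod_eq0 z : (cmod z == 0) = (z == 0).
Proof. by rewrite -(normr_eq0 z) normcmodE (inj_eq (@complexI R)). Qed.

Lemma cmodV z : cmod (z^-1) = (cmod z)^-1.
Proof. by apply: complexI; rewrite fmorphV/= -!normcmodE normfV. Qed.

Lemma cmodX z n : cmod (z ^+ n) = cmod z ^+ n.
Proof. by apply: complexI; rewrite rmorphXn/= -!normcmodE normrX. Qed.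

Lemma cmodR (x : R) : cmod x%:C = `|x|.
Proof. by rewrite /cmod/= expr0n/= addr0 sqrtr_sqr. Qed.

Lemma normr_Re_le z : `|complex.Re z| <= cmod z.
Proof. by rewrite -lecR -normcmodE normc_ge_Re. Qed.

Lemma normr_Im_le z : `|complex.Im z| <= cmod z.
Proof.
rewrite -sqrtr_sqr ler_wsqrtr// ?lerDr ?sqr_ge0//.
Qed.

Lemma cmod_le_ReIm z : cmod z <= `|complex.Re z| + `|complex.Im z|.
Proof.
rewrite -(@ger0_norm _ (_ + _)) ?addr_ge0// -sqrtr_sqr ler_wsqrtr//.
rewrite sqrrD !real_normK ?num_real// -addrA lerD2l lerDr.
by rewrite mulrn_wge0// mulr_ge0.
Qed.

End ComplexModulus.

Section ComplexDerivative.
Variable R : realType.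
Implicit Types (z h : R[i]^o) (g : R[i]^o -> R[i]^o).

Lemma ltc_cmod z (e : R) : (`|z| < e%:C) = (cmod z < e).
Proof. by rewrite normcmodE ltcR. Qed.

(** Complex differentiability with all inequalities between real numbers. *)
Lemma derivable_cmodP g z : derivable g z 1 <->
  exists l : R[i]^o, forall e : R, 0 < e -> exists2 d : R, 0 < d &
    forall h, cmod h < d -> cmod (g (z + h) - g z - l * h) <= e * cmod h.
Proof.
have ltc0P (e : R[i]) : 0 < e -> 0 < complex.Re e /\ e = (complex.Re e)%:C.
  by case: e => a b; rewrite ltcE/= => /andP[/eqP -> ->].
split=> [/derivable_nbhsP/eqaddoP dg|[l dl]].
  exists ('D_1 g z) => e e0.
  have /dg : (0 : R[i]) < e%:C by rewrite ltcR.
  rewrite -nbhs_nearE => /nbhs_ballP[d' /= /ltc0P[d0 dE] dP].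
  exists (complex.Re d') => // h hd.
  have := dP h; rewrite /ball/= sub0r normrN dE ltc_cmod => /(_ hd).
  rewrite [X in `|X|](_ : _ = g (z + h) - g z - 'D_1 g z * h); last first.
    rewrite -![(_ + _ : _ -> _) _]/(_ + _) /cst /= opprD addrA.
    rewrite /GRing.scale/= mulr1.
    by rewrite -![(- _ : _ -> _) _]/(- _) [h + z]addrC ['D_1 g z * h]mulrC.
  by rewrite !normcmodE -rmorphM/= lecR.
apply/cvg_ex; exists l; apply/(@eqolimP _ _ _ (dnbhs_filter_on _))/eqaddoP.
move=> e /ltc0P[e0 ->].
rewrite /= !(near_simpl, near_withinE).
have [d d0 dP] := dl _ e0.
apply/nbhs_ballP; exists d%:C => /=; first by rewrite ltcR.
move=> h; rewrite /ball/= sub0r normrN ltc_cmod => /dP hP h0.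
rewrite -![(_ + _ : _ -> _) _]/(_ + _) -![(- _ : _ -> _) _]/(- _) /cst/=.
rewrite normr1 mulr1 cmod_le (_ : h%:A = h :> R[i]^o); last exact: mulr1.
rewrite (_ : _ - l = h^-1 * (g (z + h) - g z - l * h) :> R[i]^o); last first.
  by rewrite mulrBr [l * h]mulrC mulKf// [h + z]addrC.
have ch0 : 0 < cmod h by rewrite lt_neqAle cmod_ge0 eq_sym cmod_eq0 h0.
by rewrite cmodM cmodV ler_pdivrMl// [cmod h * _]mulrC.
Qed.

End ComplexDerivative.

Section ComplexExponential.
Variable R : realType.
Implicit Types (z w h : R[i]^o) (a b : R).

Lemma cexpD z w : cexp (z + w) = cexp z * cexp w.
Proof.
case: z w => [a b] [c d]; rewrite /cexp/= expRD cosD sinD.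
by apply/eqP; rewrite eq_complex/=; apply/andP; split; apply/eqP; ring.
Qed.

Lemma cexp0 : cexp 0 = 1 :> R[i]^o.
Proof. by rewrite /cexp/= expR0 cos0 sin0 mulr1 mulr0. Qed.

Lemma cexpN z : cexp (- z) = (cexp z)^-1.
Proof.
have e1 : cexp z * cexp (- z) = 1 by rewrite -cexpD subrr cexp0.
have z0 : cexp z != 0.
  by apply/eqP => z0; move/eqP: e1; rewrite z0 mul0r eq_sym oner_eq0.
by apply: (mulfI z0); rewrite e1 mulfV.
Qed.

Lemma cexp_real a : cexp (a%:C : R[i]^o) = (expR a)%:C.
Proof. by rewrite /cexp/= cos0 sin0 mulr1 mulr0. Qed.

Lemma cmod_cexp z : cmod (cexp z) = expR (complex.Re z).
Proof.
by rewrite /cmod/cexp/= !exprMn -mulrDr cos2Dsin2 mulr1 sqrtr_sqr ger0_norm// expR_ge0.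
Qed.

Lemma normr_sin_le b : `|sin b| <= `|b|.
Proof.
wlog b0 : b / 0 <= b.
  move=> H; have [/H//|/ltW b0] := leP 0 b.
  by rewrite -normrN -sinN -(normrN b); apply: H; rewrite oppr_ge0.
have [|c _] := @MVT_segment R sin cos _ _ b0.
  by apply: continuous_subspaceT => x; exact: continuous_sin.
by rewrite sin0 !subr0 => ->; rewrite normrM ler_piMl// cos_max.
Qed.

Lemma normr_cosB1_le b : `|cos b - 1| <= `|b|.
Proof.
wlog b0 : b / 0 <= b.
  move=> H; have [/H//|/ltW b0] := leP 0 b.
  by rewrite -cosN -(normrN b); apply: H; rewrite oppr_ge0.
have [|c _] := @MVT_segment R cos (fun x => - sin x) _ _ b0.
  by apply: continuous_subspaceT => x; exact: continuous_cos.
by rewrite cos0 !subr0 => ->; rewrite normrM normrN ler_piMl// sin_max.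
Qed.

Lemma normr_cosB1_le2 b : `|cos b - 1| <= b ^+ 2.
Proof.
wlog b0 : b / 0 <= b.
  move=> H; have [/H//|/ltW b0] := leP 0 b.
  by rewrite -cosN -sqrrN; apply: H; rewrite oppr_ge0.
have [|c /itvP cb] := @MVT_segment R cos (fun x => - sin x) _ _ b0.
  by apply: continuous_subspaceT => x; exact: continuous_cos.
rewrite cos0 !subr0 => ->; rewrite normrM normrN expr2 (ger0_norm b0).
rewrite ler_wpM2r// (le_trans (normr_sin_le _))// ger0_norm ?cb//.
Qed.

Lemma normr_sinBid_le2 b : `|sin b - b| <= b ^+ 2.
Proof.
wlog b0 : b / 0 <= b.
  move=> H; have [/H//|/ltW b0] := leP 0 b.
  have := H (- b); rewrite sqrrN sinN oppr_ge0 -opprD normrN; exact.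
have [|c /itvP cb] := @MVT_segment R (fun x => sin x - x) (fun x => cos x - 1) _ _ b0.
  apply: continuous_subspaceT => x; apply: cvgB => //; exact: continuous_sin.
rewrite sin0 !subr0 => ->; rewrite normrM expr2 (ger0_norm b0).
rewrite ler_wpM2r// (le_trans (normr_cosB1_le _))// ger0_norm ?cb//.
Qed.

Lemma normr_expRB1_le a : `|expR a - 1| <= `|a| * expR `|a|.
Proof.
have [a0|a0] := leP 0 a.
  have e1 : 1 - a <= expR (- a) := expR_ge1Dx (- a).
  have : (1 - a) * expR a <= 1 by rewrite -ler_pdivlMr ?expR_gt0// div1r -expRN.
  rewrite (ger0_norm a0) ger0_norm; first lra.
  by rewrite subr_ge0 -expR0 ler_expR.
rewrite (ltr0_norm a0) ler0_norm ?opprB; last by rewrite subr_le0 expR_le1 ltW.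
have := expR_ge1Dx a => e1.
apply: (@le_trans _ _ (- a)); first lra.
by rewrite ler_peMr ?oppr_ge0 ?(ltW a0)// ltW// expR_gt1 oppr_gt0.
Qed.

Lemma normr_expRB1D_le a : `|expR a - 1 - a| <= a ^+ 2 * expR `|a|.
Proof.
rewrite ger0_norm; last by have := expR_ge1Dx a; lra.
have e1 := expR_ge1Dx a.
have e2 : 1 - a <= expR (- a) := expR_ge1Dx (- a).
have e3 := expR_gt0 a.
have e6 : (1 - a) * expR a <= 1.
  by rewrite -ler_pdivlMr ?expR_gt0// div1r -expRN.
have [a0|a0] := leP 0 a; first rewrite ger0_norm//.
  have : 0 <= a * (1 - (1 - a) * expR a) by rewrite mulr_ge0// subr_ge0.
  by move: e6; rewrite expr2; lra.
have e5 : 1 <= expR (- a) by rewrite -expR0 ler_expR; lra.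
have e7 : expR a <= 1 + a + a ^+ 2.
  rewrite -(@ler_pM2l _ (1 - a)); last lra.
  apply: le_trans e6 _; have : 0 <= (- a) ^+ 3 by rewrite exprn_ge0; lra.
  by rewrite !expr2 !exprS expr0; lra.
rewrite ltr0_norm//; have : 0 <= a ^+ 2 * (expR (- a) - 1).
  by rewrite mulr_ge0 ?sqr_ge0// subr_ge0.
by lra.
Qed.

Lemma cmod_cexpB1D_le h :
  cmod (cexp h - 1 - h) <= 5 * cmod h ^+ 2 * expR (cmod h).
Proof.
have ha := normr_Re_le h; have hb := normr_Im_le h.
case: h ha hb => a b; set r := cmod _ => /= ha hb.
have r0 : 0 <= r by exact: cmod_ge0.
have er : expR `|a| <= expR r by rewrite ler_expR.
have era : expR a <= expR r by rewrite ler_expR (le_trans (ler_norm _) ha).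
have er1 : 1 <= expR r by rewrite -expR0 ler_expR.
have b2 : b ^+ 2 <= r ^+ 2 by rewrite -real_normK ?num_real// lerXn2r ?nnegrE.
have a2 : a ^+ 2 <= r ^+ 2 by rewrite -real_normK ?num_real// lerXn2r ?nnegrE.
have r20 : 0 <= r ^+ 2 by rewrite exprn_ge0.
apply: le_trans (cmod_le_ReIm _) _; rewrite /cexp/=.
have -> : expR a * cos b - 1 - a = expR a * (cos b - 1) + (expR a - 1 - a) by ring.
have -> : expR a * sin b - 0 - b = expR a * (sin b - b) + (expR a - 1) * b by ring.
have H1 : `|expR a * (cos b - 1)| <= r ^+ 2 * expR r.
  rewrite normrM ger0_norm ?expR_ge0// mulrC ler_pM ?expR_ge0//.
  exact: le_trans (normr_cosB1_le2 _) b2.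
have H2 : `|expR a - 1 - a| <= r ^+ 2 * expR r.
  by apply: le_trans (normr_expRB1D_le _) _; rewrite ler_pM ?sqr_ge0 ?expR_ge0.
have H3 : `|expR a * (sin b - b)| <= r ^+ 2 * expR r.
  rewrite normrM ger0_norm ?expR_ge0// mulrC ler_pM ?expR_ge0//.
  exact: le_trans (normr_sinBid_le2 _) b2.
have H4 : `|(expR a - 1) * b| <= r ^+ 2 * expR r.
  rewrite normrM expr2 mulrAC ler_pM//.
  by apply: le_trans (normr_expRB1_le _) _; rewrite ler_pM ?expR_ge0.
have := ler_normD (expR a * (cos b - 1)) (expR a - 1 - a).
have := ler_normD (expR a * (sin b - b)) ((expR a - 1) * b).
have : 0 <= r ^+ 2 * expR r by rewrite mulr_ge0// expR_ge0.
rewrite -mulrA; move: H1 H2 H3 H4; lra.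
Qed.

End ComplexExponential.

(** * Cauchy's theorem for squares *)

Section IntervalIntegral.
Variable R : realType.
Implicit Types (f : R -> R) (a b c : R).
Notation mu := (@lebesgue_measure R).

Definition segint f a b : R := \int[mu]_(x in `[a, b]) f x.

Lemma continuous_seg_integrable f a b : continuous f ->
  mu.-integrable `[a, b] (EFin \o f).
Proof.
move=> cf; apply: continuous_compact_integrable; first exact: segment_compact.
exact: continuous_subspaceT.
Qed.

Lemma segint_split f a b c : continuous f -> a <= c -> c <= b ->
  segint f a b = segint f a c + segint f c b.
Proof.
move=> cf ac cb; apply/eqP; rewrite addrC -subr_eq; apply/eqP.
rewrite /segint Rintegral_itvB ?bnd_simp//; last exact: continuous_seg_integrable.
apply: Rintegral_itv_obnd_cbnd.
apply: integrableS (continuous_seg_integrable c b cf) => //.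
exact: subset_itv_oc_cc.
Qed.

Lemma segint_cst (k : R) a b : a <= b -> segint (fun=> k) a b = k * (b - a).
Proof.
move=> ab; rewrite /segint Rintegral_cst//= lebesgue_measure_itv/= lte_fin.
by case: ltgtP ab => // -> _; rewrite /= subrr.
Qed.

Lemma segint_ge (k : R) f a b : continuous f -> a <= b ->
  (forall x, a <= x <= b -> k <= f x) -> k * (b - a) <= segint f a b.
Proof.
move=> cf ab kf; rewrite -segint_cst//; apply: le_Rintegral => //.
- by apply: (@continuous_seg_integrable (fun=> k)); exact: cst_continuous.
- exact: continuous_seg_integrable.
Qed.

Lemma segint_le (k : R) f a b : continuous f -> a <= b ->
  (forall x, a <= x <= b -> f x <= k) -> segint f a b <= k * (b - a).
Proof.
move=> cf ab kf; rewrite -segint_cst//; apply: le_Rintegral => //.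
- exact: continuous_seg_integrable.
- by apply: (@continuous_seg_integrable (fun=> k)); exact: cst_continuous.
Qed.

Lemma segintB f g a b : continuous f -> continuous g ->
  segint f a b - segint g a b = segint (fun x => f x - g x) a b.
Proof.
by move=> cf cg; rewrite /segint RintegralB//; exact: continuous_seg_integrable.
Qed.

Lemma segint_diff_bound f g (k e : R) a b : continuous f -> continuous g ->
  a <= b -> (forall x, a <= x <= b -> `|f x - g x - k| <= e) ->
  `|segint f a b - segint g a b - k * (b - a)| <= e * (b - a).
Proof.
move=> cf cg ab fe; rewrite segintB//.
have cfg : continuous (fun x => f x - g x).
  by move=> x; apply: cvgB; [exact: cf|exact: cg].
have H1 := @segint_ge (k - e) _ a b cfg ab.
have H2 := @segint_le (k + e) _ a b cfg ab.
rewrite ler_distl -!mulrBl -!mulrDl H1 ?H2//.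
- by move=> x /fe; rewrite ler_distl => /andP[].
- by move=> x /fe; rewrite ler_distl => /andP[].
Qed.

End IntervalIntegral.

Section CauchyRiemann.
Variable R : realType.
Variables P Q : R -> R -> R.

(** The Cauchy-Riemann form of complex differentiability at every point. *)
Definition cauchy_riemann_diff := forall x0 y0, exists al be : R,
  forall e : R, 0 < e -> exists2 d : R, 0 < d & forall x y,
    `|x - x0| < d -> `|y - y0| < d ->
    `|P x y - P x0 y0 - (al * (x - x0) - be * (y - y0))|
      <= e * (`|x - x0| + `|y - y0|) /\
    `|Q x y - Q x0 y0 - (be * (x - x0) + al * (y - y0))|
      <= e * (`|x - x0| + `|y - y0|).

End CauchyRiemann.

Section Goursat.
Variable R : realType.
Implicit Types (P Q : R -> R -> R).

Lemma cauchy_riemann_diffN P Q : cauchy_riemann_diff P Q ->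
  cauchy_riemann_diff Q (fun x y => - P x y).
Proof.
move=> CR x0 y0; have [al [be H]] := CR x0 y0.
exists be, (- al) => e /H[d d0 dP]; exists d => // x y xd yd.
have [h1 h2] := dP x y xd yd; rewrite mulNr opprK; split => //.
rewrite [X in `|X|](_ : _ =
  - (P x y - P x0 y0 - (al * (x - x0) - be * (y - y0)))) ?normrN//; ring.
Qed.

Lemma cauchy_riemann_cont1 P Q y : cauchy_riemann_diff P Q ->
  continuous (P ^~ y).
Proof.
move=> CR x0; apply/cvgrPdist_le => e e0.
have [al [be /(_ 1 ltr01)[d d0 dP]]] := CR x0 y.
have K0 : 0 < `|al| + 1 by rewrite ltr_wpDl.
apply/nbhs_ballP; exists (Num.min d (e / (`|al| + 1))) => /=.
  by rewrite lt_min d0 divr_gt0.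
move=> x; rewrite /ball/= distrC lt_min => /andP[xd xe].
have [] := dP x y xd; first by rewrite subrr normr0.
rewrite !subrr mulr0 subr0 normr0 addr0 mul1r => H _.
rewrite distrC; move: xe; rewrite ltr_pdivlMr//.
have := ler_normD (P x y - P x0 y - al * (x - x0)) (al * (x - x0)).
by rewrite subrK normrM; lra.
Qed.

Lemma cauchy_riemann_cont2 P Q x : cauchy_riemann_diff P Q ->
  continuous (P x).
Proof.
move=> CR y0; apply/cvgrPdist_le => e e0.
have [al [be /(_ 1 ltr01)[d d0 dP]]] := CR x y0.
have K0 : 0 < `|be| + 1 by rewrite ltr_wpDl.
apply/nbhs_ballP; exists (Num.min d (e / (`|be| + 1))) => /=.
  by rewrite lt_min d0 divr_gt0.
move=> y; rewrite /ball/= distrC lt_min => /andP[xd xe].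
have [] := dP x y _ xd; first by rewrite subrr normr0.
rewrite !subrr mulr0 sub0r opprK normr0 add0r mul1r => H _.
rewrite distrC; move: xe; rewrite ltr_pdivlMr//.
have := ler_normD (P x y - P x y0 + be * (y - y0)) (- (be * (y - y0))).
by rewrite addrK normrN normrM; lra.
Qed.

(** The real part of the integral of [P + iQ] round the square with lower left
    corner [(p, q)] and side [s]; the imaginary part is the same expression for
    the pair [(Q, - P)]. *)
Definition square_flux P Q p q s : R :=
  segint (P ^~ q) p (p + s) - segint (P ^~ (q + s)) p (p + s)
  - (segint (Q (p + s)) q (q + s) - segint (Q p) q (q + s)).

Section Flux.
Variables P Q : R -> R -> R.
Hypothesis CR : cauchy_riemann_diff P Q.

Let cP1 y : continuous (P ^~ y). Proof. exact: cauchy_riemann_cont1 CR. Qed.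
Let cP2 x : continuous (P x). Proof. exact: cauchy_riemann_cont2 CR. Qed.
Let cQ1 y : continuous (Q ^~ y).
Proof. exact: cauchy_riemann_cont1 (cauchy_riemann_diffN CR). Qed.
Let cQ2 x : continuous (Q x).
Proof. exact: cauchy_riemann_cont2 (cauchy_riemann_diffN CR). Qed.

Lemma square_flux_split p q h : 0 <= h ->
  square_flux P Q p q (h + h) =
  square_flux P Q p q h + square_flux P Q (p + h) q h
  + square_flux P Q p (q + h) h + square_flux P Q (p + h) (q + h) h.
Proof.
move=> h0; rewrite /square_flux !addrA.
rewrite (@segint_split _ (P ^~ q) p (p + h + h) (p + h))// ?lerDl//.
rewrite (@segint_split _ (P ^~ (q + h + h)) p (p + h + h) (p + h))// ?lerDl//.
rewrite (@segint_split _ (Q (p + h + h)) q (q + h + h) (q + h))// ?lerDl//.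
rewrite (@segint_split _ (Q p) q (q + h + h) (q + h))// ?lerDl//.
by ring.
Qed.

Lemma square_flux_quarter p q h e : 0 <= h ->
  e * (h + h) ^+ 2 <= `|square_flux P Q p q (h + h)| ->
  exists pq : R * R, [/\ p <= pq.1, pq.1 <= p + h, q <= pq.2, pq.2 <= q + h &
    e * h ^+ 2 <= `|square_flux P Q pq.1 pq.2 h|].
Proof.
move=> h0; rewrite square_flux_split//.
set a := square_flux P Q p q h; set b := square_flux P Q (p + h) q h.
set c := square_flux P Q p (q + h) h; set d := square_flux P Q _ _ h => H.
have ph : p <= p + h by rewrite lerDl.
have qh : q <= q + h by rewrite lerDl.
have [ea|ea] := leP (e * h ^+ 2) `|a|; first by exists (p, q); split=> //=.
have [eb|eb] := leP (e * h ^+ 2) `|b|; first by exists (p + h, q); split=> //=.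
have [ec|ec] := leP (e * h ^+ 2) `|c|; first by exists (p, q + h); split=> //=.
have [ed|ed] := leP (e * h ^+ 2) `|d|; first by exists (p + h, q + h); split=> //=.
have := ler_normD (a + b + c) d; have := ler_normD (a + b) c.
have := ler_normD a b; lra.
Qed.

(** The flux of the linear approximation at [(x0, y0)] round the square is 0,
    which is where the Cauchy-Riemann equations enter: the two pairs of opposite
    sides contribute the same [be * s^2]. *)
Lemma square_flux_small x0 y0 e : 0 < e -> exists2 d : R, 0 < d &
  forall p q s, 0 <= s -> s < d -> p <= x0 <= p + s -> q <= y0 <= q + s ->
    `|square_flux P Q p q s| <= e * s ^+ 2.
Proof.
move=> e0; have [al [be CRe]] := CR x0 y0.
have [|d d0 dP] := CRe (e / 8); first by rewrite divr_gt0.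
exists d => // p q s s0 sd /andP[px xp] /andP[qy yq].
have ps : p <= p + s by rewrite lerDl.
have qs : q <= q + s by rewrite lerDl.
have near x y : p <= x <= p + s -> q <= y <= q + s ->
    `|P x y - P x0 y0 - (al * (x - x0) - be * (y - y0))| <= e / 4 * s /\
    `|Q x y - Q x0 y0 - (be * (x - x0) + al * (y - y0))| <= e / 4 * s.
  move=> /andP[px' xp'] /andP[qy' yq'].
  have xs : `|x - x0| <= s by rewrite ler_distl; apply/andP; split; lra.
  have ys : `|y - y0| <= s by rewrite ler_distl; apply/andP; split; lra.
  have [h1 h2] := dP x y (le_lt_trans xs sd) (le_lt_trans ys sd).
  have : e / 8 * (`|x - x0| + `|y - y0|) <= e / 8 * (s + s).
    by rewrite ler_pM2l ?divr_gt0// lerD.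
  by split; lra.
have HP : `|segint (P ^~ q) p (p + s) - segint (P ^~ (q + s)) p (p + s)
            - be * s * (p + s - p)| <= e / 2 * s * (p + s - p).
  apply: segint_diff_bound => // x xp'.
  have [|h1 _] := near x q xp'; first by rewrite lexx.
  have [|h2 _] := near x (q + s) xp'; first by rewrite lexx andbT.
  move: h1 h2; rewrite !ler_norml; lra.
have HQ : `|segint (Q (p + s)) q (q + s) - segint (Q p) q (q + s)
            - be * s * (q + s - q)| <= e / 2 * s * (q + s - q).
  apply: segint_diff_bound => // y yq'.
  have [|_ h1] := near p y _ yq'; first by rewrite lexx.
  have [|_ h2] := near (p + s) y _ yq'; first by rewrite lexx andbT.
  move: h1 h2; rewrite !ler_norml; lra.
move: HP HQ; rewrite /square_flux ![_ + s - _]addrAC !subrr !add0r.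
by rewrite !ler_norml expr2; lra.
Qed.

(** Goursat: a square of flux [e s^2] contains a quarter of flux at least
    [e (s/2)^2], and so on; at the common point of these squares the linear
    approximation of [P + iQ] makes the flux [o(s^2)]. *)
Lemma square_flux_eq0 p q s : 0 < s -> square_flux P Q p q s = 0.
Proof.
move=> s0; apply/eqP; rewrite -normr_le0 leNgt; apply/negP => f0.
pose e := `|square_flux P Q p q s| / s ^+ 2.
have e0 : 0 < e by rewrite divr_gt0// exprn_gt0.
pose good (h : R) (u : R * R) := e * h ^+ 2 <= `|square_flux P Q u.1 u.2 h|.
pose sd n : R := s / 2 ^+ n.
have sd0 n : 0 < sd n by rewrite divr_gt0// exprn_gt0.
have sdS n : sd n = sd n.+1 + sd n.+1.
  by rewrite /sd exprS; field; rewrite expf_neq0.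
pose step n (u v : R * R) := [/\ u.1 <= v.1, v.1 <= u.1 + sd n.+1,
   u.2 <= v.2, v.2 <= u.2 + sd n.+1 & good (sd n.+1) v].
have nxt n u : exists v, good (sd n) u -> step n u v.
  have [gu|ngu] := pselect (good (sd n) u); last by exists u.
  have [|v vP] := @square_flux_quarter u.1 u.2 (sd n.+1) e (ltW (sd0 _)).
    by move: gu; rewrite /good sdS.
  by exists v.
have [f fP] := choice (fun nu : nat * (R * R) => nxt nu.1 nu.2).
pose u := fix u n := if n is m.+1 then f (m, u m) else (p, q).
have ug n : good (sd n) (u n).
  elim: n => [|n IH /=]; last by have [] := fP (n, u n) IH.
  by rewrite /good/sd /= expr0 divr1 /e divfK// expf_neq0 ?gt_eqF.
have uS n : step n (u n) (u n.+1) by exact: (fP (n, u n) (ug n)).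
have nest (x : nat -> R) : (forall n, x n <= x n.+1 <= x n + sd n.+1) ->
    exists x0, forall n, x n <= x0 <= x n + sd n.
  move=> xS.
  have xle n k : x n <= x (n + k)%N /\ x (n + k)%N + sd (n + k)%N <= x n + sd n.
    elim: k => [|k [IH1 IH2]]; first by rewrite addn0.
    rewrite addnS; have /andP[h1 h2] := xS (n + k)%N.
    by rewrite (le_trans IH1)//; have := sdS (n + k)%N; split=> //; lra.
  have xub n m : x m <= x n + sd n.
    have [nm|/ltnW mn] := leqP n m.
      have [_] := xle n (m - n)%N; rewrite subnKC// => H.
      by have := sd0 m; lra.
    have [+ _] := xle m (n - m)%N; rewrite subnKC// => H.
    by have := sd0 n; lra.
  exists (sup (range x)) => n; apply/andP; split.
    by apply: ub_le_sup; [exists (x n + sd n) => _ [m _ <-]|exists n].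
  by apply: ge_sup; [exists (x 0%N), 0%N|move=> _ [m _ <-]].
have [x0 x0P] : exists x0, forall n, (u n).1 <= x0 <= (u n).1 + sd n.
  by apply: nest => n; have [-> ->] := uS n.
have [y0 y0P] : exists x0, forall n, (u n).2 <= x0 <= (u n).2 + sd n.
  by apply: nest => n; have [_ _ -> ->] := uS n.
have [|d d0 dP] := @square_flux_small x0 y0 (e / 2); first by rewrite divr_gt0.
have [n nd] : exists n, sd n < d.
  exists (Num.bound (s / d)); rewrite ltr_pdivrMr ?exprn_gt0// mulrC.
  rewrite -ltr_pdivrMr//; apply: lt_trans (archi_boundP _) _.
    by rewrite divr_ge0// ltW.
  by rewrite -natrX ltr_nat ltn_expl.
have := dP (u n).1 (u n).2 (sd n) (ltW (sd0 n)) nd (x0P n) (y0P n).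
have := ug n; rewrite /good => h1 h2.
have : 0 < e * sd n ^+ 2 by rewrite mulr_gt0// exprn_gt0.
lra.
Qed.

End Flux.

End Goursat.

(** * Entire functions are determined by their values on a half-plane *)

Section IdentityTheorem.
Variable R : realType.
Implicit Types (d F : R[i]^o -> R[i]^o) (a z h : R[i]^o).

(** A quadratic error bound is the form in which the derivatives of the
    Gaussian below and of the Mellin transform are obtained. *)
Lemma derivable_quadratic F z (l : R[i]^o) (C : R) :
  (forall h, cmod h <= 1 -> cmod (F (z + h) - F z - l * h) <= C * cmod h ^+ 2) ->
  derivable F z 1.
Proof.
move=> H; apply/derivable_cmodP; exists l => e e0.
have K0 : 0 < `|C| + 1 by rewrite ltr_wpDl.
exists (Num.min 1 (e / (`|C| + 1))).
  by rewrite lt_min ltr01 divr_gt0.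
move=> h; rewrite lt_min ltr_pdivlMr// => /andP[h1 he].
apply: le_trans (H h (ltW h1)) _; rewrite expr2 mulrA ler_wpM2r ?cmod_ge0//.
have : C * cmod h <= `|C| * cmod h by rewrite ler_wpM2r ?cmod_ge0// ler_norm.
have := cmod_ge0 h; lra.
Qed.

Lemma derivable_cauchy_riemann F : (forall z, derivable F z 1) ->
  cauchy_riemann_diff (fun x y => complex.Re (F (x +i* y)))
                      (fun x y => complex.Im (F (x +i* y))).
Proof.
move=> dF x0 y0; have /derivable_cmodP[[al be] H] := dF (x0 +i* y0).
exists al, be => e e0; have [d d0 dP] := H e e0; exists (d / 2); first by rewrite divr_gt0.
move=> x y xd yd.
have hle : cmod ((x - x0) +i* (y - y0)) <= `|x - x0| + `|y - y0|.
  exact: cmod_le_ReIm.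
have hE : (x0 +i* y0) + ((x - x0) +i* (y - y0)) = (x +i* y) :> R[i]^o.
  by apply/eqP; rewrite eq_complex/= !subrKC !eqxx.
have /dP : cmod ((x - x0) +i* (y - y0)) < d by lra.
rewrite hE => H1.
have H2 : e * cmod ((x - x0) +i* (y - y0)) <= e * (`|x - x0| + `|y - y0|).
  by rewrite ler_pM2l.
split; apply: le_trans (le_trans H1 H2).
  apply: le_trans (normr_Re_le _).
  by case: (F _) (F _) => a b [a' b'] /=.
apply: le_trans (normr_Im_le _).
by case: (F _) (F _) => a b [a' b'] /=; rewrite [al * _ + _]addrC.
Qed.

Lemma derivable_cexp_sqr (lam : R) a z :
  derivable (fun z : R[i]^o => cexp (lam%:C * (z - a) ^+ 2) : R[i]^o) z 1.
Proof.
set w : R[i]^o := z - a; set E := cexp (lam%:C * w ^+ 2).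
pose K := `|lam| * (2 * cmod w + 1).
have w0 := cmod_ge0 w; have l0 := normr_ge0 lam.
have K0 : 0 <= K by rewrite mulr_ge0//; lra.
apply: (@derivable_quadratic _ z (E * (lam%:C * (2 * w)))
  (cmod E * (5 * K ^+ 2 * expR K + `|lam|))) => h h1.
have h0 := cmod_ge0 h.
pose k : R[i]^o := lam%:C * (2 * w * h + h ^+ 2).
have -> : cexp (lam%:C * (z + h - a) ^+ 2) = E * cexp k.
  rewrite /E -cexpD /k /w; congr cexp; ring.
have -> : E * cexp k - cexp (lam%:C * (z - a) ^+ 2) - E * (lam%:C * (2 * w)) * h
   = E * (cexp k - 1 - k + lam%:C * h ^+ 2) by rewrite -/w -/E /k; ring.
have ck : cmod k <= K * cmod h.
  rewrite /k /K cmodM cmodR -[leRHS]mulrA ler_wpM2l// (le_trans (cmodD _ _))//.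
  rewrite cmodX !cmodM (_ : 2 = (2 : R)%:C) ?cmodR ?ger0_norm//; last first.
    by rewrite rmorphMn/=.
  by rewrite [leRHS]mulrDl mul1r lerD2l expr2 ler_piMl.
have ck1 : cmod k <= K by rewrite (le_trans ck)// ler_piMr.
clearbody K.
rewrite cmodM -mulrA ler_wpM2l ?cmod_ge0// (le_trans (cmodD _ _))//.
rewrite mulrDl cmodM cmodX cmodR lerD2r (le_trans (cmod_cexpB1D_le _))//.
rewrite -!mulrA ler_pM2l//.
rewrite [leLHS]mulrA -expr2.
have -> : K * (K * (expR K * cmod h ^+ 2)) = (K * cmod h) ^+ 2 * expR K by ring.
by rewrite ler_pM ?exprn_ge0 ?expR_ge0 ?cmod_ge0 ?ler_expR// lerXn2r// ?nnegrE ?cmod_ge0// mulr_ge0.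
Qed.

Lemma continuous_seg_bounded (f : R -> R) (a b : R) : a <= b -> continuous f ->
  exists2 M, 0 <= M & forall x, a <= x <= b -> `|f x| <= M.
Proof.
move=> ab cf.
have [|c _ cP] := @EVT_max R (fun x => `|f x|) a b ab.
  apply: continuous_subspaceT => x.
  by apply: continuous_comp; [exact: cf|exact: norm_continuous].
exists (`|f c|) => // x xab; apply: cP; by rewrite in_itv.
Qed.

(** If [d] vanishes for Re z > 1 then the integral of [exp (lam (z - a)^2) d z]
    along the vertical line through [a] is moved to the horizontal sides of a
    large square, where it is exponentially small; on the vertical line the
    Gaussian concentrates at [a]. *)
Lemma entire_halfplane_Im_le0 d a : (forall z, derivable d z 1) ->
  (forall s, 1 < complex.Re s -> d s = 0) -> complex.Im (d a) <= 0.
Proof.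
move=> dd d0.
have [a1|a1] := ltP 1 (complex.Re a); first by rewrite d0.
rewrite leNgt; apply/negP; case: a a1 => x0 y0 /= x01 eta0.
set eta := complex.Im _ in eta0.
have CR := derivable_cauchy_riemann dd.
pose u y := complex.Im (d (x0 +i* y)).
have cu : continuous u by exact: cauchy_riemann_cont2 (cauchy_riemann_diffN CR).
(* The side [2 T] leaves the half-plane of vanishing on the right, and on the
   horizontal sides [(x - x0)^2 - T^2 <= (1 - x0)^2 - (2 - x0)^2 <= - 1]
   wherever [d] need not vanish. *)
pose T := 2 - x0; have T1 : 1 <= T by rewrite /T; lra.
pose hor y x := `|complex.Re (d (x +i* y))| + `|complex.Im (d (x +i* y))|.
have chor y : continuous (hor y).
  move=> x; apply: cvgD.
    by apply: cvg_norm; exact: (cauchy_riemann_cont1 CR).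
  by apply: cvg_norm; exact: (cauchy_riemann_cont1 (cauchy_riemann_diffN CR)).
have [|M1 M10 M1P] := @continuous_seg_bounded u (y0 - T) (y0 + T) _ cu; first lra.
have [|M2 M20 M2P] := @continuous_seg_bounded _ x0 (x0 + 2 * T) _ (chor (y0 - T)); first lra.
have [|M3 M30 M3P] := @continuous_seg_bounded _ x0 (x0 + 2 * T) _ (chor (y0 + T)); first lra.
pose M := M1 + M2 + M3; have M0 : 0 <= M by rewrite /M; lra.
have [de [de0 de1 deP]] : exists de, [/\ 0 < de, de <= 1 &
    forall y, `|y - y0| <= de -> 0 < eta / 2 <= u y].
  have /cvgrPdist_lt /(_ (eta / 2)) := cu y0.
  rewrite divr_gt0// => /(_ isT) /nbhs_ballP[e /= e0 eP].
  exists (Num.min 1 (e / 2)); split.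
  - by rewrite lt_min ltr01 divr_gt0.
  - by rewrite ge_min lexx.
  move=> y; rewrite le_min => /andP[_ ye].
  have /eP : ball y0 e y by rewrite /ball/= distrC; lra.
  have uE : u y0 = eta by [].
  rewrite uE ltr_norml => /andP[_ h]; lra.
(* [lam] makes the contribution of the central segment, of order
   [de * eta * exp (- lam * (de/2)^2)], exceed all the others, which are at most
   [6 * T * M * exp (- lam * de^2)]. *)
pose lam := 16 * T * M / (de * eta) / de ^+ 2.
have lam0 : 0 <= lam by rewrite /lam !divr_ge0 ?mulr_ge0//; lra.
pose F z : R[i]^o := cexp (lam%:C * (z - (x0 +i* y0)) ^+ 2) * d z.
have dF z : derivable F z 1 by apply: derivableM; [exact: derivable_cexp_sqr|].
have CRF := derivable_cauchy_riemann dF.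
have T0 : 0 < 2 * T by lra.
have := square_flux_eq0 CRF x0 (y0 - T) T0; rewrite /square_flux.
set P := fun x y => complex.Re (F (x +i* y)).
set Q := fun x y => complex.Im (F (x +i* y)).
have -> : y0 - T + 2 * T = y0 + T by ring.
have cQ x : continuous (Q x).
  exact: cauchy_riemann_cont2 (cauchy_riemann_diffN CRF).
have cP y : continuous (P ^~ y) by exact: cauchy_riemann_cont1 CRF.
have FE x y : F (x +i* y) = cexp ((lam * ((x - x0) ^+ 2 - (y - y0) ^+ 2)) +i*
     (lam * (2 * (x - x0) * (y - y0)))) * d (x +i* y).
  rewrite /F; congr (cexp _ * _).
  by apply/eqP; rewrite eq_complex/=; apply/andP; split; apply/eqP; ring.
have -> : segint (Q (x0 + 2 * T)) (y0 - T) (y0 + T) = 0.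
  rewrite (_ : Q _ = fun=> 0) ?segint_cst ?mul0r//; first lra.
  by apply/funext => y; rewrite /Q /F d0 ?mulr0//= /T; lra.
have Qx0 y : Q x0 y = expR (- (lam * (y - y0) ^+ 2)) * u y.
  rewrite /Q FE subrr mulr0 mul0r mulr0 expr0n/= sub0r mulrN.
  rewrite /cexp/= cos0 sin0 mulr1 mulr0 /u.
  by case: (d _) => a b /=; rewrite mul0r addr0.
have small x y : x0 <= x <= x0 + 2 * T -> (y - y0) ^+ 2 = T ^+ 2 ->
    hor y x <= M -> `|P x y| <= M * expR (- lam).
  move=> /andP[xx0 _] yT hM.
  apply: le_trans (normr_Re_le _) _; rewrite FE cmodM cmod_cexp /=.
  have [x1|x1] := ltP 1 x; first by rewrite d0// cmod0 mulr0 mulr_ge0 ?expR_ge0.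
  rewrite mulrC ler_pM ?expR_ge0 ?cmod_ge0//.
    exact: le_trans (cmod_le_ReIm _) hM.
  rewrite ler_expR yT -[leRHS]mulrN1 ler_wpM2l//.
  have : (x - x0) ^+ 2 <= (1 - x0) ^+ 2 by rewrite lerXn2r// ?nnegrE; lra.
  by rewrite /T !expr2; lra.
have Hhor : `|segint (P ^~ (y0 - T)) x0 (x0 + 2 * T)
              - segint (P ^~ (y0 + T)) x0 (x0 + 2 * T)| <=
            2 * M * expR (- lam) * (2 * T).
  have := @segint_diff_bound _ _ _ 0 (2 * M * expR (- lam)) x0 (x0 + 2 * T)
    (cP (y0 - T)) (cP (y0 + T)).
  rewrite mul0r subr0 [x0 + 2 * T - x0]addrAC subrr add0r; apply; first lra.
  move=> x xx0; rewrite subr0.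
  have h1 := small x (y0 - T) xx0; have h2 := small x (y0 + T) xx0.
  have h4 := le_trans (ler_norm _) (M2P x xx0).
  have h3 := le_trans (ler_norm _) (M3P x xx0).
  have {}h1 : `|P x (y0 - T)| <= M * expR (- lam).
    by apply: h1; [rewrite addrAC subrr add0r sqrrN|rewrite /M; lra].
  have {}h2 : `|P x (y0 + T)| <= M * expR (- lam).
    by apply: h2; [rewrite addrAC subrr add0r|rewrite /M; lra].
  by have := ler_normB (P x (y0 - T)) (P x (y0 + T)); lra.
pose E := expR (- (lam * de ^+ 2)); pose E4 := expR (- (lam * (de / 2) ^+ 2)).
have E0 : 0 <= E by exact: expR_ge0.
have outer y : y0 - T <= y <= y0 + T -> - (M * E) <= Q x0 y.
  move=> yT; rewrite Qx0.
  have [yd|yd] := leP `|y - y0| de.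
    have := deP y yd => /andP[h1 h2].
    apply: (@le_trans _ _ 0); first by rewrite oppr_le0 mulr_ge0.
    by rewrite mulr_ge0 ?expR_ge0//; lra.
  rewrite lerNl -mulrN mulrC; apply: (@le_trans _ _ (M1 * expR (- (lam * (y - y0) ^+ 2)))).
    rewrite ler_wpM2r ?expR_ge0//; apply: le_trans (M1P y yT).
    by rewrite -normrN ler_norm.
  rewrite ler_pM ?expR_ge0//; first by rewrite /M; lra.
  rewrite ler_expR lerN2 ler_wpM2l// -[leRHS]real_normK ?num_real//.
  by rewrite lerXn2r ?nnegrE//; lra.
have inner y : y0 - de / 2 <= y <= y0 + de / 2 -> E4 * (eta / 2) <= Q x0 y.
  move=> yd; rewrite Qx0.
  have yd2 : `|y - y0| <= de / 2 by rewrite ler_distl.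
  have /deP/andP[h1 h2] : `|y - y0| <= de by lra.
  apply: ler_pM => //; [exact: expR_ge0|exact: ltW|].
  rewrite ler_expR lerN2 ler_wpM2l// -[leLHS]real_normK ?num_real//.
  by rewrite lerXn2r ?nnegrE//; lra.
have low : - (M * E) * (T - de / 2) + E4 * (eta / 2) * de
    + - (M * E) * (T - de / 2) <= segint (Q x0) (y0 - T) (y0 + T).
  rewrite (@segint_split _ (Q x0) (y0 - T) (y0 + T) (y0 - de / 2)) //; try lra.
  rewrite (@segint_split _ (Q x0) (y0 - de / 2) (y0 + T) (y0 + de / 2)) //; try lra.
  rewrite -addrA; apply: lerD; [|apply: lerD].
  - rewrite (_ : T - de / 2 = y0 - de / 2 - (y0 - T)); last by ring.
    apply: segint_ge => //; first lra.
    by move=> y yy; apply: outer; move: yy => /andP[y1 y2]; apply/andP; split; lra.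
  - rewrite (_ : E4 * (eta / 2) * de = E4 * (eta / 2) * (y0 + de / 2 - (y0 - de / 2))).
      by apply: segint_ge => //; lra.
    by congr (_ * _); field.
  - rewrite (_ : T - de / 2 = y0 + T - (y0 + de / 2)); last by ring.
    apply: segint_ge => //; first lra.
    by move=> y yy; apply: outer; move: yy => /andP[y1 y2]; apply/andP; split; lra.
have EL : expR (- lam) <= E.
  by rewrite ler_expR lerN2 ler_piMr// expr_le1// ltW.
rewrite sub0r opprK => flux0.
have key : E4 * (eta / 2) * de <= 6 * T * M * E.
  move: Hhor; rewrite ler_norml => /andP[Hhor _].
  have h1 : 4 * T * M * expR (- lam) <= 4 * T * M * E.
    by rewrite ler_wpM2l// !mulr_ge0//; lra.
  have h2 : 0 <= M * E * de by rewrite !mulr_ge0// ltW.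
  by move: low flux0 h1 h2 Hhor; lra.
have EE : E4 = E * expR (lam * (3 / 4 * de ^+ 2)).
  by rewrite /E4 /E -expRD; congr expR; field.
have lamE : lam * (3 / 4 * de ^+ 2) = 12 * T * M / (de * eta).
  by rewrite /lam; field; rewrite !gt_eqF.
move: key; rewrite EE lamE.
have -> : E * expR (12 * T * M / (de * eta)) * (eta / 2) * de =
  E * (expR (12 * T * M / (de * eta)) * (de * eta / 2)) by field.
rewrite mulrC ler_pM2r ?expR_gt0// leNgt; apply/negP; rewrite negbK.
apply: (@lt_le_trans _ _ ((1 + 12 * T * M / (de * eta)) * (de * eta / 2))).
  have -> : (1 + 12 * T * M / (de * eta)) * (de * eta / 2) =
    de * eta / 2 + 6 * T * M by field; rewrite !gt_eqF.
  by have : 0 < de * eta := mulr_gt0 de0 eta0; lra.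
by rewrite ler_wpM2r ?expR_ge1Dx// divr_ge0// ltW// mulr_gt0.
Qed.

(** The bound on imaginary parts applies to all multiples [c * d], in particular
    for [c] one of [1], [- 1], [i], [- i]. *)
Lemma entire_halfplane_eq0 d : (forall z, derivable d z 1) ->
  (forall s, 1 < complex.Re s -> d s = 0) -> forall a, d a = 0.
Proof.
move=> dd d0 a.
have Hc (c : R[i]^o) : complex.Im (c * d a) <= 0.
  apply: (@entire_halfplane_Im_le0 (fun z => c * d z)) => [z|s s1].
    exact: (@derivableZ _ _ _ d c z 1).
  by rewrite d0 ?mulr0.
have h1 := Hc 1; have h2 := Hc (- 1); have h3 := Hc 'i; have h4 := Hc (- 'i).
apply/eqP; rewrite eq_complex/=; move: h1 h2 h3 h4.
case: (d a) => x y /=.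
by move=> h1 h2 h3 h4; apply/andP; split; apply/eqP; lra.
Qed.

End IdentityTheorem.

(** * Powers of cosines and binomial coefficients *)

Section CosineSums.
Variable R : realType.
Implicit Types (x t : R) (n m N i j k : nat).

Lemma cos_mul_cos x t : 2 * cos x * cos t = cos (t + x) + cos (t - x).
Proof. rewrite cosD cosB; ring. Qed.

(** The binomial expansion of [(e^(it) + e^(-it))^n], without exponentials. *)
Lemma expr_2cos n t :
  (2 * cos t) ^+ n = \sum_(0 <= k < n.+1) 'C(n, k)%:R * cos ((n%:R - 2 * k%:R) * t).
Proof.
elim: n => [|n IH].
  by rewrite big_nat1 expr0 bin0 mulr0 subr0 mul0r cos0 mulr1.
rewrite exprS IH big_distrr/=.
under eq_bigr => k _ do rewrite mulrCA cos_mul_cos mulrDr.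
rewrite big_split/= [in RHS]big_nat_recl// bin0.
under [in RHS]eq_bigr => k _ do rewrite binS natrD mulrDl.
rewrite big_split/= [X in _ = _ + (X + _)]big_nat_recr//= bin_small// mul0r addr0.
rewrite [X in X + _ = _]big_nat_recl// bin0 -!addrA; congr (_ + _).
  by congr (_ * cos _); rewrite -natr1; ring.
congr (_ + _); apply: eq_big_nat => k _; congr (_ * cos _).
  by rewrite -(natr1 k) -(natr1 n); ring.
by rewrite -(natr1 k) -(natr1 n); ring.
Qed.

Lemma expr_2cos_even m t :
  (2 * cos t) ^+ (m + m) = 'C(m + m, m)%:R
    + 2 * \sum_(0 <= i < m) 'C(m + m, m + i.+1)%:R * cos (2 * i.+1%:R * t).
Proof.
rewrite expr_2cos (big_cat_nat (n := m))//=; last by rewrite leqW// leq_addr.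
rewrite [X in _ + X]big_ltn; last by rewrite ltnS leq_addr.
have -> : ((m + m)%:R - 2 * m%:R) * t = 0 by rewrite natrD; ring.
rewrite cos0 mulr1 addrCA; congr (_ + _).
rewrite mulr_natl mulr2n; congr (_ + _).
  rewrite big_nat_rev/= add0n; apply: eq_big_nat => i im.
  have mi : (m - i.+1 <= m + m)%N by rewrite (leq_trans (leq_subr _ _))// leq_addr.
  congr (_%:R * cos _).
    rewrite -bin_sub//; congr 'C(_, _); move: im; rewrite /=; lia.
  by rewrite natrB// natrD; ring.
rewrite -[m.+1]add0n big_addn subSS addnK; apply: eq_bigr => i _.
rewrite -cosN addnC addSnnS; congr (_ * cos _).
by rewrite !natrD; ring.
Qed.

Lemma sin_natpi k : sin (pi * k%:R) = 0 :> R.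
Proof.
elim: k => [|k IH]; first by rewrite mulr0 sin0.
by rewrite -natr1 mulrDr mulr1 sinDpi IH oppr0.
Qed.

Lemma cos_natpi k : cos (pi * k%:R) = (-1) ^+ k :> R.
Proof.
elim: k => [|k IH]; first by rewrite mulr0 cos0.
by rewrite -natr1 mulrDr mulr1 cosDpi IH exprS mulN1r.
Qed.

Lemma sin_mul_dirichlet n t :
  sin t * (1 + 2 * \sum_(0 <= j < n) cos (2 * j.+1%:R * t))
  = sin ((2 * n%:R + 1) * t).
Proof.
elim: n => [|n IH]; first by rewrite big_geq// !mulr0 addr0 add0r mulr1 mul1r.
rewrite big_nat_recr//= [2 * (_ + _)]mulrDr addrA mulrDr IH -(natr1 n).
have -> : (2 * (n%:R + 1) + 1) * t = 2 * (n%:R + 1) * t + t by ring.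
have -> : (2 * n%:R + 1) * t = 2 * (n%:R + 1) * t - t by ring.
by rewrite sinB sinD; ring.
Qed.

(** The Dirichlet kernel at the multiples of [2 pi / N], [N = 2n + 1]. *)
Lemma sum_cos_dirichlet n i :
  1 + 2 * \sum_(0 <= j < n) cos (2 * i%:R * (pi * j.+1%:R / n.*2.+1%:R)) =
  if (n.*2.+1 %| i)%N then n.*2.+1%:R else 0 :> R.
Proof.
set N := n.*2.+1; have N0 : (N%:R : R) != 0 by rewrite pnatr_eq0.
have NE : (N%:R : R) = 2 * n%:R + 1 by rewrite /N -natr1 -muln2 natrM mulrC.
case: ifPn => [/dvdnP[q ->]|Ni].
  rewrite (eq_bigr (fun=> 1)); last first.
    move=> j _; rewrite (_ : _ * (_ / _) = pi * (q * j.+1 * 2)%:R); last first.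
      by rewrite !natrM; field.
    by rewrite cos_natpi mulnC exprM sqrrN !expr1n.
  by rewrite big_const_nat subn0 iter_addr_0 NE addrC.
pose t : R := pi * i%:R / N%:R.
have st : sin t != 0.
  have iE := divn_eq i N; set q := (i %/ N)%N in iE; set r := (i %% N)%N in iE.
  have r0 : (0 < r)%N by rewrite lt0n.
  have rN : (r < N)%N by exact: ltn_pmod.
  have -> : t = pi * q%:R + pi * r%:R / N%:R.
    by rewrite /t iE natrD natrM; field.
  rewrite sinD sin_natpi mul0r add0r cos_natpi mulf_neq0 ?expf_neq0 ?oppr_eq0//.
  rewrite gt_eqF// sin_gt0_pi// divr_gt0 ?mulr_gt0 ?pi_gt0 ?ltr0n//=.
  by rewrite ltr_pdivrMr ?ltr0n// ltr_pM2l ?pi_gt0// ltr_nat.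
apply: (mulfI st); rewrite mulr0.
rewrite (eq_bigr (fun j => cos (2 * j.+1%:R * t))); last first.
  by move=> j _; congr cos; rewrite /t; field.
rewrite sin_mul_dirichlet -NE (_ : N%:R * t = pi * i%:R) ?sin_natpi//.
by rewrite /t; field.
Qed.

Lemma sum_dvdn_multiples N M (f : nat -> R) : (0 < N)%N ->
  \sum_(0 <= i < M * N) (if (N %| i.+1)%N then f i.+1 else 0)
  = \sum_(0 <= l < M) f (l.+1 * N)%N.
Proof.
move=> N0; elim: M => [|M IH]; first by rewrite mul0n !big_geq.
rewrite [RHS]big_nat_recr//= (big_cat_nat (n := (M * N)%N))//=; last first.
  by rewrite leq_mul2r leqnSn orbT.
rewrite IH; congr (_ + _).
rewrite -[(M * N)%N]add0n mulSn big_addn addnK.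
case: N N0 {IH} => // N _.
rewrite big_nat_recr//= big_nat_cond big1 ?add0r; last first.
  move=> i /andP[/andP[_ iN] _]; rewrite ifF//.
  by rewrite -addSn dvdn_addl ?dvdn_mull//; apply/negP => /dvdn_leq; lia.
by rewrite -addSn dvdn_addr// dvdn_mull// mulSn.
Qed.

(** Summing the binomial expansion of [(2 cos)^(2m)] over the angles
    [pi j / N], [|j| <= n], keeps only the coefficients at multiples of [N]. *)
Lemma polya_identity n m : let N := n.*2.+1 in
  4 ^+ m * (1 + 2 * \sum_(0 <= j < n) cos (pi * j.+1%:R / N%:R) ^+ (m + m)) =
  N%:R * ('C(m + m, m)%:R
          + 2 * \sum_(0 <= l < m) 'C(m + m, m + l.+1 * N)%:R) :> R.
Proof.
move=> N.
have e4 t : 4 ^+ m * cos t ^+ (m + m) = 'C(m + m, m)%:R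
    + 2 * \sum_(0 <= i < m) 'C(m + m, m + i.+1)%:R * cos (2 * i.+1%:R * t).
  rewrite -expr_2cos_even exprMn; congr (_ * _).
  by rewrite exprD -exprMn; congr (_ ^+ _); ring.
have e40 : 4 ^+ m = 'C(m + m, m)%:R
    + 2 * \sum_(0 <= i < m) 'C(m + m, m + i.+1)%:R :> R.
  have := e4 0; rewrite cos0 expr1n mulr1 => ->; congr (_ + _ * _).
  by apply: eq_bigr => i _; rewrite mulr0 cos0 mulr1.
rewrite mulrDr mulr1 mulrCA big_distrr/=.
under [X in _ + 2 * X]eq_bigr => j _ do rewrite e4.
rewrite big_split/= -big_distrr/= exchange_big/= {1}e40.
rewrite big_const_nat subn0 iter_addr_0.
transitivity (N%:R * 'C(m + m, m)%:R + 2 * \sum_(0 <= i < m) 'C(m + m, m + i.+1)%:R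
   * (1 + 2 * \sum_(0 <= j < n) cos (2 * i.+1%:R * (pi * j.+1%:R / N%:R))) : R).
  under [in RHS]eq_bigr => i _ do rewrite mulrDr mulr1 mulrCA mulr_sumr.
  have NE : N%:R = 2 * n%:R + 1 :> R by rewrite /N -natr1 -muln2 natrM mulrC.
  rewrite big_split/= -big_distrr/= NE.
  by rewrite -mulr_natr; ring.
have sN i : 1 + 2 * \sum_(0 <= j < n) cos (2 * i%:R * (pi * j.+1%:R / N%:R)) =
  if (N %| i)%N then N%:R else 0 :> R by exact: sum_cos_dirichlet.
transitivity (N%:R * 'C(m + m, m)%:R + 2 * \sum_(0 <= i < m)
    'C(m + m, m + i.+1)%:R * (if (N %| i.+1)%N then N%:R else 0) : R).
  by congr (_ + 2 * _); apply: eq_bigr => i _; rewrite sN.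
rewrite [RHS]mulrDr mulrCA; congr (_ + 2 * _).
rewrite -(@sum_dvdn_multiples N m (fun i => 'C(m + m, m + i)%:R)) ?ltnS// big_distrr/=.
rewrite [RHS](big_cat_nat (n := m))//=; last by rewrite leq_pmulr.
rewrite [X in _ + X]big_nat_cond [X in _ + X]big1 ?addr0; last first.
  move=> i /andP[/andP[mi _] _]; rewrite bin_small ?if_same ?mulr0//.
  by rewrite ltn_add2l.
by apply: eq_bigr => i _; rewrite -/N; case: ifP => _; rewrite ?mulr0// mulrC.
Qed.

End CosineSums.

(** * Tannery's theorem and Gaussian bounds *)

Section Tannery.
Variable R : realType.
Implicit Types (b l : R^nat) (a : nat -> nat -> R).

Lemma series_diff_le (u b : R^nat) J K : (J <= K)%N -> cvgn (series b) ->
  (forall j, `|u j| <= b j) ->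
  `|series u K - series u J| <= limn (series b) - series b J.
Proof.
move=> JK cb ub.
have b0 j : 0 <= b j by rewrite (le_trans _ (ub j)).
have -> : series u K - series u J = \sum_(J <= j < K) u j.
  by rewrite /series/= (big_cat_nat (n := J))//= addrAC subrr add0r.
apply: le_trans (ler_norm_sum _ _ _) _.
apply: (@le_trans _ _ (series b K - series b J)).
  rewrite (_ : _ - _ = \sum_(J <= j < K) b j); first exact: ler_sum.
  by rewrite /series/= (big_cat_nat (n := J))//= addrAC subrr add0r.
rewrite lerD2r; apply: nondecreasing_cvgn_le => //.
exact: nondecreasing_series.
Qed.

Lemma dominated_cvg_series (u b : R^nat) : cvgn (series b) ->
  (forall j, `|u j| <= b j) -> cvgn (series u).
Proof.
move=> cb ub; apply: normed_cvg; apply: (series_le_cvg _ _ ub cb) => // j.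
exact: le_trans (ub j).
Qed.

Lemma series_tail_le (u b : R^nat) J : cvgn (series b) ->
  (forall j, `|u j| <= b j) ->
  `|limn (series u) - series u J| <= limn (series b) - series b J.
Proof.
move=> cb ub; have cu := dominated_cvg_series cb ub.
have cN : (fun K => `|series u K - series u J|) @ \oo -->
    `|limn (series u) - series u J|.
  by apply: cvg_norm; apply: cvgB => //; exact: cvg_cst.
apply: (@cvgr_to_le _ _ _ _ _ _ _ cN).
by exists J => // K /= JK; exact: series_diff_le.
Qed.

(** Dominated convergence for sums whose length may grow with the parameter. *)
Lemma tannery a l b (K : nat -> nat) :
  (forall j, a ^~ j @ \oo --> l j) ->
  (\forall n \near \oo, forall j, `|a n j| <= b j) -> cvgn (series b) ->
  (forall n j, (K n <= j)%N -> a n j = 0) ->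
  (fun n => \sum_(0 <= j < K n) a n j) @ \oo --> limn (series l).
Proof.
move=> al ab cb aK.
have lb j : `|l j| <= b j.
  apply: (@cvgr_to_le _ _ _ _ _ _ _ (cvg_norm (al j))).
  by apply: filterS ab => n; exact.
apply/cvgrPdist_le => e e0.
have e3 : 0 < e / 3 by rewrite divr_gt0.
have [J _ /(_ J (leqnn J))/= JP] := (@cvgrPdist_le _ _ _ _ _ _ _).1 cb _ e3.
have {}JP : limn (series b) - series b J <= e / 3.
  by apply: le_trans JP; exact: ler_norm.
have cJ : (fun n => series (a n) J) @ \oo --> series l J.
  elim: (J) => [|j IH].
    rewrite (_ : (fun n => _) = cst 0); first by rewrite /series/= big_geq//; exact: cvg_cst.
    by apply/funext => n; rewrite /series/= big_geq.
  rewrite (_ : (fun n => _) = (fun n => series (a n) j + a n j)); last first.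
    by apply/funext => n; rewrite seriesSr.
  by rewrite seriesSr; apply: cvgD.
move/cvgrPdist_le : (cJ) => /(_ _ e3) cJ3.
near=> n.
have an : forall j, `|a n j| <= b j by near: n.
have H : `|series l J - series (a n) J| <= e / 3 by near: n.
have h1 : `|series (a n) (K n) - series (a n) J| <= e / 3.
  have [JK|/ltnW KJ] := leqP J (K n).
    exact: le_trans (series_diff_le JK cb an) JP.
  rewrite (_ : series (a n) (K n) = series (a n) J) ?subrr ?normr0 ?ltW//.
  rewrite [RHS]/series/= (big_cat_nat (n := K n))//= [X in _ + X]big_nat_cond.
  by rewrite [X in _ + X]big1 ?addr0// => j /andP[/andP[/aK]].
have h2 := le_trans (series_tail_le J cb lb) JP.
have -> : limn (series l) - \sum_(0 <= j < K n) a n j =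
  (limn (series l) - series l J) + (series l J - series (a n) J)
   - (series (a n) (K n) - series (a n) J) by rewrite /series/=; ring.
have := ler_normB ((limn (series l) - series l J) + (series l J - series (a n) J))
   (series (a n) (K n) - series (a n) J).
have := ler_normD (limn (series l) - series l J) (series l J - series (a n) J).
move: h1 h2 H; lra.
Unshelve. all: by end_near. Qed.

Lemma cvg_gauss_series (c : R) : 0 < c ->
  cvgn (series (fun j => expR (- (c * j.+1%:R ^+ 2)))).
Proof.
move=> c0; pose z := expR (- c).
have z1 : `|z| < 1 by rewrite ger0_norm ?expR_ge0// expR_lt1 oppr_lt0.
apply: (series_le_cvg _ _ _ (is_cvg_geometric_series (a := 1) z1)) => j.
- exact: expR_ge0.
- by rewrite /geometric/= mul1r exprn_ge0// expR_ge0.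
rewrite /geometric/= mul1r -expRM_natl ler_expR mulrN lerN2 mulrC ler_pM2l//.
rewrite -natrX ler_nat; nia.
Qed.

End Tannery.

Section GaussianBounds.
Variable R : realType.
Implicit Types (x : R) (m L : nat).

Lemma mul_cos_le_sin x : 0 <= x <= pi -> x * cos x <= sin x.
Proof.
move=> /andP[x0 xpi]; rewrite -subr_ge0.
have [||c /itvP cx] := @MVT_segment R (fun x => sin x - x * cos x)
    (fun x => x * sin x) 0 x x0.
- by move=> y _; apply: is_derive_eq; rewrite /GRing.scale/=; ring.
- by apply: continuous_subspaceT => y; apply: cvgB; [|apply: cvgM => //];
    [exact: continuous_sin|exact: continuous_cos].
rewrite sin0 mul0r !subr0 => ->; rewrite !mulr_ge0// ?cx//.
by rewrite sin_ge0_pi// cx/= (le_trans _ xpi)// cx.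
Qed.

(** The derivative of [cos x * exp (x^2 / 2)] has the sign of [x cos x - sin x]. *)
Lemma cos_le_gauss x : 0 <= x <= pi -> cos x <= expR (- (x ^+ 2 / 2)).
Proof.
move=> /andP[x0 xpi]; rewrite expRN -[leRHS]div1r ler_pdivlMr ?expR_gt0//.
rewrite -subr_le0.
pose g (x : R) := cos x * expR (x ^+ 2 / 2).
pose dg (x : R) := expR (x ^+ 2 / 2) * (x * cos x - sin x).
have gd (y : R) : is_derive y 1 g (dg y).
  rewrite /g; apply: is_derive_eq.
  by rewrite /dg /GRing.scale/=; field.
have [|c /itvP cx] := @MVT_segment R g dg 0 x x0.
  apply: derivable_within_continuous => y _; exact: (@ex_derive _ _ _ _ _ _ _ (gd y)).
rewrite /g cos0 expr0n/= mul0r expR0 mulr1 => ->.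
rewrite subr0 mulr_le0_ge0// mulr_ge0_le0 ?expR_ge0// subr_le0 mul_cos_le_sin//.
by rewrite cx/= (le_trans _ xpi)// cx.
Qed.

Lemma cos_ge_quadratic x : 1 - x ^+ 2 / 2 <= cos x.
Proof.
have -> : cos x = 1 - 2 * sin (x / 2) ^+ 2.
  have {1}-> : x = (x / 2) *+ 2 by rewrite -mulr_natr; field.
  by rewrite cos_mulr2n cos2sin2 -mulr_natr; ring.
have : sin (x / 2) ^+ 2 <= (x / 2) ^+ 2.
  rewrite -[leLHS]real_normK ?num_real// -[leRHS]real_normK ?num_real//.
  by rewrite lerXn2r ?nnegrE// normr_sin_le.
rewrite !expr2; lra.
Qed.

Lemma oneB_ge_exp x : x < 1 -> expR (- (x / (1 - x))) <= 1 - x.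
Proof.
move=> x1; have x10 : 0 < 1 - x by lra.
rewrite expRN invf_ple ?posrE ?expR_gt0//; apply: le_trans (expR_ge1Dx _).
by rewrite le_eqVlt; apply/orP; left; apply/eqP; field; rewrite gt_eqF.
Qed.

(** Normalised by the central coefficient, binomial coefficients have a Gaussian
    profile in [L / sqrt m]; the two bounds below differ from
    [exp (- L^2 / m)] by the relative size of [K >= L] with respect to [m]. *)
Definition bin_ratio m L : R := 'C(m + m, m + L)%:R / 'C(m + m, m)%:R.

Lemma bin_ratio0 m : bin_ratio m 0 = 1.
Proof. by rewrite /bin_ratio addn0 mulfV// pnatr_eq0 -lt0n bin_gt0 leq_addr. Qed.

Lemma bin_ratioS m L : (L <= m)%N ->
  bin_ratio m L.+1 = bin_ratio m L * ((m%:R - L%:R) / (m%:R + L.+1%:R)).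
Proof.
move=> Lm; have := mul_bin_left (m + m) (m + L).
rewrite subnDl -addnS => /(congr1 (fun n => n%:R : R)).
rewrite !natrM natrB// natrD => H.
have mL : m%:R + L.+1%:R != 0 :> R by rewrite -natrD pnatr_eq0 addnS.
rewrite /bin_ratio [X in X / _ = _](_ : _ =
  (m%:R - L%:R) * 'C(m + m, m + L)%:R / (m%:R + L.+1%:R)); last first.
  by rewrite -H mulrAC mulfV ?mul1r.
have c0 : 'C(m + m, m)%:R != 0 :> R by rewrite pnatr_eq0 -lt0n bin_gt0 leq_addr.
by set d := _ + L.+1%:R in mL *; field; rewrite mL c0.
Qed.

Lemma bin_ratio_ge0 m L : 0 <= bin_ratio m L.
Proof. by rewrite divr_ge0. Qed.

Lemma bin_ratio_small m L : (m < L)%N -> bin_ratio m L = 0.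
Proof. by move=> mL; rewrite /bin_ratio bin_small ?mul0r// ltn_add2l. Qed.

Lemma bin_ratio_le m L K : (L <= K <= m)%N ->
  bin_ratio m L <= expR (- (L%:R ^+ 2 / (m%:R + K%:R))).
Proof.
elim: L => [|L IH] /andP[LK Km].
  by rewrite bin_ratio0 expr0n/= mul0r oppr0 expR0.
have m0 : (0 < m)%N by lia.
have Lm : (L <= m)%N by lia.
have mK : 0 < m%:R + K%:R :> R by rewrite -natrD ltr0n; lia.
have mL : 0 < m%:R + L.+1%:R :> R by rewrite -natrD ltr0n; lia.
have KL : L.+1%:R <= K%:R :> R by rewrite ler_nat.
have LS : L.+1%:R = L%:R + 1 :> R by rewrite natr1.
have LmR : L%:R <= m%:R :> R by rewrite ler_nat.
rewrite bin_ratioS// (_ : - _ = - (L%:R ^+ 2 / (m%:R + K%:R))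
  + - ((2 * L%:R + 1) / (m%:R + K%:R))); last first.
  by rewrite LS; field; rewrite gt_eqF.
rewrite expRD ler_pM ?bin_ratio_ge0 ?divr_ge0 ?IH ?subr_ge0//; try lia; try lra.
apply: le_trans (expR_ge1Dx _); rewrite ler_pdivrMr// LS.
have : (2 * L%:R + 1) / (m%:R + K%:R) * (m%:R + L.+1%:R) <= 2 * L%:R + 1 :> R.
  rewrite mulrAC ler_pdivrMr// ler_wpM2l//; last lra.
by lra.
Qed.

Lemma bin_ratio_ge m L K : (L <= K < m)%N ->
  expR (- (L%:R ^+ 2 / (m%:R - K%:R))) <= bin_ratio m L.
Proof.
elim: L => [|L IH] /andP[LK Km].
  by rewrite bin_ratio0 expr0n/= mul0r oppr0 expR0.
have Lm : (L <= m)%N by lia.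
have KL : L.+1%:R <= K%:R :> R by rewrite ler_nat.
have KmR : K%:R < m%:R :> R by rewrite ltr_nat.
have mK : 0 < m%:R - K%:R :> R by lra.
have LS : L.+1%:R = L%:R + 1 :> R by rewrite natr1.
have L0 : 0 <= L%:R :> R by [].
rewrite bin_ratioS// (_ : - _ = - (L%:R ^+ 2 / (m%:R - K%:R))
  + - ((2 * L%:R + 1) / (m%:R - K%:R))); last first.
  by rewrite LS; field; rewrite gt_eqF.
rewrite expRD ler_pM ?expR_ge0 ?IH//; try lia.
pose y : R := (2 * L%:R + 1) / (m%:R + L.+1%:R).
have yE : (m%:R - L%:R) / (m%:R + L.+1%:R) = 1 - y.
  by rewrite /y LS; field; rewrite gt_eqF//; lra.
have y1 : y < 1 by rewrite /y ltr_pdivrMr; lra.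
rewrite yE; apply: le_trans (oneB_ge_exp y1).
have -> : y / (1 - y) = (2 * L%:R + 1) / (m%:R - L%:R).
  by rewrite -yE /y LS; field; rewrite !gt_eqF//; lra.
rewrite ler_expR lerN2.
by rewrite ler_pM2l ?lef_pV2 ?posrE; lra.
Qed.

End GaussianBounds.

(** * Jacobi's theta transformation *)

Section GaussSum.
Variable R : realType.

Definition gauss_sum (c : R) : R := limn (series (fun j => expR (- (c * j.+1%:R ^+ 2)))).

Lemma gauss_sum_ge0 (c : R) : 0 < c -> 0 <= gauss_sum c.
Proof.
move=> c0; apply: limr_ge; first exact: cvg_gauss_series.
by apply: nearW => n; apply: sumr_ge0 => j _; exact: expR_ge0.
Qed.

(** With [M = m + 1], [polya_identity] is applied to [M] and to the odd number
    [N = 2 n + 1] closest to [r * sqrt M]. The sum of cosine powers then tends to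
    [gauss_sum (pi^2 / r^2)] and the sum of binomial ratios to
    [gauss_sum (r^2)]. *)
Variable r : R.
Hypothesis r0 : 0 < r.

Let s (m : nat) : R := Num.sqrt m.+1%:R.
Let n (m : nat) : nat := Num.truncn (r * s m / 2).
Let N (m : nat) : nat := (n m).*2.+1.
Let rho (m : nat) : R := (N m)%:R / s m.

Let s0 m : 0 < s m. Proof. by rewrite sqrtr_gt0 ltr0n. Qed.
Let s2 m : s m ^+ 2 = m.+1%:R. Proof. by rewrite sqr_sqrtr. Qed.

Let sV_cvg : (fun m => (s m)^-1) @ \oo --> (0 : R).
Proof.
rewrite (_ : (fun m => _) = Num.sqrt \o @harmonic R); last first.
  by apply/funext => m; rewrite /= /harmonic sqrtrV.
rewrite -(@sqrtr0 R); apply: continuous_cvg; first exact: sqrt_continuous.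
exact: cvg_harmonic.
Qed.

Let n_itv m : (n m)%:R <= r * s m / 2 < (n m)%:R + 1.
Proof. by rewrite natr1; apply: truncn_itv; rewrite divr_ge0// mulr_ge0// ltW. Qed.

Let NE m : (N m)%:R = 2 * (n m)%:R + 1 :> R.
Proof. by rewrite /N -natr1 -muln2 natrM mulrC. Qed.

Let rho_dist m : `|r - rho m| <= (s m)^-1.
Proof.
have /andP[h1 h2] := n_itv m; have h3 := s0 m.
rewrite /rho NE -(ler_pM2r h3) -{2}(gtr0_norm h3) -normrM mulVf ?gt_eqF//.
rewrite mulrBl divfK ?gt_eqF// ler_norml; apply/andP; split; lra.
Qed.

Let rho_cvg : rho @ \oo --> r.
Proof.
apply/cvgrPdist_le => e e0; move/cvgrPdist_le : sV_cvg => /(_ _ e0).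
apply: filterS => m; rewrite sub0r normrN gtr0_norm ?invr_gt0//.
exact: le_trans.
Qed.

Let rho_near : \forall m \near \oo, r / 2 <= rho m <= 2 * r.
Proof.
have r20 : 0 < r / 2 by rewrite divr_gt0.
move/cvgrPdist_le : rho_cvg => /(_ _ r20); apply: filterS => m.
by rewrite ler_distlC => /andP[h1 h2]; apply/andP; split; lra.
Qed.

Let n_large j : \forall m \near \oo, (j < n m)%N.
Proof.
have e0 : 0 < r / (2 * j.+2%:R) by rewrite divr_gt0// mulr_gt0.
move/cvgrPdist_lt : sV_cvg => /(_ _ e0); apply: filterS => m.
rewrite sub0r normrN gtr0_norm ?invr_gt0// ltr_pdivlMr ?mulr_gt0//.
rewrite mulrC ltr_pdivrMr// => h; have /andP[_ h2] := n_itv m.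
move: h; rewrite -ltnS -(ltr_nat R) -(natr1 (n m)) -(natr1 j.+1); lra.
Qed.

Let x m j : R := pi * j.+1%:R / (N m)%:R.
Let X m j : R := pi ^+ 2 * j.+1%:R ^+ 2 / rho m ^+ 2.

Let N0 m : 0 < (N m)%:R :> R. Proof. by rewrite ltr0n. Qed.
Let rho0 m : 0 < rho m. Proof. by rewrite divr_gt0. Qed.

Let XE m j : m.+1%:R * x m j ^+ 2 = X m j.
Proof. by rewrite -s2 /x /X /rho; field; rewrite !gt_eqF. Qed.

Let X_cvg j : X ^~ j @ \oo --> pi ^+ 2 / r ^+ 2 * j.+1%:R ^+ 2.
Proof.
rewrite mulrAC; apply: cvgM; first exact: cvg_cst.
apply: cvgV; first by rewrite expf_neq0// gt_eqF.
by apply: cvgM.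
Qed.

Let x_le m j : (j < n m)%N -> 0 <= x m j <= pi.
Proof.
move=> jn; have p0 := pi_gt0 R; apply/andP; split.
  by rewrite divr_ge0// mulr_ge0// ltW.
rewrite ler_pdivrMr// ler_pM2l// ler_nat /N; lia.
Qed.

Let a m j : R := if (j < n m)%N then cos (x m j) ^+ (m.+1 + m.+1) else 0.

Let cos_ge0 m j : (j < n m)%N -> 0 <= cos (x m j).
Proof.
move=> jn; apply: cos_ge0_pihalf.
have p0 := pi_gt0 R; have /andP[h1 _] := x_le jn; apply/andP; split; first lra.
rewrite /x -mulrA ler_pM2l// ler_pdivrMr// [leRHS]mulrC ler_pdivlMr//.
by rewrite -natrM ler_nat /N; lia.
Qed.

Let a_le m j : 0 <= a m j <= expR (- X m j).
Proof.
rewrite /a; case: ifPn => [jn|_]; last by rewrite lexx expR_ge0.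
have c0 := cos_ge0 jn; rewrite exprn_ge0//=.
apply: le_trans (_ : expR (- (x m j ^+ 2 / 2)) ^+ (m.+1 + m.+1) <= _).
  by rewrite lerXn2r ?nnegrE ?expR_ge0// cos_le_gauss// x_le.
rewrite -expRM_natl ler_expR -XE natrD.
by rewrite le_eqVlt; apply/orP; left; apply/eqP; field.
Qed.

Let a_ge m j : (j < n m)%N -> x m j ^+ 2 / 2 < 1 ->
  expR (- (X m j / (1 - x m j ^+ 2 / 2))) <= a m j.
Proof.
move=> jn y1; rewrite /a jn.
have -> : - (X m j / (1 - x m j ^+ 2 / 2)) = (m.+1 + m.+1)%:R *
    - (x m j ^+ 2 / 2 / (1 - x m j ^+ 2 / 2)).
  rewrite -XE natrD; field.
  by have /lt0r_neq0 : 0 < 2 - x m j ^+ 2 by lra.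
rewrite expRM_natl lerXn2r ?nnegrE ?expR_ge0 ?cos_ge0//.
exact: le_trans (oneB_ge_exp y1) (cos_ge_quadratic _).
Qed.

Let a_cvg j : a ^~ j @ \oo --> expR (- (pi ^+ 2 / r ^+ 2 * j.+1%:R ^+ 2)).
Proof.
have yc : (fun m => x m j ^+ 2 / 2) @ \oo --> (0 : R).
  rewrite (_ : (fun m => _) = (fun m => X m j * harmonic m / 2)); last first.
    by apply/funext => m; rewrite -XE /harmonic/= [m.+1%:R * _]mulrC mulfK// pnatr_eq0.
  rewrite -[0](mul0r (2^-1)); apply: cvgM; last exact: cvg_cst.
  rewrite -[0](mulr0 (pi ^+ 2 / r ^+ 2 * j.+1%:R ^+ 2)); apply: cvgM => //.
  exact: cvg_harmonic.
apply: (@squeeze_cvgr _ _ _ _ (fun m => expR (- (X m j / (1 - x m j ^+ 2 / 2))))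
  (fun m => expR (- X m j))).
- near=> m; have -> := (andP (a_le m j)).2; rewrite andbT; apply: a_ge.
    by near: m; exact: n_large.
  suff : `|0 - x m j ^+ 2 / 2| < 1 by rewrite sub0r normrN => /(le_lt_trans (ler_norm _)).
  by near: m; move/cvgrPdist_lt : yc; apply.
- apply: continuous_cvg; first exact: continuous_expR.
  apply: cvgN; rewrite -[X in _ --> X]divr1; apply: cvgM => //.
  apply: cvgV; first by rewrite oner_eq0.
  by rewrite -[X in _ --> X]subr0; apply: cvgB => //; exact: cvg_cst.
- apply: continuous_cvg; first exact: continuous_expR.
  exact: cvgN.
Unshelve. all: by end_near. Qed.

Let cos_sum_cvg : (fun m => \sum_(0 <= j < n m) cos (pi * j.+1%:R / (N m)%:R) ^+ (m.+1 + m.+1))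
  @ \oo --> gauss_sum (pi ^+ 2 / r ^+ 2).
Proof.
rewrite (_ : (fun m => _) = (fun m => \sum_(0 <= j < n m) a m j)); last first.
  by apply/funext => m; apply: eq_big_nat => j /andP[_ jn]; rewrite /a jn.
have p0 := pi_gt0 R.
pose b j := expR (- (pi ^+ 2 / (4 * r ^+ 2) * j.+1%:R ^+ 2)) : R.
apply: (@tannery _ _ _ b) => //.
- apply: filterS rho_near => m /andP[h1 h2] j.
  have /andP[a0 a1] := a_le m j; rewrite ger0_norm//; apply: le_trans a1 _.
  rewrite ler_expR lerN2 /X mulrAC ler_pM2l ?mulr_gt0 ?exprn_gt0//.
  have rho2 := exprn_gt0 2 (rho0 m).
  rewrite lef_pV2 ?posrE//; last by rewrite mulr_gt0 ?exprn_gt0.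
  have -> : 4 * r ^+ 2 = (2 * r) ^+ 2 by ring.
  by rewrite lerXn2r// ?nnegrE ?ltW// mulr_gt0.
- apply: (@cvg_gauss_series R (pi ^+ 2 / (4 * r ^+ 2))).
  by rewrite divr_gt0 ?mulr_gt0 ?exprn_gt0.
- by move=> m j nj; rewrite /a ltnNge nj.
Qed.

Let q m l := bin_ratio R m.+1 (l.+1 * N m).

Let LE m l : (l.+1 * N m)%:R = l.+1%:R * rho m * s m :> R.
Proof. by rewrite natrM /rho -mulrA divfK ?gt_eqF. Qed.

Let q_le m l : 0 <= q m l <= expR (- (rho m ^+ 2 / 2 * l.+1%:R ^+ 2)).
Proof.
rewrite bin_ratio_ge0/= /q.
have [mL|Lm] := ltnP m.+1 (l.+1 * N m); first by rewrite bin_ratio_small ?expR_ge0.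
apply: le_trans (@bin_ratio_le _ _ _ (m.+1) _) _; first by rewrite Lm leqnn.
rewrite ler_expR lerN2 LE -(s2 m).
rewrite le_eqVlt; apply/orP; left; apply/eqP; field.
by rewrite gt_eqF// addr_gt0// exprn_gt0.
Qed.

Let q_cvg l : q ^~ l @ \oo --> expR (- (r ^+ 2 * l.+1%:R ^+ 2)).
Proof.
pose d m := l.+1%:R * rho m * (s m)^-1.
have dc : d @ \oo --> (0 : R).
  rewrite -[0](mulr0 (l.+1%:R * r)); apply: cvgM => //.
  by apply: cvgM => //; exact: cvg_cst.
have E m (sg : R) : 1 + sg * d m != 0 -> (l.+1 * N m)%:R ^+ 2 / (m.+1%:R + sg * (l.+1 * N m)%:R)
     = rho m ^+ 2 * l.+1%:R ^+ 2 / (1 + sg * d m).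
  rewrite /d LE -(s2 m) => h.
  have h3 : s m + sg * l.+1%:R * rho m != 0.
    apply: contra h => /eqP h; apply/eqP; apply: (mulIf (lt0r_neq0 (s0 m))).
    by rewrite mul0r -[RHS]h; field; rewrite gt_eqF.
  have LS : 1 + l%:R = l.+1%:R :> R by rewrite addrC natr1.
  field; rewrite LS mulrA h3 gt_eqF//=.
  rewrite (_ : _ + _ = s m * (s m + sg * l.+1%:R * rho m)); last by ring.
  by rewrite mulf_neq0// gt_eqF.
have lim1 (sg : R) : (fun m => expR (- (rho m ^+ 2 * l.+1%:R ^+ 2 / (1 + sg * d m)))) @ \oo
    --> expR (- (r ^+ 2 * l.+1%:R ^+ 2)).
  apply: continuous_cvg; first exact: continuous_expR.
  apply: cvgN; rewrite -[X in _ --> X]divr1; apply: cvgM.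
    by apply: cvgM; [apply: cvgM|exact: cvg_cst].
  apply: cvgV; first by rewrite oner_eq0.
  rewrite -[X in _ --> X]addr0 -[X in _ + X](mulr0 sg).
  by apply: cvgD; [exact: cvg_cst|apply: cvgM => //; exact: cvg_cst].
apply: (squeeze_cvgr _ (lim1 (-1)) (lim1 1)).
near=> m.
have dm : `|d m| < 1.
  have : `|0 - d m| < 1 by near: m; move/cvgrPdist_lt : dc; apply.
  by rewrite sub0r normrN.
have d0 : 0 <= d m by rewrite /d mulr_ge0// ?mulr_ge0// ltW// invr_gt0.
move: dm; rewrite ger0_norm// => dm.
have Lm : (l.+1 * N m < m.+1)%N.
  rewrite -(ltr_nat R) LE -(s2 m) expr2 ltr_pM2r//.
  by move: dm; rewrite /d ltr_pdivrMr// mul1r.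
apply/andP; split.
  rewrite -E; last by rewrite gt_eqF//; lra.
  by rewrite mulN1r; apply: bin_ratio_ge; rewrite leqnn.
rewrite -E; last by rewrite gt_eqF//; lra.
by rewrite mul1r; apply: bin_ratio_le; rewrite leqnn ltnW.
Unshelve. all: by end_near. Qed.

Let bin_sum_cvg : (fun m => \sum_(0 <= l < m.+1) q m l) @ \oo --> gauss_sum (r ^+ 2).
Proof.
pose b j := expR (- (r ^+ 2 / 8 * j.+1%:R ^+ 2)) : R.
apply: (@tannery _ _ _ b) => //.
- apply: filterS rho_near => m /andP[h1 h2] l.
  have /andP[a0 a1] := q_le m l; rewrite ger0_norm//; apply: le_trans a1 _.
  rewrite ler_expR lerN2 ler_pM2r ?exprn_gt0//.
  have : (r / 2) ^+ 2 <= rho m ^+ 2 by rewrite lerXn2r// nnegrE ltW// divr_gt0.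
  by rewrite !expr2; lra.
- apply: (@cvg_gauss_series R (r ^+ 2 / 8)).
  by rewrite divr_gt0 ?exprn_gt0.
- move=> m l ml; apply: bin_ratio_small.
  by rewrite (leq_trans (_ : _ < l.+1)%N)// leq_pmulr.
Qed.

(** The limit of [sqrt M * 'C(2M, M) / 4 ^ M] does not involve [r], so it need
    not be evaluated: comparing two values of [r] is enough. *)
Lemma central_binomial_cvg :
  (fun m => Num.sqrt m.+1%:R * ('C(m.+1 + m.+1, m.+1)%:R / 4 ^+ m.+1)) @ \oo -->
  (1 + 2 * gauss_sum (pi ^+ 2 / r ^+ 2)) / (1 + 2 * gauss_sum (r ^+ 2)) / r.
Proof.
have D0 m : 0 < 1 + 2 * \sum_(0 <= l < m.+1) q m l.
  have : 0 <= \sum_(0 <= l < m.+1) q m l.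
    by apply: sumr_ge0 => l _; exact: bin_ratio_ge0.
  by move=> ?; lra.
have G0 : 0 <= gauss_sum (r ^+ 2) by apply: gauss_sum_ge0; rewrite exprn_gt0.
rewrite (_ : (fun m => _) = (fun m =>
  (1 + 2 * \sum_(0 <= j < n m) cos (pi * j.+1%:R / (N m)%:R) ^+ (m.+1 + m.+1)) /
  (1 + 2 * \sum_(0 <= l < m.+1) q m l) / rho m)); last first.
  apply/funext => m; have : 4 ^+ m.+1 * (1 + 2 * \sum_(0 <= j < n m)
        cos (pi * j.+1%:R / (N m)%:R) ^+ (m.+1 + m.+1)) = (N m)%:R *
      ('C(m.+1 + m.+1, m.+1)%:R + 2 * \sum_(0 <= l < m.+1)
        'C(m.+1 + m.+1, m.+1 + l.+1 * N m)%:R) :> R by exact: polya_identity.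
  set S := \sum_(0 <= j < n m) _; set c := 'C(_, _)%:R.
  have c0 : c != 0 by rewrite pnatr_eq0 -lt0n bin_gt0 leq_addr.
  have -> : \sum_(0 <= l < m.+1) 'C(m.+1 + m.+1, m.+1 + l.+1 * N m)%:R =
            c * \sum_(0 <= l < m.+1) q m l.
    rewrite mulr_sumr; apply: eq_bigr => l _.
    by rewrite /q /bin_ratio mulrC divfK.
  have := lt0r_neq0 (D0 m); set D := \sum_(0 <= l < _) _ => D1.
  have p4 : 4 ^+ m.+1 != 0 :> R by rewrite expf_neq0// pnatr_eq0.
  move=> H; have {H} -> : 1 + 2 * S = (N m)%:R * (c + 2 * (c * D)) / 4 ^+ m.+1.
    by rewrite -H mulrAC mulfV// mul1r.
  have sm := lt0r_neq0 (s0 m); have Nm := lt0r_neq0 (N0 m).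
  by rewrite -/(s m) /rho; field; rewrite sm D1 p4 Nm.
apply: cvgM; last by apply: cvgV => //; rewrite gt_eqF.
apply: cvgM.
  apply: cvgD; first exact: cvg_cst.
  by apply: cvgM => //; exact: cvg_cst.
apply: cvgV; first by rewrite gt_eqF//; lra.
apply: cvgD; first exact: cvg_cst.
by apply: cvgM => //; exact: cvg_cst.
Qed.

End GaussSum.

Section ThetaFunctionalEquation.
Variable R : realType.
Implicit Types x : R.

(** [1 + 2 * theta_half x], the sum of [exp (- pi j^2 x)] over all integers [j],
    is Jacobi's theta constant. *)
Definition theta_half x : R := gauss_sum (pi * x).

(** Comparison of the limits of [central_binomial_cvg] for [r = sqrt pi], where
    the two sums coincide, and [r = sqrt (pi x)]. *)
Lemma theta_half_inv x : 0 < x ->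
  1 + 2 * theta_half x^-1 = Num.sqrt x * (1 + 2 * theta_half x).
Proof.
move=> x0; have p0 := pi_gt0 R.
pose K r : R := (1 + 2 * gauss_sum (pi ^+ 2 / r ^+ 2)) / (1 + 2 * gauss_sum (r ^+ 2)) / r.
have KK r r' : 0 < r -> 0 < r' -> K r = K r'.
  move=> /central_binomial_cvg h1 /central_binomial_cvg h2.
  exact: cvg_unique h1 h2.
have sp : 0 < Num.sqrt (pi : R) by rewrite sqrtr_gt0.
have sx : 0 < Num.sqrt x by rewrite sqrtr_gt0.
have G c : 0 < c -> 1 + 2 * gauss_sum c != 0 :> R.
  by move=> /gauss_sum_ge0 => c0; rewrite gt_eqF//; lra.
have K1 : K (Num.sqrt pi) = (Num.sqrt pi)^-1.
  rewrite /K sqr_sqrtr ?ltW// expr2 mulfK ?gt_eqF// mulfV ?mul1r//.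
  exact: G.
have spx : 0 < Num.sqrt pi * Num.sqrt x by rewrite mulr_gt0.
have := KK _ _ sp spx; rewrite K1 /K exprMn !sqr_sqrtr ?ltW//.
have aux (p : R) : p != 0 -> p ^+ 2 / (p * x) = p * x^-1.
  by move=> p1; field; rewrite p1 gt_eqF.
rewrite aux ?gt_eqF//.
rewrite -/(theta_half x) -/(theta_half x^-1).
have B0 : 1 + 2 * theta_half x != 0 by apply: G; rewrite mulr_gt0.
set A := 1 + _; set B := 1 + _ in B0 * => H.
transitivity (A / B / (Num.sqrt pi * Num.sqrt x) * (Num.sqrt pi * Num.sqrt x * B)).
  by field; rewrite B0 !gt_eqF.
by rewrite -H; field; rewrite gt_eqF.
Qed.

End ThetaFunctionalEquation.

(** * The function omega *)

Section ThetaDerivatives.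
Variable R : realType.
Implicit Types (x y h : R) (p k : nat).

Lemma exprn_le_fact_exp p y : 0 <= y -> y ^+ p <= p`!%:R * expR y.
Proof.
move=> y0; case: p => [|p].
  by rewrite expr0 mul1r -expR0 ler_expR.
have := expR_ge1Dxn p y0; rewrite -ler_pdivrMl ?ltr0n ?fact_gt0// mulrC; lra.
Qed.

Lemma is_derive_quadratic (f : R -> R) x l C d : 0 < d ->
  (forall h, `|h| < d -> `|f (x + h) - f x - l * h| <= C * h ^+ 2) ->
  is_derive x 1 f l.
Proof.
move=> d0 H.
have K0 : 0 < `|C| + 1 by rewrite ltr_wpDl.
have c : (fun h => h^-1 *: ((f \o shift x) (h *: 1) - f x)) @ 0^' --> l.
  apply/cvgrPdist_le => e e0; rewrite near_withinE.
  apply/nbhs_ballP; exists (Num.min d (e / (`|C| + 1))) => /=.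
    by rewrite lt_min d0 divr_gt0.
  move=> h; rewrite /ball/= sub0r normrN lt_min => /andP[hd he] h0.
  have nh : 0 < `|h| by rewrite normr_gt0.
  rewrite (_ : l - _ = - (f (x + h) - f x - l * h) / h); last first.
    by rewrite /GRing.scale/= mulr1 [h + x]addrC; field.
  rewrite normrM normrN normfV ler_pdivrMr//; apply: le_trans (H h hd) _.
  rewrite -[h ^+ 2]real_normK ?num_real// expr2 mulrA ler_pM2r//.
  have : C * `|h| <= `|C| * `|h| by rewrite ler_wpM2r// ler_norm.
  by move: he; rewrite ltr_pdivlMr//; lra.
apply: DeriveDef; first by apply/cvg_ex; exists l.
by apply/cvg_lim.
Qed.

Definition theta_term p x k : R :=
  (k.+1%:R ^+ 2) ^+ p * expR (- (pi * x * k.+1%:R ^+ 2)).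

Lemma theta_term_ge0 p x k : 0 <= theta_term p x k.
Proof. by rewrite mulr_ge0 ?expR_ge0// exprn_ge0. Qed.

Lemma theta_term_cvg p x : 0 < x -> cvgn (series (theta_term p x)).
Proof.
move=> x0; have p0 := pi_gt0 R.
pose c := pi * x / 2; have c0 : 0 < c by rewrite divr_gt0 ?mulr_gt0.
have cs := is_cvg_seriesZ (k := p`!%:R / c ^+ p) (cvg_gauss_series c0).
apply: (dominated_cvg_series cs) => k.
rewrite ger0_norm ?theta_term_ge0//.
have ck : 0 <= c * k.+1%:R ^+ 2 by rewrite mulr_ge0 ?exprn_ge0// ltW.
have := exprn_le_fact_exp p ck; rewrite exprMn => H.
have cp : 0 < c ^+ p by rewrite exprn_gt0.
rewrite /theta_term (_ : pi * x = c + c); last by rewrite /c; field.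
rewrite mulrDl opprD expRD mulrA -[X in _ <= X]/(_ * expR _).
rewrite ler_wpM2r ?expR_ge0// expRN ler_pdivrMr ?expR_gt0//.
by rewrite mulrAC ler_pdivlMr// mulrC.
Qed.

Definition theta_sum p x : R := limn (series (theta_term p x)).

Lemma theta_sum0 x : theta_sum 0 x = theta_half x.
Proof.
rewrite /theta_sum /theta_half /gauss_sum; congr (limn (series _)).
by apply/funext => j; rewrite /theta_term expr0 mul1r.
Qed.

(** Termwise differentiation: the remainder of the exponential is quadratic in
    [h], with a coefficient summable like the terms at [x / 2]. *)
Lemma is_derive_theta_sum p x : 0 < x ->
  is_derive x 1 (theta_sum p) (- (pi * theta_sum p.+1 x)).
Proof.
move=> x0; have p0 := pi_gt0 R; have x20 : 0 < x / 2 by rewrite divr_gt0.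
apply: (@is_derive_quadratic _ _ _ (pi ^+ 2 * theta_sum p.+2 (x / 2)) (x / 2)) => // h hx.
have xh0 : 0 < x + h by move: hx; rewrite ltr_norml; lra.
have c1 := @theta_term_cvg p _ xh0; have c2 := @theta_term_cvg p _ x0.
have c3 := @theta_term_cvg p.+1 _ x0; have c4 := @theta_term_cvg p.+2 _ x20.
pose u k := theta_term p (x + h) k - theta_term p x k + pi * h * theta_term p.+1 x k.
have cu : series u @ \oo -->
    theta_sum p (x + h) - theta_sum p x - - (pi * theta_sum p.+1 x) * h.
  rewrite (_ : series u = (fun n => series (theta_term p (x + h)) n
    - series (theta_term p x) n + pi * h * series (theta_term p.+1 x) n)); last first.
    by apply/funext => n; rewrite /series/= big_split/= sumrB mulr_sumr.
  rewrite (_ : _ - _ = theta_sum p (x + h) - theta_sum p x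
    + pi * h * theta_sum p.+1 x); last by ring.
  exact: (cvgD (cvgB c1 c2) (cvgM (cvg_cst _) c3)).
rewrite -(cvg_lim _ cu)//.
pose v k := pi ^+ 2 * h ^+ 2 * theta_term p.+2 (x / 2) k.
have cv : series v @ \oo --> pi ^+ 2 * theta_sum p.+2 (x / 2) * h ^+ 2.
  rewrite (_ : series v = (fun n => pi ^+ 2 * h ^+ 2 *
      series (theta_term p.+2 (x / 2)) n)); last first.
    by apply/funext => n; rewrite /series/= mulr_sumr.
  rewrite [X in _ --> X]mulrAC; apply: cvgM; [exact: cvg_cst|exact: c4].
have uv k : `|u k| <= v k.
  rewrite /u /v /theta_term; set m2 := k.+1%:R ^+ 2.
  have m20 : 0 < m2 by rewrite exprn_gt0.
  pose a := pi * m2; have a0 : 0 < a by rewrite mulr_gt0.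
  rewrite (_ : _ + _ =
    m2 ^+ p * (expR (- (a * x)) * (expR (- (a * h)) - 1 - - (a * h)))); last first.
    rewrite (_ : - (pi * (x + h) * m2) = - (a * x) + - (a * h)) ?expRD; last by rewrite /a; ring.
    by rewrite /a [pi * x * m2]mulrAC exprS; ring.
  rewrite !normrM (ger0_norm (exprn_ge0 _ (ltW m20))) (ger0_norm (expR_ge0 _)).
  have -> : pi ^+ 2 * h ^+ 2 * (m2 ^+ p.+2 * expR (- (pi * (x / 2) * m2))) =
     m2 ^+ p * (expR (- (a * x)) * ((- (a * h)) ^+ 2 * expR (a * x / 2))).
    rewrite [X in _ = _ * X]mulrCA -expRD (_ : - (a * x) + _ = - (pi * (x / 2) * m2)).
      by rewrite !exprS /a; ring.
    by rewrite /a; field.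
  rewrite ler_pM2l ?exprn_gt0// ler_pM2l ?expR_gt0//.
  apply: le_trans (normr_expRB1D_le _) _.
  rewrite ler_wpM2l ?sqr_ge0// ler_expR normrN normrM (gtr0_norm a0).
  by rewrite -mulrA ler_pM2l// ltW.
have := series_tail_le 0 (cvgP _ cv) uv.
rewrite /series/= !big_geq// !subr0 => /le_trans; apply.
by rewrite -/(series v) (cvg_lim _ cv).
Qed.

End ThetaDerivatives.

Section Omega.
Variable R : realType.
Implicit Types (x y v : R) (k : nat).

Definition omega_term x k : R := let m : R := k.+1%:R in
  (2 * pi ^+ 2 * m ^+ 4 * x ^+ 2 - 3 * pi * m ^+ 2 * x) * expR (- (pi * m ^+ 2 * x)).

(** With [y = pi m^2 x], the term is [(2 y^2 - 3 y) e^(-y)], where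
    [76 = 2 * 32 + 3 * 4] comes from [y^2 <= 32 e^(y/4)] and [y <= 4 e^(y/4)];
    what remains of the exponential is split between [e^(-x)] and the terms of a
    telescoping series. *)
Lemma omega_term_le x k : 0 < x -> `|omega_term x k| <=
  76 * expR (- x) * (2 / ((1 + k%:R * (Num.sqrt x / 2)) * (1 + k.+1%:R * (Num.sqrt x / 2)))).
Proof.
move=> x0; have p2 := pi_ge2 R; rewrite /omega_term; set m : R := k.+1%:R.
have kE : k%:R = m - 1 :> R by rewrite /m -natr1 addrK.
have k0 : 0 <= k%:R :> R by [].
have m0 : 1 <= m by rewrite /m ler1n.
rewrite kE; rewrite kE in k0.
pose y := pi * m ^+ 2 * x.
have -> : 2 * pi ^+ 2 * m ^+ 4 * x ^+ 2 - 3 * pi * m ^+ 2 * x = 2 * y ^+ 2 - 3 * y.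
  by rewrite /y; ring.
rewrite -/y.
have m2 : 1 <= m ^+ 2 by rewrite expr2; nra.
have y0 : 0 <= y by rewrite /y !mulr_ge0//; lra.
have h1 : `|2 * y ^+ 2 - 3 * y| <= 76 * expR (y / 4).
  have y4 : 0 <= y / 4 by lra.
  have := exprn_le_fact_exp 1 y4; have := exprn_le_fact_exp 2 y4.
  rewrite expr1 -[1`!]/1%N -[2`!]/2%N => h2 h3.
  have e0 := expR_ge0 (y / 4).
  have := sqr_ge0 y; move: h2; rewrite ler_norml !expr2; lra.
rewrite normrM (ger0_norm (expR_ge0 _)).
apply: (@le_trans _ _ (76 * expR (y / 4) * expR (- y))).
  by rewrite ler_wpM2r ?expR_ge0.
pose r := Num.sqrt x / 2.
have s0 : 0 < Num.sqrt x by rewrite sqrtr_gt0.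
have r0 : 0 < r by rewrite divr_gt0.
have r2 : x = 4 * r ^+ 2 by rewrite /r expr_div_n sqr_sqrtr ?ltW//; field.
have h2 : expR (y / 4) * expR (- y) <= expR (- x) * expR (- (m ^+ 2 * r ^+ 2)).
  rewrite -!expRD ler_expR -opprD -/(_ - _) lerNr opprD opprK.
  have : 2 * (m ^+ 2 * x) <= y by rewrite /y -mulrA ler_wpM2r// mulr_ge0//; lra.
  have : x <= m ^+ 2 * x by rewrite ler_peMl// ltW.
  by move: r2; nra.
rewrite -[leLHS]mulrA -[leRHS]mulrA ler_pM2l//; apply: le_trans h2 _.
rewrite ler_pM2l ?expR_gt0// expRN.
have q1 : 0 < 1 + (m - 1) * r by have : 0 <= (m - 1) * r := mulr_ge0 k0 (ltW r0); lra.
have q2 : 0 < 1 + m * r by lra.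
apply: (@le_trans _ _ ((1 + m ^+ 2 * r ^+ 2)^-1)).
  rewrite lef_pV2 ?posrE ?expR_gt0 ?expR_ge1Dx//.
  by have : 0 <= m ^+ 2 * r ^+ 2 := mulr_ge0 (sqr_ge0 _) (sqr_ge0 _); lra.
have q3 : 0 < 1 + m ^+ 2 * r ^+ 2.
  by have : 0 <= m ^+ 2 * r ^+ 2 := mulr_ge0 (sqr_ge0 _) (sqr_ge0 _); lra.
rewrite -/r ler_pdivlMr ?mulr_gt0// mulrC ler_pdivrMr//.
have : (1 + (m - 1) * r) * (1 + m * r) <= (1 + m * r) * (1 + m * r).
  by rewrite ler_pM2r//; nra.
by have := sqr_ge0 (1 - m * r); rewrite !expr2; lra.
Qed.

(** Dominating the series by a telescoping one costs only the factor
    [1 / sqrt x], which the Mellin transform tolerates for Re s > 1. *)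
Lemma omega_partial_le x n : 0 < x ->
  \sum_(0 <= k < n) `|omega_term x k| <= 304 * (expR (- x) / Num.sqrt x).
Proof.
move=> x0; have s0 : 0 < Num.sqrt x by rewrite sqrtr_gt0.
pose r := Num.sqrt x / 2; have r0 : 0 < r by rewrite divr_gt0.
have q k : 0 < 1 + k%:R * r.
  by have : 0 <= k%:R * r := mulr_ge0 (ler0n _ _) (ltW r0); lra.
apply: (@le_trans _ _ (\sum_(0 <= k < n) 76 * expR (- x) * (2 / r) *
    ((1 + k%:R * r)^-1 - (1 + k.+1%:R * r)^-1))).
  apply: ler_sum => k _; apply: le_trans (omega_term_le k x0) _.
  rewrite -/r -[leRHS]mulrA ler_pM2l ?mulr_gt0 ?expR_gt0// le_eqVlt.
  apply/orP; left; apply/eqP.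
  have := lt0r_neq0 (q k); have := lt0r_neq0 (q k.+1); rewrite -natr1 => h1 h2.
  by field; rewrite h1 h2 gt_eqF.
rewrite -mulr_sumr.
have -> : \sum_(0 <= k < n) ((1 + k%:R * r)^-1 - (1 + k.+1%:R * r)^-1) =
   1 - (1 + n%:R * r)^-1.
  elim: n => [|n IH]; first by rewrite big_geq// mul0r addr0 invr1 subrr.
  by rewrite big_nat_recr//= IH; ring.
have := q n; rewrite -invr_gt0 => qn.
apply: (@le_trans _ _ (76 * expR (- x) * (2 / r))).
  by rewrite ler_piMr//; [rewrite !mulr_ge0 ?expR_ge0 ?invr_ge0// ltW|lra].
rewrite /r le_eqVlt; apply/orP; left; apply/eqP; field; by rewrite gt_eqF.
Qed.

Lemma omega_cvg x : 0 < x -> series (omega_term x) @ \oo --> omega x.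
Proof.
move=> x0; suff : cvgn (series (omega_term x)) by [].
apply: normed_cvg; apply: nondecreasing_is_cvgn.
  by apply: nondecreasing_series => k *; exact: normr_ge0.
by exists (304 * (expR (- x) / Num.sqrt x)) => _ [n _ <-]; exact: omega_partial_le.
Qed.

Lemma omega_le_infty x : 0 < x -> `|omega x| <= 304 * (expR (- x) / Num.sqrt x).
Proof.
move=> x0; apply: (@cvgr_to_le _ _ _ _ _ _ _ (cvg_norm (omega_cvg x0))).
apply: nearW => n; apply: le_trans (ler_norm_sum _ _ _) _.
exact: omega_partial_le.
Qed.

Lemma omegaE x : 0 < x ->
  omega x = 2 * pi ^+ 2 * x ^+ 2 * theta_sum 2 x - 3 * pi * x * theta_sum 1 x.
Proof.
move=> x0; apply: (cvg_unique _ (omega_cvg x0)) => //.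
rewrite (_ : series _ = (fun n => 2 * pi ^+ 2 * x ^+ 2 * series (theta_term 2 x) n
   - 3 * pi * x * series (theta_term 1 x) n)); last first.
  apply/funext => n; rewrite /series/= !mulr_sumr -sumrB.
  apply: eq_bigr => k _; rewrite /omega_term /theta_term.
  by rewrite [pi * x * _]mulrAC; ring.
by apply: cvgB; apply: cvgM; (try exact: cvg_cst); exact: theta_term_cvg.
Qed.

Lemma continuous_omega x : 0 < x -> {for x, continuous (@omega R)}.
Proof.
move=> x0; have cT p : {for x, continuous (@theta_sum R p)}.
  apply: differentiable_continuous; apply/derivable1_diffP.
  exact: (@ex_derive _ _ _ _ _ _ _ (is_derive_theta_sum p x0)).
have : {for x, continuous (fun x => 2 * pi ^+ 2 * x ^+ 2 * theta_sum 2 x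
                                    - 3 * pi * x * theta_sum 1 x)}.
  apply: cvgB; apply: cvgM => //; first last.
  - exact: cT.
  - by apply: cvgM; [exact: cvg_cst|exact: cvg_id].
  - exact: cT.
  - by apply: cvgM; [exact: cvg_cst|apply: cvgM; exact: cvg_id].
move=> c; rewrite /prop_for /continuous_at omegaE//.
apply: cvg_trans c; apply: near_eq_cvg.
near=> y; rewrite omegaE//; near: y; exact: lt_nbhsr.
Unshelve. all: by end_near. Qed.

Lemma is_derive_even_odd (g g1 : R -> R) (e : R) :
  (forall v, is_derive v 1 g (g1 v)) -> (forall v, g (- v) = e * g v) ->
  forall v, g1 (- v) = - e * g1 v.
Proof.
move=> dg ge v.
have d1 : is_derive v 1 (g \o -%R) (g1 (- v) * - 1).
  by apply: (@is_derive1_comp _ g -%R).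
have d2 : is_derive v 1 (fun v => e * g v) (e * g1 v).
  exact: is_deriveZ.
have E : g \o -%R = (fun v => e * g v) by apply/funext => w; rewrite /= ge.
have h1 := @derive_val _ _ _ _ _ _ _ d1.
have h2 := @derive_val _ _ _ _ _ _ _ d2.
by move: h1; rewrite E h2; lra.
Qed.

Lemma is_derive_weighted_theta (e T0 T1 : R -> R) v :
  is_derive v 1 e (e v / 4) -> is_derive v 1 T0 (- (pi * T1 v) * expR v) ->
  is_derive v 1 (fun v => e v * (1 + 2 * T0 v))
    (e v * ((1 + 2 * T0 v) / 4 - 2 * pi * (expR v * T1 v))).
Proof.
move=> de d0; move: (pi : R) d0 => p d0; apply: is_derive_eq.
by rewrite /GRing.scale/=; field.
Qed.

Lemma is_derive_weighted_theta2 (e T0 T1 T2 : R -> R) v :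
  is_derive v 1 e (e v / 4) -> is_derive v 1 T0 (- (pi * T1 v) * expR v) ->
  is_derive v 1 T1 (- (pi * T2 v) * expR v) ->
  is_derive v 1 (fun v => e v * ((1 + 2 * T0 v) / 4 - 2 * pi * (expR v * T1 v)))
    (e v * ((1 + 2 * T0 v) / 16
      + (2 * pi ^+ 2 * expR v ^+ 2 * T2 v - 3 * pi * expR v * T1 v))).
Proof.
move=> de d0 d1; move: (pi : R) d0 d1 => p d0 d1; apply: is_derive_eq.
by rewrite /GRing.scale/=; field.
Qed.

(** With [x = exp v], Jacobi's formula says that
    [exp (v/4) * (1 + 2 * theta_half (exp v))] is even; so is its second derivative, and [exp (v/4) omega (exp v)] is a linear
    combination of the two. *)
Lemma omega_inv x : 0 < x -> omega x^-1 = Num.sqrt x * omega x.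
Proof.
have p0 := pi_gt0 R.
pose e v : R := expR (v / 4).
pose g v := e v * (1 + 2 * theta_sum 0 (expR v)).
pose g1 v := e v * ((1 + 2 * theta_sum 0 (expR v)) / 4
  - 2 * pi * (expR v * theta_sum 1 (expR v))).
pose g2 v := e v * ((1 + 2 * theta_sum 0 (expR v)) / 16
  + (2 * pi ^+ 2 * expR v ^+ 2 * theta_sum 2 (expR v) - 3 * pi * expR v * theta_sum 1 (expR v))).
have dT p v : is_derive v 1 (fun v => theta_sum p (expR v))
    (- (pi * theta_sum p.+1 (expR v)) * expR v).
  have d1 := is_derive_theta_sum p (expR_gt0 v).
  exact: (@is_derive1_comp _ (@theta_sum R p) expR v _ _ d1 (is_derive_expR v)).
have de v : is_derive v 1 e (e v / 4).
  have dl : is_derive v 1 (fun v : R => v / 4) (4^-1).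
    by apply: is_derive_eq; rewrite /GRing.scale/=; ring.
  exact: (@is_derive1_comp _ expR (fun v : R => v / 4) v _ _ (is_derive_expR _) dl).
have dg v : is_derive v 1 g (g1 v).
  exact: (@is_derive_weighted_theta e (fun v => theta_sum 0 (expR v))
    (fun v => theta_sum 1 (expR v)) v (de v) (dT 0%N v)).
have dg1 v : is_derive v 1 g1 (g2 v).
  exact: (@is_derive_weighted_theta2 e (fun v => theta_sum 0 (expR v))
    (fun v => theta_sum 1 (expR v)) (fun v => theta_sum 2 (expR v)) v
    (de v) (dT 0%N v) (dT 1%N v)).
have se v : Num.sqrt (expR v) = e v ^+ 2.
  rewrite /e -expRM_natl (_ : expR v = expR (2 * (v / 4)) ^+ 2).
    by rewrite sqrtr_sqr ger0_norm ?expR_ge0.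
  by rewrite -expRM_natl; congr expR; field.
have eN v : e (- v) = (e v)^-1 by rewrite /e mulNr expRN.
have e0 v : e v != 0 by rewrite /e expR_eq0.
have gE v : g (- v) = 1 * g v.
  rewrite /g expRN theta_sum0 theta_half_inv ?expR_gt0// -theta_sum0 se eN.
  by field.
have g1E := is_derive_even_odd dg gE.
have g2E := is_derive_even_odd dg1 g1E.
move=> x0; pose v := ln x.
have xE : x = expR v by rewrite lnK.
rewrite xE -expRN !omegaE ?expR_gt0//.
have := g2E v; have := gE v.
rewrite /g2 /g !eN se mul1r opprK mul1r => h1 h2.
have h3 : (e v)^-1 * (2 * pi ^+ 2 * expR (- v) ^+ 2 * theta_sum 2 (expR (- v)) -
      3 * pi * expR (- v) * theta_sum 1 (expR (- v))) =
   e v * (2 * pi ^+ 2 * expR v ^+ 2 * theta_sum 2 (expR v) -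
      3 * pi * expR v * theta_sum 1 (expR v)).
  have aux (a b A A' W W' : R) : a * (1 + 2 * A') = b * (1 + 2 * A) ->
      a * ((1 + 2 * A') / 16 + W') = b * ((1 + 2 * A) / 16 + W) -> a * W' = b * W.
    move=> k1 k2; have -> : a * W' = a * ((1 + 2 * A') / 16 + W')
      - a * (1 + 2 * A') / 16 by ring.
    by rewrite k2 k1; ring.
  exact: aux h1 h2.
apply: (mulfI (invr_neq0 (e0 v))); rewrite h3.
by field.
Qed.

(** [omega_inv] carries the bound from [x >= 1] to [x <= 1]. *)
Lemma omega_le x : 0 < x -> `|omega x| <= 304 * expR (- ((x + x^-1) / 2)).
Proof.
have large y : 1 <= y -> `|omega y| <= 304 * expR (- ((y + y^-1) / 2)) / Num.sqrt y.
  move=> y1; have y0 : 0 < y by lra.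
  apply: le_trans (omega_le_infty y0) _; rewrite mulrA.
  have yV : y^-1 <= 1 by rewrite invf_le1.
  rewrite ler_wpM2r ?invr_ge0 ?sqrtr_ge0// ler_wpM2l ?ler0n// ler_expR.
  by lra.
move=> x0; have [x1|x1] := leP 1 x.
  apply: le_trans (large x x1) _; rewrite ler_piMr ?mulr_ge0 ?expR_ge0 ?ler0n//.
  rewrite invf_le1 ?sqrtr_gt0//.
  by have := ler_wsqrtr x1; rewrite sqrtr1.
have xV1 : 1 <= x^-1 by rewrite invf_ge1// ltW.
have xV0 : 0 < x^-1 by rewrite invr_gt0.
have := omega_inv xV0; rewrite invrK => ->.
rewrite normrM ger0_norm ?sqrtr_ge0// mulrC -ler_pdivlMr ?sqrtr_gt0//.
by have := large _ xV1; rewrite invrK [x^-1 + x]addrC.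
Qed.

End Omega.

(** * Integrals over the positive half-line *)

Section HalfLine.
Variable R : realType.
Notation mu := (@lebesgue_measure R).
Implicit Types (f g F : R -> R) (x : R).

(** Continuity on the open half-line, in a pointwise form which is stable under
    the operations on functions of [R]; it provides measurability and the
    integrals over segments. *)
Definition pcont f := forall x, 0 < x -> {for x, continuous f}.

Definition halfline : set R := `]0, +oo[%classic.

Lemma halflineE x : halfline x = (0 < x) :> Prop.
Proof. by rewrite /halfline/= in_itv/= andbT. Qed.

Lemma measurable_halfline : measurable (halfline : set (measurableTypeR R)).
Proof. exact: measurable_itv. Qed.

Lemma pcont_measurable f : pcont f -> measurable_fun halfline f.
Proof.
move=> cf; apply: open_continuous_measurable_fun; first exact: interval_open.
by move=> x; rewrite inE halflineE => /cf.
Qed.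

Lemma pcont_within f a b : pcont f -> 0 < a -> {within `[a, b], continuous f}.
Proof.
move=> cf a0; apply: continuous_in_subspaceT => x.
by rewrite inE/= in_itv/= => /andP[ax _]; apply: cf; exact: lt_le_trans ax.
Qed.

Lemma pcont_cst (k : R) : pcont (fun=> k).
Proof. by move=> x _; exact: cvg_cst. Qed.

Lemma pcont_id : pcont id.
Proof. by move=> x _; exact: cvg_id. Qed.

Lemma pcontD f g : pcont f -> pcont g -> pcont (fun x => f x + g x).
Proof. by move=> cf cg x x0; apply: cvgD; [exact: cf|exact: cg]. Qed.

Lemma pcontN f : pcont f -> pcont (fun x => - f x).
Proof. by move=> cf x x0; apply: cvgN; exact: cf. Qed.

Lemma pcontB f g : pcont f -> pcont g -> pcont (fun x => f x - g x).
Proof. by move=> cf cg x x0; apply: cvgB; [exact: cf|exact: cg]. Qed.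

Lemma pcontM f g : pcont f -> pcont g -> pcont (fun x => f x * g x).
Proof. by move=> cf cg x x0; apply: cvgM; [exact: cf|exact: cg]. Qed.

Lemma pcontX f n : pcont f -> pcont (fun x => f x ^+ n).
Proof.
move=> cf; elim: n => [|n IH].
  by under eq_fun do rewrite expr0; exact: pcont_cst.
by under eq_fun do rewrite exprS; exact: pcontM.
Qed.

Lemma pcontV f : pcont f -> (forall x, 0 < x -> f x != 0) ->
  pcont (fun x => (f x)^-1).
Proof. by move=> cf f0 x x0; apply: cvgV; [exact: f0|exact: cf]. Qed.

Lemma pcont_comp f (h : R -> R) : continuous h -> pcont f -> pcont (h \o f).
Proof.
by move=> ch cf x x0; apply: continuous_comp; [exact: cf|exact: ch].
Qed.

Lemma pcont_ln : pcont (@ln R).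
Proof. exact: continuous_ln. Qed.

Lemma pcont_derive F f : (forall x, 0 < x -> is_derive x 1 F (f x)) -> pcont F.
Proof.
move=> dF x x0; apply: differentiable_continuous; apply/derivable1_diffP.
exact: (@ex_derive _ _ _ _ _ _ _ (dF x x0)).
Qed.

Lemma halfline_dominated_integrable f g : pcont f ->
  (forall x, 0 < x -> `|f x| <= g x) -> mu.-integrable halfline (EFin \o g) ->
  mu.-integrable halfline (EFin \o f).
Proof.
move=> cf fg; apply: le_integrable; first exact: measurable_halfline.
  by apply/measurable_EFinP; exact: pcont_measurable.
move=> x; rewrite halflineE => x0; rewrite /= lee_fin.
by apply: le_trans (fg x x0) _; exact: ler_norm.
Qed.

Lemma le_abs_halfline f g : mu.-integrable halfline (EFin \o f) ->
  mu.-integrable halfline (EFin \o g) ->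
  (forall x, 0 < x -> `|f x| <= g x) ->
  `|\int[mu]_(x in halfline) f x| <= \int[mu]_(x in halfline) g x.
Proof.
move=> If Ig fg; have mD := measurable_halfline.
apply: le_trans (le_normr_Rintegral mD If) _.
apply: le_Rintegral => //; first exact: integrable_norm.
by move=> x; rewrite halflineE; exact: fg.
Qed.

Lemma trunc_halfline_cvg f (a b : R^nat) : (forall n, 0 < a n) ->
  (forall x, 0 < x -> \forall n \near \oo, a n <= x <= b n) ->
  mu.-integrable halfline (EFin \o f) ->
  (fun n => \int[mu]_(x in `[a n, b n]) f x) @ \oo -->
    \int[mu]_(x in halfline) f x.
Proof.
move=> a0 ab If; have mD := measurable_halfline.
have E n : \int[mu]_(x in `[a n, b n]) f x =
    fine (\int[mu]_(x in halfline) ((f \_ `[a n, b n]) x)%:E).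
  rewrite -/(Rintegral _ _ _) -Rintegral_mkcondr; congr Rintegral.
  apply/seteqP; split => x /=; last by case.
  move=> xab; split => //; rewrite halflineE; move: xab.
  by rewrite in_itv/= => /andP[ax _]; exact: lt_le_trans ax.
rewrite (_ : (fun n => _) = fine \o (fun n =>
  (\int[mu]_(x in halfline) ((f \_ `[a n, b n]) x)%:E)%E)); last first.
  by apply/funext => n; rewrite E.
apply: fine_cvg; rewrite fineK; last exact: integrable_fin_num.
have /integrableP[/measurable_EFinP mf _] := If.
have mfn n : measurable_fun halfline (f \_ `[a n, b n]).
  have mI : measurable (`[a n, b n]%classic : set (measurableTypeR R)).
    exact: measurable_itv.
  apply/(measurable_restrict f mI mD).
  by apply: measurable_funS mf => //; exact: subIsetl.
have [] // := @dominated_convergence _ _ R mu halfline mD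
  (fun n x => ((f \_ `[a n, b n]) x)%:E) (EFin \o f) (abse \o (EFin \o f)).
- by move=> n; apply/measurable_EFinP; exact: mfn.
- by apply/measurable_EFinP.
- apply: aeW => x; rewrite halflineE => x0; apply: cvg_near_cst.
  have := ab x x0; apply: filterS => n xab.
  by rewrite patchE mem_set//= in_itv.
- exact: integrable_abse.
- apply: aeW => x n _; rewrite patchE; case: ifP => _ //=.
  by rewrite normr0 lee_fin.
Qed.

Lemma trunc_inv_cvg f : mu.-integrable halfline (EFin \o f) ->
  (fun n : nat => \int[mu]_(x in `[n.+2%:R^-1, n.+2%:R]) f x) @ \oo -->
    \int[mu]_(x in halfline) f x.
Proof.
move=> If; apply: trunc_halfline_cvg => // x x0.
have [M _ MP] : \forall n \near \oo, Num.max x x^-1 <= n%:R by exact: nbhs_infty_ger.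
exists M => // n /= Mn; have := MP n.+2; rewrite /= (leq_trans Mn)//; last by lia.
move=> /(_ isT); rewrite ge_max => /andP[-> h]; rewrite andbT.
by rewrite -[leRHS]invrK lef_pV2// posrE ?invr_gt0.
Qed.

Lemma segment_FTC F f (a b : R) : 0 < a -> a < b -> pcont f ->
  (forall x, 0 < x -> is_derive x 1 F (f x)) ->
  \int[mu]_(x in `[a, b]) f x = F b - F a.
Proof.
move=> a0 ab cf dF; have cF := pcont_derive dF.
rewrite /Rintegral (@continuous_FTC2 _ f F a b)//.
- exact: pcont_within.
- split.
  + move=> x; rewrite in_itv/= => /andP[ax _].
    exact: (@ex_derive _ _ _ _ _ _ _ (dF x (lt_trans a0 ax))).
  + by apply: cvg_at_right_filter; exact: cF.
  + by apply: cvg_at_left_filter; apply: cF; exact: lt_trans ab.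
- move=> x; rewrite in_itv/= => /andP[ax _]; rewrite derive1E.
  exact: (@derive_val _ _ _ _ _ _ _ (dF x (lt_trans a0 ax))).
Qed.

Lemma halfline_FTC F f (l0 l1 : R) : pcont f ->
  mu.-integrable halfline (EFin \o f) ->
  (forall x, 0 < x -> is_derive x 1 F (f x)) ->
  (fun n : nat => F (n.+2%:R^-1)) @ \oo --> l0 ->
  (fun n : nat => F n.+2%:R) @ \oo --> l1 ->
  \int[mu]_(x in halfline) f x = l1 - l0.
Proof.
move=> cf If dF F0 F1; apply: (cvg_unique _ (trunc_inv_cvg If)) => //.
rewrite (_ : (fun n => _) = (fun n : nat => F n.+2%:R - F (n.+2%:R^-1))).
  exact: cvgB.
apply/funext => n; apply: segment_FTC => //.
by rewrite (@lt_trans _ _ 1)// ?invf_lt1// ltr1n.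
Qed.

(** A nonnegative function with a bounded antiderivative is integrable: its
    integrals over the segments [[1/n, n]] are bounded. *)
Lemma ge0_halfline_integrable F f (K : R) : pcont f ->
  (forall x, 0 < x -> 0 <= f x) ->
  (forall x, 0 < x -> is_derive x 1 F (f x)) ->
  (forall x, 0 < x -> `|F x| <= K) ->
  mu.-integrable halfline (EFin \o f).
Proof.
move=> cf f0 dF FK; have mD := measurable_halfline.
have mf := pcont_measurable cf.
apply/integrableP; split; first exact/measurable_EFinP.
pose I (n : nat) : set (measurableTypeR R) := `[n.+2%:R^-1, n.+2%:R]%classic.
have I0 n x : I n x -> 0 < x.
  by rewrite /I/= in_itv/= => /andP[h _]; apply: lt_le_trans h; rewrite invr_gt0.
have IE : halfline = \bigcup_n I n.
  apply/seteqP; split=> x; last by move=> [n _ /I0]; rewrite halflineE.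
  rewrite halflineE => x0.
  have [M _ MP] : \forall n \near \oo, Num.max x x^-1 <= n%:R by exact: nbhs_infty_ger.
  exists M => //; have := MP M.+2; rewrite /= => /(_ (leqW (leqnSn _))).
  rewrite ge_max /I/= in_itv/= => /andP[-> h]; rewrite andbT.
  by rewrite -[leRHS]invrK lef_pV2// posrE ?invr_gt0.
have nI : nondecreasing_seq I.
  apply/nondecreasing_seqP => n; rewrite subsetEset => x.
  rewrite /I/= !in_itv/= => /andP[h1 h2]; apply/andP; split.
    by apply: le_trans h1; rewrite lef_pV2 ?posrE// ler_nat.
  by apply: le_trans h2 _; rewrite ler_nat.
have mI n : measurable (I n) by exact: measurable_itv.
have mfI n : measurable_fun (I n) (EFin \o f).
  apply/measurable_EFinP; apply: measurable_funS mf => //.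
  by move=> x /I0; rewrite halflineE.
have fI n x : I n x -> (0 <= (EFin \o f) x)%E by move=> /I0 x0; rewrite /= lee_fin f0.
have cI := @ge0_nondecreasing_set_cvg_integral _ _ R I (EFin \o f) mu nI mI mfI fI.
have -> : (\int[mu]_(x in halfline) `|(EFin \o f) x| =
           \int[mu]_(x in \bigcup_n I n) (EFin \o f) x)%E.
  rewrite -IE; apply: eq_integral => x; rewrite inE halflineE => x0 /=.
  by rewrite ger0_norm ?f0.
apply: (@le_lt_trans _ _ (2 * K)%:E); last exact: ltry.
rewrite -(cvg_lim _ cI)//; apply: lime_le; first exact: cvgP cI.
apply: nearW => n.
have n20 : 0 < n.+2%:R^-1 :> R by rewrite invr_gt0.
have n2 : n.+2%:R^-1 < n.+2%:R :> R.
  by rewrite (@lt_trans _ _ 1)// ?invf_lt1// ltr1n.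
have -> : (\int[mu]_(x in I n) (EFin \o f) x =
           (\int[mu]_(x in `[n.+2%:R^-1, n.+2%:R]) f x)%:E)%E.
  rewrite /Rintegral fineK//; apply: integrable_fin_num => //.
  apply: continuous_compact_integrable; first exact: segment_compact.
  exact: pcont_within.
rewrite (segment_FTC n20 n2 cf dF) lee_fin.
have := FK _ n20; have := FK _ (lt_trans n20 n2).
rewrite !ler_norml; lra.
Qed.

Lemma integrable_halfline_expR (c : R) : 0 < c ->
  mu.-integrable halfline (EFin \o (fun x => expR (- (c * x)))).
Proof.
move=> c0; apply: (@ge0_halfline_integrable (fun x => - c^-1 * expR (- (c * x))) _ c^-1).
- apply: (@pcont_comp (fun x => - (c * x)) expR); first exact: continuous_expR.
  by apply: pcontN; apply: pcontM; [exact: pcont_cst|exact: pcont_id].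
- by move=> x _; exact: expR_ge0.
- move=> x _; apply: is_derive_eq; rewrite /GRing.scale/=; field.
  by rewrite gt_eqF.
- move=> x x0; have cV : 0 < c^-1 by rewrite invr_gt0.
  rewrite normrM normrN (gtr0_norm cV) (ger0_norm (expR_ge0 _)) ler_piMr ?(ltW cV)//.
  by rewrite expR_le1 oppr_le0 mulr_ge0// ltW.
Qed.

Lemma halfline_scale f (c : R) : 0 < c -> pcont f ->
  mu.-integrable halfline (EFin \o f) ->
  mu.-integrable halfline (EFin \o (fun x => f (c * x) * c)) ->
  \int[mu]_(x in halfline) f x = \int[mu]_(x in halfline) (f (c * x) * c).
Proof.
move=> c0 cf If Ifc; apply: (cvg_unique _ _ (trunc_inv_cvg Ifc)) => //.
have n20 n : 0 < n.+2%:R^-1 :> R by rewrite invr_gt0.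
have n2 n : n.+2%:R^-1 < n.+2%:R :> R.
  by rewrite (@lt_trans _ _ 1)// ?invf_lt1// ltr1n.
rewrite (_ : (fun n => _) = (fun n : nat =>
    \int[mu]_(x in `[c * n.+2%:R^-1, c * n.+2%:R]) f x)); last first.
  apply/funext => n; rewrite /Rintegral; congr fine.
  pose G x := c * x.
  have dG x : is_derive x 1 G c.
    by rewrite /G; apply: is_derive_eq; rewrite /GRing.scale/= mulr1.
  have G' : (derive1 G) = fun=> c.
    by apply/funext => x; rewrite derive1E; exact: (@derive_val _ _ _ _ _ _ _ (dG x)).
  have cG : continuous G.
    move=> x; apply: differentiable_continuous; apply/derivable1_diffP.
    exact: (@ex_derive _ _ _ _ _ _ _ (dG x)).
  rewrite (@integration_by_substitution_increasing _ G f n.+2%:R^-1 n.+2%:R) ?ltW//.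
  - by rewrite G'.
  - by move=> x y _ _ xy; rewrite /G ltr_pM2l.
  - by rewrite G' => x _; exact: cvg_cst.
  - by rewrite G'; exact: is_cvg_cst.
  - by rewrite G'; exact: is_cvg_cst.
  - split.
    + by move=> x _; exact: (@ex_derive _ _ _ _ _ _ _ (dG x)).
    + by apply: cvg_at_right_filter; exact: cG.
    + by apply: cvg_at_left_filter; exact: cG.
  - by apply: pcont_within => //; rewrite /G mulr_gt0.
apply: trunc_halfline_cvg => // [n|x x0]; first by rewrite mulr_gt0.
have xc : 0 < c^-1 * x by rewrite mulr_gt0// invr_gt0.
have [M _ MP] : \forall n \near \oo, Num.max (c^-1 * x) (c^-1 * x)^-1 <= n%:R.
  exact: nbhs_infty_ger.
exists M => // n /= Mn; have := MP n.+2; rewrite /= (leq_trans Mn)//; last by lia.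
move=> /(_ isT); rewrite ge_max => /andP[h1 h2].
apply/andP; split; last by rewrite -ler_pdivrMl.
by rewrite -ler_pdivlMl// -[leRHS]invrK lef_pV2// posrE ?invr_gt0.
Qed.

(** The substitution [x -> 1 / x] changes the sign of the integral. *)
Lemma halfline_inv_odd f : pcont f -> mu.-integrable halfline (EFin \o f) ->
  (forall x, 0 < x -> f x^-1 / x ^+ 2 = - f x) ->
  \int[mu]_(x in halfline) f x = 0.
Proof.
move=> cf If fo; apply: (cvg_unique _ (trunc_inv_cvg If)) => //.
rewrite (_ : (fun n => _) = fun=> 0); first exact: cvg_cst.
apply/funext => n.
have n20 : 0 < n.+2%:R^-1 :> R by rewrite invr_gt0.
have n2 : n.+2%:R^-1 < n.+2%:R :> R.
  by rewrite (@lt_trans _ _ 1)// ?invf_lt1// ltr1n.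
set I := \int[mu]_(x in _) f x.
suff : I = - I by lra.
pose G x : R := x^-1.
have dG x : 0 < x -> is_derive x 1 G (- (x ^+ 2)^-1).
  move=> x0; apply: is_derive_eq; first by apply: is_deriveV; rewrite gt_eqF.
  by rewrite /GRing.scale/= mulr1.
have dGd x : 0 < x -> derivable G x 1.
  by move=> x0; exact: (@ex_derive _ _ _ _ _ _ _ (dG x x0)).
have G' x : 0 < x -> (derive1 G) x = - (x ^+ 2)^-1.
  by move=> x0; rewrite derive1E; exact: (@derive_val _ _ _ _ _ _ _ (dG x x0)).
have cG : pcont G by exact: pcont_derive dG.
have cG2 : pcont (fun x => - (x ^+ 2)^-1).
  apply: pcontN; apply: pcontV; first by apply: pcontX; exact: pcont_id.
  by move=> x x0; rewrite expf_neq0// gt_eqF.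
have cG' : pcont (derive1 G).
  move=> x x0; have := cG2 x x0; rewrite /prop_for /continuous_at G'// => c.
  apply: cvg_trans c; apply: near_eq_cvg.
  near=> y; rewrite G'//; near: y; exact: lt_nbhsr.
have Gn : G n.+2%:R = n.+2%:R^-1 by [].
have GVn : G n.+2%:R^-1 = n.+2%:R by rewrite /G invrK.
rewrite {1}/I /Rintegral -{2}GVn -{1}Gn.
have n2l := ltW n2; have n3 := lt_trans n20 n2.
rewrite (@integration_by_substitution_decreasing _ G f n.+2%:R^-1 n.+2%:R)//.
- rewrite -[RHS]/(- fine _).
  transitivity (\int[mu]_(x in `[n.+2%:R^-1, n.+2%:R]) (- 1 * f x)).
    apply: eq_Rintegral => x; rewrite inE/= in_itv/= => /andP[xn _].
    have x0 : 0 < x by exact: lt_le_trans xn.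
    by rewrite mulN1r -fo// /= -[(_ * _) x]/(_ * _) /= -[(- _) x]/(- _) G'// opprK.
  rewrite RintegralZl ?mulN1r//.
  apply: continuous_compact_integrable; first exact: segment_compact.
  exact: pcont_within.
- move=> x y; rewrite !in_itv/= => /andP[xn _] /andP[yn _] xy.
  by rewrite /G ltf_pV2// posrE (lt_le_trans n20).
- move=> x; rewrite in_itv/= => /andP[xn _]; apply: cG'; exact: lt_trans xn.
- by apply/cvg_ex; exists ((derive1 G) n.+2%:R^-1); apply: cvg_at_right_filter; exact: cG'.
- by apply/cvg_ex; exists ((derive1 G) n.+2%:R); apply: cvg_at_left_filter; exact: cG'.
- split.
  + by move=> x; rewrite in_itv/= => /andP[xn _]; apply: dGd; exact: lt_trans xn.
  + by apply: cvg_at_right_filter; exact: cG.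
  + by apply: cvg_at_left_filter; exact: cG.
- by rewrite GVn Gn; exact: pcont_within.
Unshelve. all: by end_near. Qed.

End HalfLine.

(** * The Mellin transform of omega *)

Section ComplexHalfLine.
Variable R : realType.
Notation mu := (@lebesgue_measure R).
Implicit Types (x a : R) (z c h : R[i]^o) (g : R -> R[i]^o).

Definition pcontC g :=
  pcont (fun x => complex.Re (g x)) /\ pcont (fun x => complex.Im (g x)).

Definition cintegrable g :=
  mu.-integrable (@halfline R) (EFin \o (fun x => complex.Re (g x))) /\
  mu.-integrable (@halfline R) (EFin \o (fun x => complex.Im (g x))).

Definition cint g : R[i]^o := cintegral (@halfline R) g.

Lemma cReM z c : complex.Re (z * c) =
  complex.Re z * complex.Re c - complex.Im z * complex.Im c.
Proof. by case: z c => [? ?] [? ?]. Qed.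

Lemma cImM z c : complex.Im (z * c) =
  complex.Re z * complex.Im c + complex.Im z * complex.Re c.
Proof. by case: z c => [? ?] [? ?]. Qed.

Lemma cReD z c : complex.Re (z + c) = complex.Re z + complex.Re c.
Proof. by case: z c => [? ?] [? ?]. Qed.

Lemma cImD z c : complex.Im (z + c) = complex.Im z + complex.Im c.
Proof. by case: z c => [? ?] [? ?]. Qed.

Lemma cReB z c : complex.Re (z - c) = complex.Re z - complex.Re c.
Proof. by case: z c => [? ?] [? ?]. Qed.

Lemma cImB z c : complex.Im (z - c) = complex.Im z - complex.Im c.
Proof. by case: z c => [? ?] [? ?]. Qed.

Lemma pcontC_cst c : pcontC (fun=> c).
Proof. by split; exact: pcont_cst. Qed.

Lemma pcontC_real f : pcont f -> pcontC (fun x => (f x)%:C).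
Proof. by move=> cf; split => //; exact: pcont_cst. Qed.

Lemma pcontCM g1 g2 : pcontC g1 -> pcontC g2 -> pcontC (fun x => g1 x * g2 x).
Proof.
move=> [r1 i1] [r2 i2]; split.
  under eq_fun do rewrite cReM.
  by apply: pcontB; exact: pcontM.
under eq_fun do rewrite cImM.
by apply: pcontD; exact: pcontM.
Qed.

Lemma pcontCB g1 g2 : pcontC g1 -> pcontC g2 -> pcontC (fun x => g1 x - g2 x).
Proof.
move=> [r1 i1] [r2 i2]; split.
  by under eq_fun do rewrite cReB; exact: pcontB.
by under eq_fun do rewrite cImB; exact: pcontB.
Qed.

Lemma Re_cpow x z : complex.Re (cpow x z) =
  expR (complex.Re z * ln x) * cos (complex.Im z * ln x).
Proof. by case: z => a b; rewrite /cpow /cexp/= !mulr0 subr0 add0r. Qed.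

Lemma Im_cpow x z : complex.Im (cpow x z) =
  expR (complex.Re z * ln x) * sin (complex.Im z * ln x).
Proof. by case: z => a b; rewrite /cpow /cexp/= !mulr0 subr0 add0r. Qed.

Lemma cmod_cpow x z : cmod (cpow x z) = expR (complex.Re z * ln x).
Proof. by case: z => a b; rewrite /cpow cmod_cexp/= mulr0 subr0. Qed.

Lemma cpowD x z c : cpow x (z + c) = cpow x z * cpow x c.
Proof. by rewrite /cpow mulrDl cexpD. Qed.

Lemma cpowN x z : cpow x (- z) = (cpow x z)^-1.
Proof. by rewrite /cpow mulNr cexpN. Qed.

Lemma cpow_neq0 x z : cpow x z != 0.
Proof. by rewrite -cmod_eq0 cmod_cpow gt_eqF ?expR_gt0. Qed.

Lemma cpow1 x : 0 < x -> cpow x 1 = x%:C :> R[i]^o.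
Proof. by move=> x0; rewrite /cpow mul1r cexp_real lnK. Qed.

Lemma cpowM x y z : 0 < x -> 0 < y -> cpow (x * y) z = cpow x z * cpow y z.
Proof.
by move=> x0 y0; rewrite /cpow lnM ?posrE// rmorphD/= mulrDr cexpD.
Qed.

Lemma pcontC_cpow z : pcontC (fun x => cpow x z).
Proof.
have ce : pcont (fun x : R => expR (complex.Re z * ln x)).
  apply: (@pcont_comp _ (fun x => complex.Re z * ln x) expR).
    exact: continuous_expR.
  by apply: pcontM; [exact: pcont_cst|exact: pcont_ln].
have ci : pcont (fun x : R => complex.Im z * ln x).
  by apply: pcontM; [exact: pcont_cst|exact: pcont_ln].
split.
  under eq_fun do rewrite Re_cpow; apply: pcontM => //.
  by apply: (@pcont_comp _ _ cos) ci; exact: continuous_cos.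
under eq_fun do rewrite Im_cpow; apply: pcontM => //.
by apply: (@pcont_comp _ _ sin) ci; exact: continuous_sin.
Qed.

Lemma cintegrable_dom g (w : R -> R) : pcontC g ->
  mu.-integrable (@halfline R) (EFin \o w) ->
  (forall x, 0 < x -> cmod (g x) <= w x) -> cintegrable g.
Proof.
move=> [cr ci] Iw gw; split; apply: (halfline_dominated_integrable _ _ Iw) => // x x0.
  exact: le_trans (normr_Re_le _) (gw x x0).
exact: le_trans (normr_Im_le _) (gw x x0).
Qed.

Lemma cmod_cint_le g (w : R -> R) : pcontC g ->
  mu.-integrable (@halfline R) (EFin \o w) ->
  (forall x, 0 < x -> cmod (g x) <= w x) ->
  cmod (cint g) <= 2 * \int[mu]_(x in @halfline R) w x.
Proof.
move=> cg Iw gw; have [Ir Ii] := cintegrable_dom cg Iw gw.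
apply: le_trans (cmod_le_ReIm _) _; rewrite mulr_natl mulr2n.
apply: lerD; apply: le_abs_halfline => // x x0.
  exact: le_trans (normr_Re_le _) (gw x x0).
exact: le_trans (normr_Im_le _) (gw x x0).
Qed.

Lemma cintegrableD g1 g2 : cintegrable g1 -> cintegrable g2 ->
  cintegrable (fun x => g1 x + g2 x).
Proof.
move=> [r1 i1] [r2 i2]; have mD := @measurable_halfline R; split.
  rewrite (_ : EFin \o _ = (EFin \o (fun x => complex.Re (g1 x))) \+
     (EFin \o (fun x => complex.Re (g2 x))))%E; first exact: integrableD.
  by apply/funext => x; rewrite /= cReD.
rewrite (_ : EFin \o _ = (EFin \o (fun x => complex.Im (g1 x))) \+
   (EFin \o (fun x => complex.Im (g2 x))))%E; first exact: integrableD.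
by apply/funext => x; rewrite /= cImD.
Qed.

Lemma cintegrableZ c g : cintegrable g -> cintegrable (fun x => c * g x).
Proof.
move=> [rg ig]; have mD := @measurable_halfline R; split.
  rewrite (_ : EFin \o _ = (fun x => (complex.Re c)%:E * (complex.Re (g x))%:E) \+
     (fun x => (- complex.Im c)%:E * (complex.Im (g x))%:E))%E.
    by apply: integrableD => //; exact: integrableZl.
  by apply/funext => x; rewrite /= cReM -mulNr EFinD !EFinM.
rewrite (_ : EFin \o _ = (fun x => (complex.Re c)%:E * (complex.Im (g x))%:E) \+
   (fun x => (complex.Im c)%:E * (complex.Re (g x))%:E))%E.
  by apply: integrableD => //; exact: integrableZl.
by apply/funext => x; rewrite /= cImM EFinD !EFinM.
Qed.

Lemma cintegrableB g1 g2 : cintegrable g1 -> cintegrable g2 ->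
  cintegrable (fun x => g1 x - g2 x).
Proof.
move=> i1 i2; under eq_fun do rewrite -mulN1r.
by apply: cintegrableD => //; exact: cintegrableZ.
Qed.

Lemma cintD g1 g2 : cintegrable g1 -> cintegrable g2 ->
  cint (fun x => g1 x + g2 x) = cint g1 + cint g2.
Proof.
move=> [r1 i1] [r2 i2]; have mD := @measurable_halfline R.
rewrite /cint /cintegral; under eq_Rintegral do rewrite cReD.
rewrite RintegralD//; under [X in _ +i* X]eq_Rintegral do rewrite cImD.
by rewrite RintegralD.
Qed.

Lemma cintZ c g : cintegrable g -> cint (fun x => c * g x) = c * cint g.
Proof.
move=> [rg ig]; have mD := @measurable_halfline R.
have iZ (f : R -> R) (k : R) : mu.-integrable (@halfline R) (EFin \o f) ->
    mu.-integrable (@halfline R) (EFin \o (fun x => k * f x)).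
  move=> If; rewrite (_ : EFin \o _ = (fun x => k%:E * (f x)%:E)%E).
    exact: integrableZl.
  by apply/funext => x; rewrite /= EFinM.
rewrite /cint /cintegral; under eq_Rintegral do rewrite cReM.
under [X in _ +i* X = _]eq_Rintegral do rewrite cImM.
rewrite RintegralB ?RintegralD//; try exact: iZ.
rewrite !RintegralZl//.
by apply/eqP; rewrite eq_complex/= cReM cImM /=; apply/andP.
Qed.

Lemma cintB g1 g2 : cintegrable g1 -> cintegrable g2 ->
  cint (fun x => g1 x - g2 x) = cint g1 - cint g2.
Proof.
move=> i1 i2; under eq_fun do rewrite -mulN1r.
by rewrite cintD ?cintZ ?mulN1r//; exact: cintegrableZ.
Qed.

Lemma eq_cintegrable g1 g2 : (forall x, 0 < x -> g1 x = g2 x) ->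
  cintegrable g1 -> cintegrable g2.
Proof.
move=> gg [r1 i1]; have mD := @measurable_halfline R; split.
  by apply: eq_integrable r1 => // x; rewrite inE halflineE => /gg /= ->.
by apply: eq_integrable i1 => // x; rewrite inE halflineE => /gg /= ->.
Qed.

Lemma eq_cint g1 g2 : (forall x, 0 < x -> g1 x = g2 x) -> cint g1 = cint g2.
Proof.
move=> gg; rewrite /cint /cintegral; congr (_ +i* _); apply: eq_Rintegral => x;
by rewrite inE halflineE => /gg ->.
Qed.

End ComplexHalfLine.

Section MellinOmega.
Variable R : realType.
Notation mu := (@lebesgue_measure R).
Implicit Types (x a : R) (z s h : R[i]^o) (q : R -> R[i]^o).

(** A weight bounding [x], [1/x], [|ln x|], and the powers of [x], whose powers
    are absorbed by the decay of [omega] at both ends of the half-line. *)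
Definition ends_weight x : R := x + x^-1.

Local Notation Y := ends_weight.

Lemma ends_weight_ge1 x : 0 < x -> 1 <= Y x.
Proof.
move=> x0; have xV : 0 < x^-1 by rewrite invr_gt0.
have [x1|x1] := leP 1 x; first by rewrite /Y; lra.
by have : 1 <= x^-1; [rewrite invf_ge1// ltW|rewrite /Y; lra].
Qed.

Lemma normr_ln_le_weight x : 0 < x -> `|ln x| <= Y x.
Proof.
move=> x0; have xV : 0 < x^-1 by rewrite invr_gt0.
have := ln_sublinear x0; have := ln_sublinear xV; rewrite lnV ?posrE//.
by rewrite ler_norml /Y; lra.
Qed.

Lemma expR_ln_le_weight x a k : 0 < x -> `|a| <= k%:R -> expR (a * ln x) <= Y x ^+ k.
Proof.
move=> x0 ak; have xV : 0 < x^-1 by rewrite invr_gt0.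
apply: (@le_trans _ _ (expR `|ln x| ^+ k)).
  rewrite -expRM_natl ler_expR; apply: le_trans (ler_norm _) _.
  by rewrite normrM ler_wpM2r.
rewrite lerXn2r ?nnegrE ?expR_ge0//; first by rewrite /Y; lra.
have [l0|l0] := leP 0 (ln x); first by rewrite ger0_norm// lnK ?posrE// /Y; lra.
by rewrite ltr0_norm// -lnV ?posrE// lnK ?posrE// /Y; lra.
Qed.

Lemma omega_weight_le k : exists2 C : R, 0 <= C &
  forall x, 0 < x -> `|omega x| * Y x ^+ k <= C * expR (- (4^-1 * x)).
Proof.
exists (304 * (4 ^+ k * k`!%:R)); first by rewrite !mulr_ge0 ?ler0n ?exprn_ge0 ?ler0n.
move=> x x0; have xV : 0 < x^-1 by rewrite invr_gt0.
have Y0 : 0 <= Y x / 4 by rewrite divr_ge0// /Y; lra.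
have := exprn_le_fact_exp k Y0; rewrite expr_div_n ler_pdivrMr ?exprn_gt0// => H.
apply: le_trans (ler_pM (normr_ge0 _) _ (omega_le x0) H) _.
  by rewrite exprn_ge0// /Y; lra.
rewrite -!mulrA ler_pM2l ?ltr0n// mulrC -!mulrA [leRHS]mulrA [4 ^+ k * _]mulrC.
rewrite -[leRHS]mulrA ler_wpM2l// mulrCA ler_wpM2l ?exprn_ge0//.
by rewrite -expRD ler_expR /Y; lra.
Qed.

(** The form in which integrals against [omega] are estimated: a polynomial bound
    in [ends_weight] suffices. *)
Lemma omega_cint k : exists2 C : R, 0 <= C & forall q (K : R), 0 <= K -> pcontC q ->
  (forall x, 0 < x -> cmod (q x) <= K * Y x ^+ k) ->
  cintegrable (fun x => (omega x)%:C * q x) /\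
  cmod (cint (fun x => (omega x)%:C * q x)) <= K * C.
Proof.
have [C C0 CP] := omega_weight_le k.
have c4 : 0 < 4^-1 :> R by rewrite invr_gt0.
have Ie := integrable_halfline_expR c4.
pose I := \int[mu]_(x in @halfline R) expR (- (4^-1 * x)).
have I0 : 0 <= I by apply: Rintegral_ge0 => x _; exact: expR_ge0.
exists (2 * (C * I)); first by rewrite !mulr_ge0.
move=> q K K0 cq qK.
have cw : pcontC (fun x => (omega x)%:C * q x).
  by apply: pcontCM => //; apply: pcontC_real => x; exact: continuous_omega.
have le x : 0 < x -> cmod ((omega x)%:C * q x) <= K * C * expR (- (4^-1 * x)).
  move=> x0; rewrite cmodM cmodR.
  apply: le_trans (ler_wpM2l (normr_ge0 _) (qK x x0)) _.
  by rewrite mulrCA -mulrA ler_wpM2l// CP.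
have mD := @measurable_halfline R.
have Iw : mu.-integrable (@halfline R) (EFin \o (fun x => K * C * expR (- (4^-1 * x)))).
  rewrite (_ : EFin \o _ = (fun x => (K * C)%:E * (expR (- (4^-1 * x)))%:E)%E).
    exact: integrableZl.
  by apply/funext => x; rewrite /= EFinM.
split; first exact: cintegrable_dom Iw le.
apply: le_trans (cmod_cint_le cw Iw le) _.
by rewrite RintegralZl// -/I le_eqVlt; apply/orP; left; apply/eqP; ring.
Qed.

Definition xi_mellin s : R[i]^o := cint (fun x => (omega x)%:C * cpow x (s / 2 - 1)).

Lemma cmod_cpow_le z : exists k, forall x, 0 < x -> cmod (cpow x z) <= Y x ^+ k.
Proof.
exists (Num.bound `|complex.Re z|) => x x0; rewrite cmod_cpow.
by apply: expR_ln_le_weight => //; rewrite ltW// archi_boundP.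
Qed.

Lemma xi_mellin_cintegrable z : cintegrable (fun x => (omega x)%:C * cpow x z).
Proof.
have [k kP] := cmod_cpow_le z; have [C C0 CP] := omega_cint k.
have [] // := CP _ 1 ler01 (pcontC_cpow z).
by move=> x x0; rewrite mul1r; exact: kP.
Qed.

(** Differentiation under the integral sign. The second-order remainder of
    [x^(h/2)] costs the factors [(ln x)^2] and [exp |ln x|], bounded by the cube
    of [ends_weight]. *)
Lemma entire_xi_mellin : entire xi_mellin.
Proof.
move=> s; set z := s / 2 - 1.
have [k kP] := cmod_cpow_le z; have [C C0 CP] := omega_cint (k + 3)%N.
have Yk x n m : 0 < x -> (n <= m)%N -> Y x ^+ n <= Y x ^+ m.
  by move=> x0 nm; apply: ler_weXn2l => //; exact: ends_weight_ge1.
pose q1 x : R[i]^o := (ln x / 2)%:C * cpow x z.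
have cq1 : pcontC q1.
  apply: pcontCM; last exact: pcontC_cpow.
  by apply: pcontC_real; apply: pcontM; [exact: pcont_ln|exact: pcont_cst].
have [i1 _] : cintegrable (fun x => (omega x)%:C * q1 x) /\
    cmod (cint (fun x => (omega x)%:C * q1 x)) <= 1 * C.
  apply: CP => // x x0; rewrite mul1r cmodM cmodR.
  apply: (@le_trans _ _ (Y x * Y x ^+ k)); last by rewrite -exprS Yk// -addn1 leq_add2l.
  rewrite ler_pM ?cmod_ge0 ?kP// normrM [`|2^-1|]ger0_norm//.
  by have := normr_ln_le_weight x0; have := normr_ge0 (ln x); lra.
apply: (@derivable_quadratic _ _ _ (cint (fun x => (omega x)%:C * q1 x)) (5 * C)) => h h1.
have h0 := cmod_ge0 h.
pose kk x : R[i]^o := h / 2 * (ln x)%:C.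
pose q2 x : R[i]^o := cpow x z * (cexp (kk x) - 1 - kk x).
have E : xi_mellin (s + h) - xi_mellin s - cint (fun x => (omega x)%:C * q1 x) * h =
    cint (fun x => (omega x)%:C * q2 x).
  rewrite [_ * h]mulrC -cintZ// -cintB; [|exact: xi_mellin_cintegrable..].
  rewrite -cintB; last exact: cintegrableZ.
    apply: eq_cint => x x0; rewrite /q1 /q2 -/z.
    have -> : (s + h) / 2 - 1 = z + h / 2 by rewrite /z mulrDl addrAC.
    by rewrite cpowD /cpow -/(kk x) /kk rmorphM/= fmorphV/= rmorphMn/=; ring.
  by apply: cintegrableB; exact: xi_mellin_cintegrable.
rewrite E mulrAC; have [|//|x x0|//] := CP q2 (5 * cmod h ^+ 2).
- by rewrite mulr_ge0// exprn_ge0.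
- rewrite /q2; apply: pcontCM; first exact: pcontC_cpow.
  apply: pcontCB.
    apply: pcontCB; last exact: pcontC_cst.
    have -> : (fun x => cexp (kk x)) = (fun x => cpow x (h / 2)) by [].
    exact: pcontC_cpow.
  by apply: pcontCM; [exact: pcontC_cst|apply: pcontC_real; exact: pcont_ln].
have ckk : cmod (kk x) <= cmod h * Y x.
  rewrite /kk !cmodM cmodV cmodR (_ : cmod 2 = 2); last first.
    by rewrite (_ : 2 = (2 : R)%:C) ?cmodR ?ger0_norm// rmorphMn.
  have := normr_ln_le_weight x0; have := normr_ge0 (ln x) => l0 l1.
  have : cmod h * `|ln x| <= cmod h * Y x by rewrite ler_wpM2l.
  have : 0 <= cmod h * `|ln x| by rewrite mulr_ge0.
  by lra.
have ekk : expR (cmod (kk x)) <= Y x.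
  apply: (@le_trans _ _ (expR `|ln x|)).
    rewrite ler_expR /kk !cmodM cmodV cmodR (_ : cmod 2 = 2); last first.
      by rewrite (_ : 2 = (2 : R)%:C) ?cmodR ?ger0_norm// rmorphMn.
    rewrite ler_piMl// ler_pdivrMr//; lra.
  have l1 : `|1| <= 1%:R :> R by rewrite normr1.
  have l2 : `|-1| <= 1%:R :> R by rewrite normrN normr1.
  have := expR_ln_le_weight x0 l1; have := expR_ln_le_weight x0 l2.
  by rewrite mulN1r mul1r expr1; case: (ger0P (ln x)).
rewrite /q2 cmodM.
apply: (@le_trans _ _ (Y x ^+ k * (5 * (cmod h * Y x) ^+ 2 * Y x))).
  apply: ler_pM; rewrite ?cmod_ge0 ?kP//.
  apply: le_trans (cmod_cexpB1D_le _) _; apply: ler_pM => //.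
  - by rewrite mulr_ge0// exprn_ge0// cmod_ge0.
  - rewrite ler_pM2l// lerXn2r ?nnegrE ?cmod_ge0//.
    exact: le_trans (cmod_ge0 _) ckk.
by rewrite le_eqVlt; apply/orP; left; apply/eqP; rewrite exprMn exprD !exprS expr0; ring.
Qed.

End MellinOmega.

(** * Meixner-Pollaczek polynomials *)

Section MeixnerPollaczek.
Variable R : realType.
Implicit Types (n k m : nat) (b x tau : R[i]^o).

Lemma pochhammerS (a : R[i]^o) n : pochhammer a n.+1 = pochhammer a n * (a + n%:R).
Proof. by rewrite /pochhammer big_ord_recr. Qed.

Lemma pochhammer0 (a : R[i]^o) : pochhammer a 0 = 1.
Proof. by rewrite /pochhammer big_ord0. Qed.

Lemma pochhammer_Nnat n k :
  pochhammer (- n%:R : R[i]^o) k = (-1) ^+ k * ('C(n, k) * k`!)%:R.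
Proof.
rewrite bin_ffact; elim: k => [|k IH]; first by rewrite pochhammer0 ffactn0 mulr1.
rewrite pochhammerS IH ffactnSr natrM exprS.
have [kn|nk] := leqP k n; first by rewrite natrB//; ring.
by rewrite ffact_small// !(mul0r, mulr0).
Qed.

Lemma three_halves_neq0 n : (3 / 2 + n%:R : R[i]^o) != 0.
Proof.
have -> : 3 / 2 + n%:R = (3 + 2 * n)%:R / 2%:R :> R[i]^o.
  by rewrite natrD natrM; field.
by rewrite mulf_neq0 ?invr_eq0 ?pnatr_eq0.
Qed.

Lemma pochhammer32_neq0 n : pochhammer (3 / 2 : R[i]^o) n != 0.
Proof.
elim: n => [|n IH]; first by rewrite pochhammer0 oner_neq0.
by rewrite pochhammerS mulf_neq0// three_halves_neq0.
Qed.

Lemma hyp2F1_terminating n b (c z : R[i]^o) :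
  hyp2F1 (- n%:R) b c z = \sum_(0 <= k < n.+1)
    pochhammer (- n%:R : R[i]^o) k * pochhammer b k / (pochhammer c k * (k`!)%:R) * z ^+ k.
Proof.
rewrite /hyp2F1; apply: cvg_lim; first exact: norm_hausdorff.
apply: cvg_near_cst; exists n.+1 => // K /= nK.
rewrite /series/= (big_cat_nat (n := n.+1))//= [X in _ + X]big_nat_cond.
rewrite [X in _ + X]big1 ?addr0// => k /andP[/andP[nk _] _].
by rewrite pochhammer_Nnat bin_small// mul0n mulr0 !mul0r.
Qed.

Section Recurrence.
Variable tau : R[i]^o.
Let b : R[i]^o := 3 / 4 + 'i * tau.

(** The Taylor coefficients at [u = 0] of
    [(1 + u)^(- 3/4 + i tau) (1 - u)^(- 3/4 - i tau)]. *)
Definition mp_coef n : R[i]^o := 'i ^+ n * f_poly n tau.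

(* The summand of [mp_coef n] is [A n * 'C(n, k) * D k], where [A] and [D] have
   the first-order recurrences [AS] and [DS]. *)
Let A n : R[i]^o := (-1) ^+ n * (pochhammer (3 / 2) n / (n`!)%:R).
Let D k : R[i]^o := (- 2) ^+ k * (pochhammer b k / pochhammer (3 / 2) k).

Let DS k : D k.+1 * (3 / 2 + k%:R) = D k * (- 2) * (b + k%:R).
Proof.
rewrite /D !pochhammerS exprS.
have := pochhammer32_neq0 k; have := three_halves_neq0 k.
move: (pochhammer (3 / 2) k) (3 / 2 + k%:R) => p c c0 p0.
by field; rewrite c0 p0.
Qed.

Let AS n : n.+1%:R * A n.+1 = - (3 / 2 + n%:R) * A n.
Proof.
rewrite /A pochhammerS factS natrM exprS.
have f0 : (n`!)%:R != 0 :> R[i]^o by rewrite pnatr_eq0 -lt0n fact_gt0.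
have n0 : n.+1%:R != 0 :> R[i]^o by rewrite pnatr_eq0.
move: (n.+1%:R : R[i]^o) ((n`!)%:R : R[i]^o) (3 / 2 + n%:R : R[i]^o) f0 n0 => x y c y0 x0.
by field; rewrite x0 y0.
Qed.

Let mp_coefE n K : (n < K)%N ->
  mp_coef n = \sum_(0 <= k < K) A n * 'C(n, k)%:R * D k.
Proof.
move=> nK; rewrite [RHS](big_cat_nat (n := n.+1))//= [X in _ = _ + X]big_nat_cond.
rewrite [X in _ = _ + X]big1 ?addr0; last first.
  by move=> k /andP[/andP[nk _] _]; rewrite bin_small// mulr0 mul0r.
rewrite /mp_coef /f_poly hyp2F1_terminating mulr_sumr mulr_sumr.
apply: eq_bigr => k _; rewrite pochhammer_Nnat natrM.
have f0 : (k`!)%:R != 0 :> R[i]^o by rewrite pnatr_eq0 -lt0n fact_gt0.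
have i2 : 'i ^+ n * 'i ^+ n = (-1) ^+ n :> R[i]^o.
  by rewrite -exprMn -expr2 sqr_i.
have N2 : (- 2) ^+ k = (-1) ^+ k * 2 ^+ k :> R[i]^o by rewrite -exprMn mulN1r.
have n0 : (n`!)%:R != 0 :> R[i]^o by rewrite pnatr_eq0 -lt0n fact_gt0.
rewrite /A /D N2 -i2 -/b; have := pochhammer32_neq0 k.
move: (pochhammer (3 / 2) k) (pochhammer (3 / 2) n) => p q p0.
move: ((n`!)%:R : R[i]^o) ((k`!)%:R : R[i]^o) f0 n0 => x y x0 y0.
by field; rewrite x0 y0 p0.
Qed.

(* Creative telescoping leaves a relation between neighbouring binomial
   coefficients. *)
Let bin_identity n k :
  (n%:R + 5 / 2) * 'C(n.+2, k.+1)%:R = n.+1%:R * 'C(n, k.+1)%:R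
    + (2 * k.+1%:R + 3 / 2) * 'C(n.+1, k.+1)%:R + (k.+1%:R + 1 / 2) * 'C(n.+1, k)%:R
    :> R[i]^o.
Proof.
have h1 : (n.+1%:R - k%:R) * 'C(n.+1, k)%:R = k.+1%:R * 'C(n.+1, k.+1)%:R :> R[i]^o.
  have [kn|nk] := leqP k n.+1.
    by rewrite -natrB// -!natrM mul_bin_left.
  by rewrite !bin_small ?mulr0//; lia.
have h2 : (n.+1%:R - k.+1%:R) * 'C(n.+1, k.+1)%:R = n.+1%:R * 'C(n, k.+1)%:R :> R[i]^o.
  have [kn|nk] := leqP k.+1 n.+1.
    by rewrite -natrB// -!natrM -mul_bin_down.
  by rewrite !bin_small ?mulr0//; lia.
rewrite -h2 (binS n.+1 k) natrD -(natr1 n) -(natr1 k) in h1 *.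
transitivity ((n%:R + 5 / 2) * 'C(n.+1, k.+1)%:R + (k%:R + 1 + 1/2) * 'C(n.+1, k)%:R
   + (n%:R + 1 - k%:R) * 'C(n.+1, k)%:R : R[i]^o).
  by field.
by rewrite h1; field.
Qed.

Lemma mp_coef0 : mp_coef 0 = 1.
Proof.
rewrite (@mp_coefE 0 1)// big_nat1 /A /D !expr0 !pochhammer0 fact0 bin0.
by rewrite !mulr1 !divr1 !mul1r.
Qed.

Lemma mp_coef1 : mp_coef 1 = 2 * 'i * tau.
Proof.
rewrite (@mp_coefE 1 2)// big_nat_recr//= big_nat1 /A /D !pochhammerS !pochhammer0.
rewrite bin0 bin1 -[1`!]/1%N !expr0 !expr1 /b.
by field.
Qed.

(** The three-term recurrence is the differential equation of the generating
    function read off on coefficients. It is proved by creative telescoping: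
    for the summands it holds up to the difference [H k - H (k - 1)]. *)
Lemma mp_coef_rec n : n.+2%:R * mp_coef n.+2 =
  2 * 'i * tau * mp_coef n.+1 + (n%:R + 3 / 2) * mp_coef n.
Proof.
rewrite (@mp_coefE n.+2 n.+3)// (@mp_coefE n.+1 n.+3)// (@mp_coefE n n.+3)//; last lia.
pose H k : R[i]^o := A n.+1 * 'C(n.+1, k)%:R * D k * (- 2) * (b + k%:R).
have e0 : 2 * 'i * tau = 2 * b - 3 / 2 :> R[i]^o by rewrite /b; field.
have An : (n%:R + 3 / 2) * A n = - (n.+1%:R * A n.+1) by rewrite AS; ring.
have An2 : n.+2%:R * A n.+2 = - (n%:R + 5 / 2) * A n.+1.
  by rewrite AS -(natr1 n); field.
apply/eqP; rewrite -subr_eq0 !mulr_sumr opprD -!sumrN addrA -!big_split/=.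
rewrite big_ltn//= big_add1/= (eq_big_nat _ _ (F2 := fun k => H k.+1 - H k)); last first.
  move=> k _; rewrite /H.
  transitivity (n.+2%:R * A n.+2 * ('C(n.+2, k.+1)%:R * D k.+1)
    - (2 * b - 3 / 2) * A n.+1 * ('C(n.+1, k.+1)%:R * D k.+1)
    - ((n%:R + 3 / 2) * A n) * ('C(n, k.+1)%:R * D k.+1) : R[i]^o).
    by rewrite e0; ring.
  rewrite An An2.
  transitivity (A n.+1 * D k.+1 * (- ((n%:R + 5 / 2) * 'C(n.+2, k.+1)%:R)
     - (2 * b - 3 / 2) * 'C(n.+1, k.+1)%:R + n.+1%:R * 'C(n, k.+1)%:R) : R[i]^o).
    by ring.
  rewrite bin_identity.
  transitivity (A n.+1 * 'C(n.+1, k.+1)%:R * D k.+1 * - 2 * (b + k.+1%:R) -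
    A n.+1 * 'C(n.+1, k)%:R * (D k.+1 * (3 / 2 + k%:R)) : R[i]^o).
    by rewrite -(natr1 k); field.
  by rewrite DS; ring.
rewrite telescope_sumr//= /H [X in _ + (X - _)](_ : _ = 0); last first.
  by rewrite bin_small ?mulr0 ?mul0r.
rewrite sub0r !bin0 mulr1; apply/eqP.
transitivity (n.+2%:R * A n.+2 * D 0%N - (2 * b - 3 / 2) * A n.+1 * D 0%N
  - ((n%:R + 3 / 2) * A n) * D 0%N + A n.+1 * D 0%N * 2 * (b + 0%:R) : R[i]^o).
  by rewrite e0; ring.
by rewrite An An2 -(natr1 n); field.
Qed.

End Recurrence.

(** By induction on the recurrence, Bernoulli's inequality providing the room:
    [(n + 1)^B (n + 1 + B) <= (n + 1) (n + 2)^B]. *)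
Lemma mp_coef_bound tau (B : nat) : 2 * cmod tau <= B%:R ->
  forall n, cmod (mp_coef tau n) <= n.+1%:R ^+ B.
Proof.
move=> tB.
have cn (k : nat) : cmod (k%:R : R[i]^o) = k%:R.
  by rewrite (_ : k%:R = (k%:R : R)%:C) ?cmodR ?ger0_norm// rmorph_nat.
have cbeta : cmod (2 * 'i * tau) <= B%:R.
  rewrite !cmodM (cn 2%N) (_ : cmod 'i = 1) ?mulr1//.
  by rewrite /cmod/= expr0n expr1n add0r sqrtr1.
have bern n : n.+1%:R ^+ B * (n.+1%:R + B%:R) <= n.+1%:R * n.+2%:R ^+ B :> R.
  elim: (B) => [|k IH]; first by rewrite !expr0 addr0 mulr1 mul1r.
  have -> : n.+1%:R * n.+2%:R ^+ k.+1 = (n.+1%:R * n.+2%:R ^+ k) * n.+2%:R :> R.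
    by rewrite exprSr mulrA.
  apply: le_trans (ler_wpM2r (ler0n _ n.+2) IH).
  rewrite exprSr -mulrA -[leRHS]mulrA ler_wpM2l ?exprn_ge0//.
  rewrite -(natr1 n.+1) -(natr1 k).
  have : 0 <= k%:R :> R by []. by lra.
suff H n : cmod (mp_coef tau n) <= n.+1%:R ^+ B /\
    cmod (mp_coef tau n.+1) <= n.+2%:R ^+ B by move=> n; have [] := H n.
elim: n => [|n [IH1 IH2]].
  rewrite mp_coef0 mp_coef1 (cn 1%N) expr1n lexx; split => //.
  apply: le_trans cbeta _; have := bern 0%N; rewrite expr1n !mul1r.
  by rewrite -[1%:R]/(1 : R); lra.
split=> //.
have n20 : 0 < n.+2%:R :> R by rewrite ltr0n.
rewrite -(ler_pM2l n20) -(cn n.+2) -cmodM mp_coef_rec cn.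
apply: le_trans (bern n.+1); rewrite mulrDr [leRHS]addrC.
apply: le_trans (cmodD _ _) _; apply: lerD.
  rewrite cmodM mulrC; apply: ler_pM => //; exact: cmod_ge0.
rewrite cmodM [leRHS]mulrC; apply: ler_pM => //; first exact: cmod_ge0.
- exact: cmod_ge0.
- apply: le_trans (cmodD _ _) _; rewrite cmodM cmodV !cn -(natr1 n.+1) -(natr1 n).
  by have : 0 <= n%:R :> R by []; lra.
- by apply: le_trans IH1 _; rewrite lerXn2r ?nnegrE// ler_nat.
Qed.

Section Truncations.
Variable tau : R[i]^o.
Local Notation g := (mp_coef tau).

Definition mp_sum m (u : R) : R[i]^o := \sum_(0 <= n < m.+1) g n * (u ^+ n)%:C.

Definition mp_dsum m (u : R) : R[i]^o :=
  \sum_(0 <= n < m.+1) g n * (n%:R * u ^+ n.-1)%:C.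

(** The truncated series satisfies the differential equation of the generating
    function up to two terms of top degree. *)
Lemma mp_sum_ode m u :
  (1 - u%:C ^+ 2) * mp_dsum m u - (2 * 'i * tau + 3 / 2 * u%:C) * mp_sum m u =
  - (m.+1%:R * g m.+1 * u%:C ^+ m + (m%:R + 3 / 2) * g m * u%:C ^+ m.+1).
Proof.
elim: m => [|m IH].
  rewrite /mp_dsum /mp_sum !big_nat1 mp_coef0 mp_coef1 mul0r !expr0 expr1.
  by rewrite mulr0 mulr1 ?mul1r -?[(0 : R)%:C]/(0 : R[i]^o); ring.
rewrite /mp_dsum /mp_sum !(big_nat_recr m.+1)//= -/(mp_dsum m u) -/(mp_sum m u).
rewrite mulrDr mulrDr opprD addrACA IH.
rewrite rmorphM/= !rmorphXn/= rmorph_nat.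
transitivity (- (m%:R + 3 / 2) * g m * u%:C ^+ m.+1
  - m.+1%:R * g m.+1 * u%:C ^+ m.+2 - (2 * 'i * tau * g m.+1) * u%:C ^+ m.+1
  - 3 / 2 * g m.+1 * u%:C ^+ m.+2 : R[i]^o).
  by rewrite !exprS; ring.
have -> : 2 * 'i * tau * g m.+1 = m.+2%:R * g m.+2 - (m%:R + 3 / 2) * g m.
  by rewrite mp_coef_rec; ring.
by ring.
Qed.

End Truncations.
End MeixnerPollaczek.

(** * The expansion of a power in the Cayley variable *)

Section ComplexValuedDerivative.
Variable R : realType.
Implicit Types (x : R) (g : R -> R[i]^o) (l w : R[i]^o).

Definition is_cderive g x l :=
  is_derive x 1 (fun x => complex.Re (g x)) (complex.Re l) /\
  is_derive x 1 (fun x => complex.Im (g x)) (complex.Im l).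

Lemma is_cderive_eq g x l l' : is_cderive g x l -> l = l' -> is_cderive g x l'.
Proof. by move=> ? <-. Qed.

Lemma is_cderive_cst w x : is_cderive (fun=> w) x 0.
Proof. by split; exact: is_derive_cst. Qed.

Lemma is_cderive_real (f : R -> R) x (l : R) :
  is_derive x 1 f l -> is_cderive (fun x => (f x)%:C) x l%:C.
Proof. by move=> df; split => //=; exact: is_derive_cst. Qed.

Lemma is_cderiveD g1 g2 x l1 l2 : is_cderive g1 x l1 -> is_cderive g2 x l2 ->
  is_cderive (fun x => g1 x + g2 x) x (l1 + l2).
Proof.
move=> [r1 i1] [r2 i2]; split.
  under eq_fun do rewrite cReD; rewrite cReD.
  exact: is_deriveD.
under eq_fun do rewrite cImD; rewrite cImD.
exact: is_deriveD.
Qed.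

Lemma is_cderiveM g1 g2 x l1 l2 : is_cderive g1 x l1 -> is_cderive g2 x l2 ->
  is_cderive (fun x => g1 x * g2 x) x (l1 * g2 x + g1 x * l2).
Proof.
move=> [r1 i1] [r2 i2]; split.
  under eq_fun do rewrite cReM; rewrite cReD !cReM.
  apply: is_derive_eq.
  by rewrite /GRing.scale/=; ring.
under eq_fun do rewrite cImM; rewrite cImD !cImM.
apply: is_derive_eq.
by rewrite /GRing.scale/=; ring.
Qed.

Lemma is_cderive_cpow w x : 0 < x ->
  is_cderive (fun x => cpow x w) x (w * cpow x w * (x^-1)%:C).
Proof.
move=> x0; have dl := is_derive1_ln x0.
case: w => a b; have dlin (c : R) : is_derive x 1 (fun x : R => c * ln x) (c * x^-1).
  by apply: is_derive_eq; rewrite /GRing.scale/=; ring.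
have de : is_derive x 1 (fun x : R => expR (a * ln x)) (expR (a * ln x) * (a * x^-1)).
  exact: (@is_derive1_comp _ expR (fun x : R => a * ln x) x _ _ (is_derive_expR _) (dlin a)).
have dc : is_derive x 1 (fun x : R => cos (b * ln x)) (- sin (b * ln x) * (b * x^-1)).
  exact: (@is_derive1_comp _ cos (fun x : R => b * ln x) x _ _ (is_derive_cos _) (dlin b)).
have ds : is_derive x 1 (fun x : R => sin (b * ln x)) (cos (b * ln x) * (b * x^-1)).
  exact: (@is_derive1_comp _ sin (fun x : R => b * ln x) x _ _ (is_derive_sin _) (dlin b)).
split.
  under eq_fun do rewrite Re_cpow.
  apply: is_derive_eq.
  by rewrite /cpow/cexp/GRing.scale/= !mulr0 !subr0 !add0r; ring.
under eq_fun do rewrite Im_cpow.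
apply: is_derive_eq.
by rewrite /cpow/cexp/GRing.scale/= !mulr0 !subr0 !add0r; ring.
Qed.

Lemma mvt_bound (f df : R -> R) (a b K : R) : a <= b ->
  (forall y, a <= y <= b -> is_derive y 1 f (df y)) ->
  (forall y, a <= y <= b -> `|df y| <= K) -> `|f b - f a| <= K * (b - a).
Proof.
move=> ab dfP fK; have [||c] := @MVT_segment R f df a b ab.
- by move=> y; rewrite in_itv/= => /andP[ay yb]; apply: dfP; rewrite !ltW.
- apply: derivable_within_continuous => y; rewrite in_itv/= => yab.
  exact: (@ex_derive _ _ _ _ _ _ _ (dfP y yab)).
rewrite in_itv/= => cab ->; rewrite normrM (ger0_norm (_ : 0 <= b - a)) ?subr_ge0//.
by rewrite ler_wpM2r ?subr_ge0// fK.
Qed.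

Lemma cmod_mvt_bound g (dg : R -> R[i]^o) (a b K : R) : a <= b ->
  (forall y, a <= y <= b -> is_cderive g y (dg y)) ->
  (forall y, a <= y <= b -> cmod (dg y) <= K) ->
  cmod (g b - g a) <= 2 * K * (b - a).
Proof.
move=> ab dgP gK; apply: le_trans (cmod_le_ReIm _) _; rewrite cReB cImB.
have hr := @mvt_bound (fun x => complex.Re (g x)) (fun x => complex.Re (dg x)) a b K ab.
have hi := @mvt_bound (fun x => complex.Im (g x)) (fun x => complex.Im (dg x)) a b K ab.
have := hr (fun y yab => (dgP y yab).1) (fun y yab => le_trans (normr_Re_le _) (gK y yab)).
have := hi (fun y yab => (dgP y yab).2) (fun y yab => le_trans (normr_Im_le _) (gK y yab)).
lra.
Qed.

End ComplexValuedDerivative.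

Section Remainder.
Variable R : realType.
Implicit Types (x y : R) (m k : nat).
Local Notation Y := (@ends_weight R).

(** The variable [u] with [x = (1 + u) / (1 - u)]. *)
Definition cayley x : R := (x - 1) / (x + 1).

(** [(x + 1)^(- 3/2)], which is [((1 - u) / 2)^(3/2)]. *)
Definition cayley_weight x : R := expR (- (3 / 2) * ln (x + 1)).

Local Notation u := cayley.
Local Notation w := cayley_weight.

Lemma is_derive_cayley x : 0 < x -> is_derive x 1 u (2 / (x + 1) ^+ 2).
Proof.
move=> x0; have x1 : x + 1 != 0 by rewrite gt_eqF//; lra.
have d1 : is_derive x 1 (fun x : R => x - 1) 1.
  by apply: is_derive_eq; rewrite subr0.
have d2 : is_derive x 1 (fun x : R => x + 1) 1.
  by apply: is_derive_eq; rewrite addr0.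
have dV : is_derive x 1 (fun x : R => (x + 1)^-1) (- (x + 1) ^- 2 *: (1 : R)).
  by apply: is_deriveV.
apply: is_derive_eq.
by rewrite /GRing.scale/=; field.
Qed.

Lemma is_derive_cayley_weight x : 0 < x ->
  is_derive x 1 w (- (3 / 2) * w x / (x + 1)).
Proof.
move=> x0; have x1 : 0 < x + 1 by lra.
have d2 : is_derive x 1 (fun x : R => x + 1) 1.
  by apply: is_derive_eq; rewrite addr0.
have d3 := @is_derive1_comp _ (@ln R) (fun x : R => x + 1) x _ _ (is_derive1_ln x1) d2.
have d4 : is_derive x 1 (fun x : R => - (3 / 2) * ln (x + 1)) (- (3 / 2) * ((x + 1)^-1 * 1)).
  exact: (is_deriveZ (- (3 / 2)) d3).
have d5 : is_derive x 1 w (w x * (- (3 / 2) * ((x + 1)^-1 * 1))).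
  exact: (@is_derive1_comp _ expR (fun x : R => - (3 / 2) * ln (x + 1)) x _ _
    (is_derive_expR _) d4).
by apply: is_derive_eq; rewrite mulr1; ring.
Qed.

Lemma cayley_weight_le1 x : 0 < x -> 0 <= w x <= 1.
Proof.
move=> x0; rewrite expR_ge0/= expR_le1.
by have := @ln_ge0 _ (x + 1) => H; have := H _; lra.
Qed.

Lemma ends_weight_mono x y : 0 < x -> 0 < y -> (1 <= y <= x) || (x <= y <= 1) -> Y y <= Y x.
Proof.
move=> x0 y0 xy; rewrite -subr_ge0.
have -> : Y x - Y y = (x - y) * (1 - (x * y)^-1).
  by rewrite /ends_weight; field; rewrite !gt_eqF.
have xy0 : 0 < x * y by rewrite mulr_gt0.
case/orP: xy => /andP[h1 h2].
  rewrite mulr_ge0 ?subr_ge0// invf_le1//; apply: mulr_ege1 => //.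
  exact: le_trans h2.
rewrite mulr_le0 ?subr_le0// invf_ge1//.
by apply: mulr_ile1; rewrite ?(ltW x0) ?(ltW y0)//; exact: le_trans h1 h2.
Qed.

Lemma normr_cayley_mono x y : 0 < x -> 0 < y ->
  (1 <= y <= x) || (x <= y <= 1) -> `|u y| <= `|u x|.
Proof.
move=> x0 y0; rewrite /u !normrM !normfV.
rewrite [`|y + 1|]ger0_norm ?[`|x + 1|]ger0_norm; [|lra|lra].
rewrite ler_pdivrMr; last lra.
rewrite mulrAC ler_pdivlMr; last lra.
case/orP => /andP[h1 h2].
  by rewrite !ger0_norm; lra.
by rewrite !ler0_norm; lra.
Qed.

Lemma normr_cayley_le x : 0 < x -> `|u x| <= 1 - (Y x)^-1.
Proof.
move=> x0; have xV : 0 < x^-1 by rewrite invr_gt0.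
have Y1 := ends_weight_ge1 x0; have xx : x * x^-1 = 1 by rewrite mulfV ?gt_eqF.
rewrite lerBrDr -lerBrDl.
apply: (@le_trans _ _ (2 * Num.min 1 x / (x + 1))).
  rewrite -[leLHS]div1r ler_pdivrMr; last lra.
  rewrite mulrAC ler_pdivlMr; last lra.
  rewrite /ends_weight mul1r minElt; case: ifP => x1; first lra.
  have {}x1 : x <= 1 by rewrite leNgt x1.
  by have := sqr_ge0 x; rewrite expr2; lra.
rewrite /u normrM normfV [`|x + 1|]ger0_norm; last lra.
rewrite lerBrDr -mulrDl ler_pdivrMr; last lra.
rewrite minElt; case: ifP => x1; first by rewrite ger0_norm; lra.
have {}x1 : x <= 1 by rewrite leNgt x1.
by rewrite ler0_norm; lra.
Qed.

Lemma normr_cayley_le1 x : 0 < x -> `|u x| <= 1.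
Proof.
move=> x0; apply: le_trans (normr_cayley_le x0) _.
have Y1 := ends_weight_ge1 x0.
have : 0 < (Y x)^-1 by rewrite invr_gt0; lra.
by lra.
Qed.

Section Tau.
Variable tau : R[i]^o.

(** The exponent [s / 2 - 1] at [s = 1/2 + i t], [tau = t / 2]. *)
Definition xi_exponent : R[i]^o := - (3 / 4) + 'i * tau.
Local Notation z := xi_exponent.

Definition cayley_approx m x : R[i]^o :=
  (2 * Num.sqrt 2 * w x)%:C * mp_sum tau m (u x).

Definition cayley_ratio m x : R[i]^o := cayley_approx m x * cpow x (- z).

Definition ode_error m x : R[i]^o :=
  - (m.+1%:R * mp_coef tau m.+1 * (u x)%:C ^+ m
     + (m%:R + 3 / 2) * mp_coef tau m * (u x)%:C ^+ m.+1).

Lemma is_cderive_mp_sum m x : 0 < x ->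
  is_cderive (fun x => mp_sum tau m (u x)) x
    (mp_dsum tau m (u x) * (2 / (x + 1) ^+ 2)%:C).
Proof.
move=> x0; have du := is_derive_cayley x0.
have dXn n : is_derive x 1 (fun x => u x ^+ n)
    (n%:R * u x ^+ n.-1 * (2 / (x + 1) ^+ 2)).
  have dX : is_derive x 1 (fun x => u x ^+ n)
      ((n%:R * u x ^+ n.-1) *: (2 / (x + 1) ^+ 2 : R)).
    case: n => [|n].
      rewrite mul0r scale0r (_ : (fun x => _) = cst 1); first exact: is_derive_cst.
      by apply/funext => y; rewrite expr0.
    rewrite (_ : (fun x => _) = u ^+ n.+1); first exact: is_deriveX.
    by apply/funext => y; rewrite exprfctE.
  exact: dX.
have dt n : is_cderive (fun x => mp_coef tau n * (u x ^+ n)%:C) x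
    (mp_coef tau n * (n%:R * u x ^+ n.-1)%:C * (2 / (x + 1) ^+ 2)%:C).
  apply: is_cderive_eq.
    exact: (is_cderiveM (is_cderive_cst (mp_coef tau n) x) (is_cderive_real (dXn n))).
  by rewrite mul0r add0r rmorphM/= mulrA.
rewrite /mp_sum /mp_dsum; elim: m.+1 => [|k IH].
  rewrite big_geq// mul0r (_ : (fun x => _) = fun=> 0); first exact: is_cderive_cst.
  by apply/funext => y; rewrite big_geq.
rewrite big_nat_recr//= mulrDl (_ : (fun x => _) = (fun x =>
  (\sum_(0 <= n < k) mp_coef tau n * (u x ^+ n)%:C) + mp_coef tau k * (u x ^+ k)%:C)).
  exact: is_cderiveD.
by apply/funext => y; rewrite big_nat_recr.
Qed.

(** The quotient of the truncated expansion by the power it approximates has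
    the error of the differential equation as its logarithmic derivative. *)
Lemma is_cderive_ratio m x : 0 < x ->
  is_cderive (cayley_ratio m) x ((Num.sqrt 2 * w x * x^-1)%:C * cpow x (- z) * ode_error m x).
Proof.
move=> x0.
have dw := is_derive_cayley_weight x0.
have dw2 : is_derive x 1 (fun x => 2 * Num.sqrt 2 * w x)
    (2 * Num.sqrt 2 * (- (3 / 2) * w x / (x + 1))) by exact: is_deriveZ.
apply: is_cderive_eq.
  exact: (is_cderiveM (is_cderiveM (is_cderive_real dw2) (is_cderive_mp_sum m x0))
    (is_cderive_cpow (- z) x0)).
rewrite /ode_error -mp_sum_ode.
set P := mp_sum _ _ _; set P' := mp_dsum _ _ _; set c := cpow _ _.
have x10 : x + 1 != 0 by rewrite gt_eqF//; lra.
have xn0 : x != 0 by rewrite gt_eqF.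
rewrite /u !(rmorphM, rmorphN, rmorphB, rmorphD, rmorphXn, fmorphV, rmorph1, rmorph_nat)/=.
have X0 : x%:C != 0 :> R[i]^o by rewrite (inj_eq (@complexI R)).
have X1 : x%:C + 1 != 0 :> R[i]^o.
  by rewrite -(rmorph1 (real_complex R)) -rmorphD (inj_eq (@complexI R)).
by rewrite /z; field; rewrite X0 X1.
Qed.

End Tau.

End Remainder.

(** * Bounds for the remainder *)

Section RemainderBound.
Variable R : realType.
Notation mu := (@lebesgue_measure R).
Implicit Types (x y : R) (m k : nat).
Local Notation Y := (@ends_weight R).
Local Notation u := (@cayley R).
Local Notation w := (@cayley_weight R).

Lemma sqrt2E : Num.sqrt 2 = expR (2^-1 * ln 2) :> R.
Proof. by rewrite -powR12_sqrt// /powR pnatr_eq0. Qed.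

Lemma cayley_weight1 : 2 * Num.sqrt 2 * w 1 = 1.
Proof.
have e2 : expR (ln 2) = 2 :> R by rewrite lnK ?posrE.
rewrite sqrt2E /cayley_weight -{1}e2 -!expRD (_ : 1 + 1 = 2)//.
by rewrite (_ : _ + _ = 0) ?expR0//; field.
Qed.

Lemma normr_sqrt2_weight_le x : 0 < x -> `|Num.sqrt 2 * w x| <= 2.
Proof.
move=> x0; have /andP[w0 w1] := cayley_weight_le1 x0.
have s0 : 0 <= Num.sqrt 2 :> R by exact: sqrtr_ge0.
have s2 : Num.sqrt 2 ^+ 2 = 2 :> R by rewrite sqr_sqrtr.
have s1 : Num.sqrt 2 <= 2 :> R by rewrite -(@ler_pXn2r _ 2)// ?nnegrE// s2 expr2; lra.
rewrite ger0_norm ?mulr_ge0// -[leRHS]mulr1; exact: ler_pM.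
Qed.

Lemma cayley1 : u 1 = 0.
Proof. by rewrite /cayley subrr mul0r. Qed.

Section Tau.
Variables (tau : R[i]^o) (B k : nat).
Hypothesis tauB : 2 * cmod tau <= B%:R.
Hypothesis zk : `|complex.Re (xi_exponent tau)| <= k%:R.
Local Notation z := (xi_exponent tau).

Lemma cayley_ratio1 m : cayley_ratio tau m 1 = 1.
Proof.
rewrite /cayley_ratio /cayley_approx cayley1 cayley_weight1 /mp_sum.
rewrite big_ltn// big_nat_cond big1 ?addr0; last first.
  by move=> [|n] //= _; rewrite expr0n/= mulr0.
by rewrite mp_coef0 expr0 /cpow ln1 mulr0 cexp0 !mulr1.
Qed.

Lemma cmod_ode_error_le m x : 0 < x ->
  cmod (ode_error tau m x) <= 2 * m.+2%:R ^+ B.+1 * `|u x| ^+ m.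
Proof.
move=> x0; have u1 := normr_cayley_le1 x0.
have cn (n : nat) : cmod (n%:R : R[i]^o) = n%:R.
  by rewrite (_ : n%:R = (n%:R : R)%:C) ?cmodR ?ger0_norm// rmorph_nat.
have m20 : 0 <= m.+2%:R ^+ B :> R by rewrite exprn_ge0.
have := mp_coef_bound tauB m.+1; have := mp_coef_bound tauB m.
rewrite /ode_error; move: (mp_coef tau m) (mp_coef tau m.+1) => g0 g1 hg0 hg1.
rewrite cmodN; apply: le_trans (cmodD _ _) _.
rewrite !cmodM !cmodX !cmodR -[leRHS]mulrA [leRHS]mulr_natl mulr2n.
have u0 : 0 <= `|u x| ^+ m by rewrite exprn_ge0.
apply: lerD.
  rewrite ler_wpM2r// exprS ler_pM ?cmod_ge0//.
    by rewrite cn ler_nat.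
rewrite ler_pM ?mulr_ge0 ?cmod_ge0 ?exprn_ge0//; last first.
  by rewrite exprS ler_piMl.
rewrite exprS ler_pM ?cmod_ge0//.
  apply: le_trans (cmodD _ _) _; rewrite cmodM cmodV !cn -(natr1 m.+1) -(natr1 m).
  by rewrite -[1 + 1]/(2%:R) cn; lra.
apply: le_trans hg0 _.
by rewrite lerXn2r ?nnegrE// ler_nat.
Qed.

(** The quotient [cayley_ratio] is 1 at 1, and between 1 and [x] its derivative is
    bounded by the value at [x] of the bound, since [Y] and [|u|] grow away from 1
    on either side. *)
Lemma cayley_approx_le m x : 0 < x ->
  cmod (cpow x z - cayley_approx tau m x) <=
  8 * m.+2%:R ^+ B.+1 * Y x ^+ (k + k + 2) * `|u x| ^+ m.
Proof.
move=> x0; have Y1 := ends_weight_ge1 x0.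
pose dr y := (Num.sqrt 2 * w y * y^-1)%:C * cpow y (- z) * ode_error tau m y.
pose K := 4 * m.+2%:R ^+ B.+1 * Y x ^+ k.+1 * `|u x| ^+ m.
have m20 : 0 <= m.+2%:R ^+ B.+1 :> R by rewrite exprn_ge0.
have drK y : 0 < y -> (1 <= y <= x) || (x <= y <= 1) -> cmod (dr y) <= K.
  move=> y0 yx; have Yy := ends_weight_mono x0 y0 yx; have uy := normr_cayley_mono x0 y0 yx.
  have yV : 0 < y^-1 by rewrite invr_gt0.
  have Yy1 := ends_weight_ge1 y0.
  rewrite /dr !cmodM cmodR normrM (gtr0_norm yV) cmod_cpow.
  apply: (@le_trans _ _ (2 * Y x * Y x ^+ k * (2 * m.+2%:R ^+ B.+1 * `|u x| ^+ m))).
    apply: ler_pM; rewrite ?mulr_ge0 ?expR_ge0 ?cmod_ge0// ?(ltW yV)//.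
      apply: ler_pM; rewrite ?mulr_ge0 ?expR_ge0// ?(ltW yV)//.
        apply: ler_pM; rewrite ?(ltW yV)//; first exact: normr_sqrt2_weight_le.
        by apply: le_trans Yy; rewrite /ends_weight; lra.
      apply: le_trans (_ : Y y ^+ k <= _).
        apply: expR_ln_le_weight => //.
        by move: zk; case: (z) => a b /=; rewrite normrN.
      by rewrite lerXn2r ?nnegrE//; lra.
    apply: le_trans (cmod_ode_error_le m y0) _.
    by rewrite ler_wpM2l ?mulr_ge0// lerXn2r ?nnegrE.
  by rewrite /K [Y x ^+ k.+1]exprS le_eqVlt; apply/orP; left; apply/eqP; ring.
have dd y : 0 < y -> is_cderive (cayley_ratio tau m) y (dr y).
  by move=> y0; exact: is_cderive_ratio.
have K0 : 0 <= K by rewrite /K !mulr_ge0// exprn_ge0//; lra.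
have K2 : 0 <= 2 * K by rewrite mulr_ge0 ?K0.
have r1 : cmod (cayley_ratio tau m x - 1) <= 2 * K * Y x.
  rewrite -(cayley_ratio1 m); have [x1|x1] := leP 1 x.
    apply: le_trans (@cmod_mvt_bound _ _ dr _ _ K x1 _ _) _.
    - by move=> y /andP[y1 _]; apply: dd; lra.
    - by move=> y yx; apply: drK; [case/andP: yx; lra|rewrite yx].
    rewrite ler_wpM2l//.
    have xV : 0 < x^-1 by rewrite invr_gt0.
    by rewrite /ends_weight; lra.
  rewrite -cmodN opprB.
  apply: le_trans (@cmod_mvt_bound _ _ dr _ _ K (ltW x1) _ _) _.
  - by move=> y /andP[y1 _]; apply: dd; lra.
  - by move=> y yx; apply: drK; [case/andP: yx; lra|rewrite yx orbT].
  by rewrite ler_wpM2l//; lra.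
have -> : cpow x z - cayley_approx tau m x = - cpow x z * (cayley_ratio tau m x - 1).
  rewrite /cayley_ratio cpowN mulrBr mulr1 opprK mulNr mulrCA mulfV ?cpow_neq0//.
  by rewrite mulr1 addrC.
rewrite cmodM cmodN cmod_cpow.
apply: (@le_trans _ _ (Y x ^+ k * (2 * K * Y x))).
  apply: ler_pM; rewrite ?expR_ge0 ?cmod_ge0//.
  exact: expR_ln_le_weight.
rewrite /K [Y x ^+ k.+1]exprS !exprD le_eqVlt; apply/orP; left; apply/eqP.
move: (m.+2%:R ^+ B.+1 : R) (Y x) (`|u x| ^+ m) => a b c.
by ring.
Qed.

End Tau.

(** [|u|^m <= exp (- m / Y)] while [|omega| = O(exp (- Y / 2))]. Of the latter,
    [exp (- Y / 4)] is used here, since [m / Y + Y / 4 >= sqrt m], with equality at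
    [Y = 2 sqrt m]; the rest absorbs [Y^k] and leaves the integrable
    [exp (- x / 8)]. *)
Lemma omega_geometric_le k : exists2 C : R, 0 <= C &
  forall m x, 0 < x -> `|omega x| * (Y x ^+ k * `|u x| ^+ m) <=
    C * expR (- Num.sqrt m%:R) * expR (- (8^-1 * x)).
Proof.
exists (304 * (8 ^+ k * k`!%:R)); first by rewrite !mulr_ge0 ?ler0n ?exprn_ge0 ?ler0n.
move=> m x x0; have xV : 0 < x^-1 by rewrite invr_gt0.
have Y1 := ends_weight_ge1 x0; have Yp : 0 < Y x by lra.
have h1 : Y x ^+ k <= 8 ^+ k * k`!%:R * expR (Y x / 8).
  have Y0 : 0 <= Y x / 8 by lra.
  have := exprn_le_fact_exp k Y0; rewrite expr_div_n ler_pdivrMr ?exprn_gt0//.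
  by move=> h; apply: le_trans h _; rewrite le_eqVlt; apply/orP; left; apply/eqP; ring.
have h2 : `|u x| ^+ m <= expR (- (m%:R / Y x)).
  apply: (@le_trans _ _ (expR (- (Y x)^-1) ^+ m)).
    rewrite lerXn2r ?nnegrE ?expR_ge0//; apply: le_trans (normr_cayley_le x0) _.
    exact: expR_ge1Dx.
  by rewrite -expRM_natl ler_expR mulrN.
have h3 : Num.sqrt m%:R <= Y x / 4 + m%:R / Y x.
  have s0 : 0 <= Num.sqrt m%:R :> R by exact: sqrtr_ge0.
  have s2 : Num.sqrt m%:R ^+ 2 = m%:R :> R by rewrite sqr_sqrtr.
  rewrite -(ler_pM2r Yp) mulrDl divfK ?gt_eqF// -{2}s2.
  by have := sqr_ge0 (Num.sqrt m%:R - Y x / 2); rewrite !expr2; lra.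
have h4 := omega_le x0.
apply: (@le_trans _ _ (304 * expR (- ((x + x^-1) / 2)) *
   (8 ^+ k * k`!%:R * expR (Y x / 8) * expR (- (m%:R / Y x))))).
  apply: ler_pM => //; first by rewrite mulr_ge0 ?exprn_ge0//; lra.
  by apply: ler_pM => //; rewrite exprn_ge0//; lra.
rewrite [leLHS](_ : _ = 304 * (8 ^+ k * k`!%:R) *
  (expR (- ((x + x^-1) / 2)) * expR (Y x / 8) * expR (- (m%:R / Y x)))); last first.
  by move: (304 : R) => c; ring.
rewrite -[leRHS]mulrA ler_wpM2l ?mulr_ge0 ?ler0n ?exprn_ge0 ?ler0n//.
rewrite -!expRD ler_expR -/(Y x); move: h3; rewrite /ends_weight; lra.
Qed.

Lemma omega_geometric_cint k : exists2 C : R, 0 <= C &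
  forall (q : R -> R[i]^o) (K : R) m, 0 <= K -> pcontC q ->
  (forall x, 0 < x -> cmod (q x) <= K * (Y x ^+ k * `|u x| ^+ m)) ->
  cmod (cint (fun x => (omega x)%:C * q x)) <= K * C * expR (- Num.sqrt m%:R).
Proof.
have [C C0 CP] := omega_geometric_le k.
have c8 : 0 < 8^-1 :> R by rewrite invr_gt0.
have Ie := integrable_halfline_expR c8.
pose I := \int[mu]_(x in @halfline R) expR (- (8^-1 * x)).
have I0 : 0 <= I by apply: Rintegral_ge0 => x _; exact: expR_ge0.
exists (2 * (C * I)); first by rewrite !mulr_ge0.
move=> q K m K0 cq qK.
have cw : pcontC (fun x => (omega x)%:C * q x).
  by apply: pcontCM => //; apply: pcontC_real => x; exact: continuous_omega.
pose c := K * C * expR (- Num.sqrt m%:R).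
have le x : 0 < x -> cmod ((omega x)%:C * q x) <= c * expR (- (8^-1 * x)).
  move=> x0; rewrite cmodM cmodR.
  apply: le_trans (ler_wpM2l (normr_ge0 _) (qK x x0)) _.
  by rewrite mulrCA /c -[K * C * _]mulrA -mulrA ler_wpM2l// CP.
have mD := @measurable_halfline R.
have Iw : mu.-integrable (@halfline R) (EFin \o (fun x => c * expR (- (8^-1 * x)))).
  rewrite (_ : EFin \o _ = (fun x => c%:E * (expR (- (8^-1 * x)))%:E)%E).
    exact: integrableZl.
  by apply/funext => x; rewrite /= EFinM.
apply: le_trans (cmod_cint_le cw Iw le) _.
by rewrite RintegralZl// -/I /c le_eqVlt; apply/orP; left; apply/eqP; ring.
Qed.

End RemainderBound.

(** * The expansion of the Mellin transform *)

Section Expansion.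
Variable R : realType.
Notation mu := (@lebesgue_measure R).
Implicit Types (x y : R) (m k n : nat) (t tau : R[i]^o).
Local Notation Y := (@ends_weight R).
Local Notation u := (@cayley R).
Local Notation w := (@cayley_weight R).

Lemma pcont_cayley : pcont u.
Proof.
apply: pcontM; first by apply: pcontB; [exact: pcont_id|exact: pcont_cst].
apply: pcontV; first by apply: pcontD; [exact: pcont_id|exact: pcont_cst].
by move=> x x0; rewrite gt_eqF//; lra.
Qed.

Lemma pcont_cayley_weight : pcont w.
Proof. by apply: pcont_derive => x x0; exact: is_derive_cayley_weight. Qed.

Lemma pcont_weight_cayleyX n : pcont (fun x => w x * u x ^+ n).
Proof.
by apply: pcontM; [exact: pcont_cayley_weight|apply: pcontX; exact: pcont_cayley].
Qed.

Lemma weight_cayleyX_cintegrable n :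
  cintegrable (fun x => (omega x)%:C * (w x * u x ^+ n)%:C).
Proof.
have [C C0 CP] := omega_cint R 0.
have [] // := CP (fun x => (w x * u x ^+ n)%:C) 1 ler01.
  by apply: pcontC_real; exact: pcont_weight_cayleyX.
move=> x x0; rewrite cmodR expr0 mulr1 normrM.
have /andP[w0 w1] := cayley_weight_le1 x0.
by rewrite ger0_norm// normrX mulr_ile1// ?exprn_ge0// exprn_ile1// normr_cayley_le1.
Qed.

Lemma c_coefE n : (2 * Num.sqrt 2)%:C * cint (fun x => (omega x)%:C * (w x * u x ^+ n)%:C)
  = (c_coef R n)%:C :> R[i]^o.
Proof.
rewrite /cint /cintegral.
under eq_Rintegral do rewrite cReM /= mulr0 subr0.
under [X in _ +i* X]eq_Rintegral do rewrite cImM /= mulr0 mul0r addr0.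
have -> : \int[mu]_(x in @halfline R) (0 : R) = 0.
  by rewrite Rintegral_cst ?mul0r//; exact: measurable_halfline.
rewrite /c_coef; apply/eqP; rewrite eq_complex/=.
rewrite !mul0r !mulr0 subr0 addr0 eqxx andbT; apply/eqP; congr (_ * _).
apply: eq_Rintegral => x; rewrite inE halflineE => x0.
rewrite mulrA; congr (omega x * _ * _).
rewrite /w /powR gt_eqF; last lra.
by rewrite mulNr expRN.
Qed.

(** [omega (1/x) = sqrt x * omega x] makes the integrand odd under [x -> 1/x]. *)
Lemma c_coef_odd n : c_coef R n.*2.+1 = 0.
Proof.
have := c_coefE n.*2.+1; rewrite /cint /cintegral.
under eq_Rintegral do rewrite cReM /= mulr0 subr0.
under [X in _ +i* X]eq_Rintegral do rewrite cImM /= mulr0 mul0r addr0.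
have Iw : mu.-integrable (@halfline R) (EFin \o (fun x => omega x * (w x * u x ^+ n.*2.+1))).
  have [+ _] := weight_cayleyX_cintegrable n.*2.+1.
  by under eq_fun do rewrite cReM /= mulr0 subr0.
rewrite (@halfline_inv_odd _ (fun x => omega x * (w x * u x ^+ n.*2.+1)))//.
- by move/eqP; rewrite eq_complex/= !mul0r !mulr0 subr0 => /andP[/eqP <-].
- by apply: pcontM => [x|]; [exact: continuous_omega|exact: pcont_weight_cayleyX].
move=> x x0; have x1 : 0 < x + 1 by lra.
have uV : u x^-1 = - u x.
  rewrite /cayley; field.
  by rewrite (lt0r_neq0 x1) (lt0r_neq0 x0).
have wV : w x^-1 = expR (3 / 2 * ln x) * w x.
  rewrite /cayley_weight -expRD; congr expR.
  have -> : x^-1 + 1 = (x + 1) / x by field; rewrite gt_eqF.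
  by rewrite ln_div ?posrE//; ring.
have x2 : x ^+ 2 = expR (3 / 2 * ln x) * expR (2^-1 * ln x).
  rewrite -expRD -{1}(@lnK _ x) ?posrE// -expRM_natl.
  by congr expR; field.
have sx : Num.sqrt x = expR (2^-1 * ln x).
  by rewrite -powR12_sqrt ?ltW// /powR gt_eqF.
rewrite /= omega_inv// uV wV exprNn x2 sx -signr_odd /= odd_double/= expr1.
by field; rewrite !gt_eqF ?expR_gt0.
Qed.

Lemma cint_cayley_approx tau m :
  cintegrable (fun x => (omega x)%:C * cayley_approx tau m x) /\
  cint (fun x => (omega x)%:C * cayley_approx tau m x) =
  \sum_(0 <= n < m.+1) mp_coef tau n * (c_coef R n)%:C.
Proof.
pose h n x : R[i]^o := (omega x)%:C * (w x * u x ^+ n)%:C.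
pose S k x : R[i]^o := \sum_(0 <= n < k) (mp_coef tau n * (2 * Num.sqrt 2)%:C) * h n x.
have SE x : (omega x)%:C * cayley_approx tau m x = S m.+1 x.
  rewrite /cayley_approx /mp_sum !mulr_sumr; apply: eq_bigr => n _.
  by rewrite /h !rmorphM/=; ring.
have -> : (fun x => (omega x)%:C * cayley_approx tau m x) = S m.+1.
  by apply/funext => x; exact: SE.
have ih n := weight_cayleyX_cintegrable n.
elim: m.+1 => [|k [IH1 IH2]].
  have -> : S 0%N = (fun x => 0 * h 0%N x).
    by apply/funext => x; rewrite /S big_geq// mul0r.
  split; first exact: cintegrableZ (ih 0%N).
  by rewrite cintZ ?mul0r ?big_geq//; exact: ih.
have -> : S k.+1 = (fun x => S k x + (mp_coef tau k * (2 * Num.sqrt 2)%:C) * h k x).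
  by apply/funext => x; rewrite /S big_nat_recr.
have ik := cintegrableZ (mp_coef tau k * (2 * Num.sqrt 2)%:C) (ih k).
split; first exact: cintegrableD.
rewrite cintD// cintZ; last exact: ih.
by rewrite IH2 big_nat_recr//= -mulrA c_coefE.
Qed.

Lemma pcontC_cayley_approx tau m : pcontC (cayley_approx tau m).
Proof.
apply: pcontCM.
  apply: pcontC_real; apply: pcontM; first exact: pcont_cst.
  exact: pcont_cayley_weight.
split; apply: pcont_derive => x x0; have [dr di] := is_cderive_mp_sum tau m x0.
  exact: dr.
exact: di.
Qed.

(** As the odd [c_n] vanish, the sum up to [2 N + 1] of [i^n c_n f_n] is the sum
    up to [N] of [(-1)^n c_2n f_2n]. *)
Lemma sum_Xi_term t N : \sum_(0 <= n < N.+1) Xi_term t n =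
  \sum_(0 <= n < N.*2.+2) mp_coef (t / 2) n * (c_coef R n)%:C.
Proof.
elim: N => [|N IH].
  rewrite big_nat1 !big_nat_recr//= big_geq// add0r (c_coef_odd 0) mulr0 addr0.
  by rewrite /Xi_term /mp_coef !expr0 !mul1r mulrC.
rewrite big_nat_recr//= IH doubleS [RHS]big_nat_recr//= [in RHS]big_nat_recr//=.
rewrite -doubleS (c_coef_odd N.+1) mulr0 addr0; congr (_ + _).
rewrite /Xi_term /mp_coef -[in RHS]muln2 mulnC exprM sqr_i.
by rewrite -muln2 mulnC; ring.
Qed.

(** Half of the exponent pays for the powers of [m] in [cayley_approx_le]. *)
Lemma polynomial_le_exp_sqrt p : exists2 C : R, 0 <= C &
  forall m, m.+2%:R ^+ p * expR (- Num.sqrt m%:R) <= C * expR (- (2^-1 * Num.sqrt m%:R)).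
Proof.
exists (4 ^+ (2 * p) * (2 * p)`!%:R * expR (2^-1)).
  by rewrite !mulr_ge0 ?exprn_ge0 ?ler0n ?expR_ge0.
move=> m; set s := Num.sqrt _; have s0 : 0 <= s by exact: sqrtr_ge0.
have s2 : s ^+ 2 = m%:R by rewrite sqr_sqrtr.
have h1 : m.+2%:R <= (s + 2) ^+ 2.
  by rewrite -(natr1 m.+1) -(natr1 m) -s2 !expr2; lra.
have s4 : 0 <= (s + 2) / 4 by lra.
have h2 : (s + 2) ^+ (2 * p) <= 4 ^+ (2 * p) * (2 * p)`!%:R * expR ((s + 2) / 4).
  have := exprn_le_fact_exp (2 * p) s4; rewrite expr_div_n ler_pdivrMr ?exprn_gt0//.
  by move=> h; apply: le_trans h _; rewrite le_eqVlt; apply/orP; left; apply/eqP; ring.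
apply: (@le_trans _ _ (4 ^+ (2 * p) * (2 * p)`!%:R * expR ((s + 2) / 4) * expR (- s))).
  rewrite ler_wpM2r ?expR_ge0//; apply: le_trans h2.
  by rewrite exprM lerXn2r ?nnegrE ?ler0n ?exprn_ge0//; lra.
rewrite -!mulrA ler_wpM2l ?exprn_ge0// ler_wpM2l ?ler0n// -!expRD ler_expR; lra.
Qed.

(** The difference is the integral of [omega] against the error of
    [cayley_approx], whose bound is uniform once [t] is bounded. *)
Lemma xi_mellin_expansion (T : R) : 0 <= T -> exists2 C : R, 0 <= C &
  forall t N, cmod t <= T ->
    cmod (xi_mellin (2^-1 + 'i * t) - \sum_(0 <= n < N.+1) Xi_term t n)
      <= C * expR (- (2^-1 * Num.sqrt N%:R)).
Proof.
move=> T0; pose B := Num.bound T.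
have TB : T <= B%:R by rewrite ltW// archi_boundP.
have [C C0 CP] := @omega_geometric_cint R (B.+1 + B.+1 + 2).
have [C' C'0 C'P] := polynomial_le_exp_sqrt B.+1.
exists (8 * C * C'); first by rewrite !mulr_ge0.
move=> t N tT; rewrite sum_Xi_term; set tau := t / 2; pose m := N.*2.+1.
have c2 : cmod (2 : R[i]^o) = 2.
  by rewrite (_ : 2 = (2 : R)%:C) ?cmodR ?ger0_norm// rmorphMn.
have tauB : 2 * cmod tau <= B%:R.
  by rewrite /tau cmodM cmodV c2 mulrCA mulfV ?mulr1// (le_trans tT).
have zk : `|complex.Re (xi_exponent tau)| <= B.+1%:R.
  have h := normr_Im_le tau; have : complex.Re (xi_exponent tau) = - (3 / 4) - complex.Im tau.
    by rewrite /xi_exponent; case: (tau) => a b; rewrite /=; field.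
  move=> ->; apply: le_trans (ler_normB _ _) _; rewrite normrN ger0_norm//.
  by rewrite -natr1; have := cmod_ge0 tau; lra.
have [ia aE] := cint_cayley_approx tau m.
have -> : xi_mellin (2^-1 + 'i * t) = cint (fun x => (omega x)%:C * cpow x (xi_exponent tau)).
  rewrite /xi_mellin (_ : _ / 2 - 1 = xi_exponent tau)//.
  by rewrite /xi_exponent /tau; field.
rewrite -aE -cintB//; last exact: xi_mellin_cintegrable.
under eq_fun do rewrite -mulrBr.
apply: le_trans (CP _ (8 * m.+2%:R ^+ B.+1) m _ _ _) _.
- by rewrite mulr_ge0// exprn_ge0.
- by apply: pcontCB; [exact: pcontC_cpow|exact: pcontC_cayley_approx].
- move=> x x0; apply: le_trans (cayley_approx_le tauB zk m x0) _.
  by rewrite !mulrA.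
rewrite (_ : _ * C * _ = 8 * C * (m.+2%:R ^+ B.+1 * expR (- Num.sqrt m%:R))); last first.
  by move: (m.+2%:R ^+ B.+1 : R) => a; ring.
rewrite -[leRHS]mulrA ler_wpM2l ?mulr_ge0//; apply: le_trans (C'P m) _.
rewrite ler_wpM2l// ler_expR lerN2 ler_pM2l// ler_wsqrtr// ler_nat /m; lia.
Qed.

End Expansion.

(** * Gamma integrals *)

Section GammaIntegrals.
Variable R : realType.
Notation mu := (@lebesgue_measure R).
Implicit Types (x y b : R) (z s : R[i]^o).

Definition gamma_weight b x : R := expR (b * ln x) / x * expR (- x).

Lemma gamma_weight_ge0 b x : 0 < x -> 0 <= gamma_weight b x.
Proof. by move=> x0; rewrite mulr_ge0 ?expR_ge0// divr_ge0 ?expR_ge0// ltW. Qed.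

Lemma pcont_expRln b : pcont (fun x : R => expR (b * ln x)).
Proof.
apply: (@pcont_comp _ (fun x => b * ln x) expR); first exact: continuous_expR.
by apply: pcontM; [exact: pcont_cst|exact: pcont_ln].
Qed.

Lemma pcont_expRN : pcont (fun x : R => expR (- x)).
Proof.
apply: (@pcont_comp _ (fun x => - x) expR); first exact: continuous_expR.
by apply: pcontN; exact: pcont_id.
Qed.

Lemma pcont_inv : pcont (fun x : R => x^-1).
Proof. by apply: pcontV; [exact: pcont_id|move=> x x0; rewrite gt_eqF]. Qed.

Lemma pcont_gamma_weight b : pcont (gamma_weight b).
Proof.
apply: pcontM; last exact: pcont_expRN.
by apply: pcontM; [exact: pcont_expRln|exact: pcont_inv].
Qed.

Lemma expR_ln_le_Xn x b (k : nat) : 0 < x -> 0 <= b <= k%:R -> expR (b * ln x) <= 1 + x ^+ k.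
Proof.
move=> x0 /andP[b0 bk]; have xk : 0 <= x ^+ k by rewrite exprn_ge0// ltW.
have [x1|x1] := leP 1 x.
  apply: (@le_trans _ _ (expR (k%:R * ln x))).
    by rewrite ler_expR ler_wpM2r// ln_ge0.
  by rewrite expRM_natl lnK ?posrE//; lra.
apply: (@le_trans _ _ 1); last lra.
by rewrite expR_le1 mulr_ge0_le0// ln_le0// ltW.
Qed.

(** Comparison with the derivative of [- 1 / (1 + x^b)], a bounded function. *)
Lemma gamma_weight_integrable b : 0 < b ->
  mu.-integrable (@halfline R) (EFin \o gamma_weight b).
Proof.
move=> b0; pose p x : R := expR (b * ln x).
pose f x : R := b * (p x / x) / (1 + p x) ^+ 2.
have p0 x : 0 < p x by exact: expR_gt0.
have p1 x : 1 + p x != 0 by rewrite gt_eqF//; have := p0 x; lra.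
have cf : pcont f.
  apply: pcontM.
    apply: pcontM; first exact: pcont_cst.
    by apply: pcontM; [exact: pcont_expRln|exact: pcont_inv].
  apply: pcontV; last by move=> x _; rewrite expf_neq0.
  by apply: pcontX; apply: pcontD; [exact: pcont_cst|exact: pcont_expRln].
have If : mu.-integrable (@halfline R) (EFin \o f).
  apply: (@ge0_halfline_integrable _ (fun x => - (1 + p x)^-1) _ 1) => // x x0.
  - rewrite /f mulr_ge0 ?invr_ge0 ?exprn_ge0//; last by have := p0 x; lra.
    by rewrite mulr_ge0 ?(ltW b0)// divr_ge0 ?(ltW x0)// ltW.
  - have dl := is_derive1_ln x0.
    have dlin : is_derive x 1 (fun x : R => b * ln x) (b * x^-1).
      by apply: is_derive_eq; rewrite /GRing.scale/=; ring.
    have dp : is_derive x 1 p (p x * (b * x^-1)).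
      exact: (@is_derive1_comp _ expR (fun x : R => b * ln x) x _ _ (is_derive_expR _) dlin).
    have dp1 : is_derive x 1 (fun x => 1 + p x) (p x * (b * x^-1)).
      by have := is_deriveD (is_derive_cst (1 : R) x 1) dp; rewrite add0r.
    have dV : is_derive x 1 (fun x => (1 + p x)^-1) (- (1 + p x) ^- 2 *: (p x * (b * x^-1))).
      exact: (@is_deriveV _ (fun x => 1 + p x) _ _ _ (p1 x) dp1).
    apply: is_derive_eq; rewrite /f /GRing.scale/=.
    have := p1 x; move: (p x) => q q1.
    by field; rewrite q1 gt_eqF.
  - have q1 : 1 <= 1 + p x by have := p0 x; lra.
    by rewrite normrN ger0_norm ?invr_ge0 ?invf_le1//; lra.
pose k := Num.bound b.
have bk : 0 <= b <= k%:R by rewrite !ltW// archi_boundP// ltW.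
pose C := (8 + 2 * (2 * k)`!%:R) / b.
have mD := @measurable_halfline R.
apply: (@halfline_dominated_integrable _ _ (fun x => C * f x)); first exact: pcont_gamma_weight.
  move=> x x0; rewrite ger0_norm ?gamma_weight_ge0// /gamma_weight -/(p x) /C /f.
  rewrite [leRHS](_ : _ = p x / x * ((8 + 2 * (2 * k)`!%:R) / (1 + p x) ^+ 2)); last first.
    by have := p1 x; move: (p x) => q q1; field; rewrite q1 !gt_eqF.
  rewrite ler_wpM2l ?divr_ge0 ?(ltW x0) ?(ltW (p0 x))//.
  have pp : 0 < (1 + p x) ^+ 2 by rewrite exprn_gt0//; have := p0 x; lra.
  rewrite ler_pdivlMr// expRN mulrC ler_pdivrMr ?expR_gt0//.
  have h1 := expR_ln_le_Xn x0 bk; rewrite -/(p x) in h1.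
  have h2 := exprn_le_fact_exp (2 * k) (ltW x0).
  have h3 : 1 <= expR x by rewrite -expR0 ler_expR ltW.
  have h4 : x ^+ (2 * k) = x ^+ k * x ^+ k by rewrite mul2n -addnn exprD.
  have h5 : (1 + p x) ^+ 2 <= (2 + x ^+ k) ^+ 2.
    have p0x := p0 x; have xk0 : 0 <= x ^+ k by rewrite exprn_ge0// ltW.
    by rewrite lerXn2r ?nnegrE//; lra.
  apply: le_trans h5 _; rewrite h4 in h2.
  have := sqr_ge0 (2 - x ^+ k); rewrite !expr2; lra.
rewrite (_ : EFin \o _ = (fun x => C%:E * (f x)%:E)%E); first exact: integrableZl.
by apply/funext => x; rewrite /= EFinM.
Qed.

Lemma cmod_cpowB1 x z : 0 < x ->
  cmod (cpow x (z - 1)) = expR (complex.Re z * ln x) / x.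
Proof.
move=> x0; rewrite cpowD cpowN cpow1// cmodM cmodV cmodR gtr0_norm//.
by rewrite cmod_cpow.
Qed.

Definition gamma_integrand z x : R[i]^o := cpow x (z - 1) * (expR (- x))%:C.

Lemma cGammaE z : cGamma z = cint (gamma_integrand z).
Proof. by []. Qed.

Lemma pcontC_gamma_integrand z : pcontC (gamma_integrand z).
Proof.
apply: pcontCM; first exact: pcontC_cpow.
by apply: pcontC_real; exact: pcont_expRN.
Qed.

Lemma gamma_integrand_cintegrable z : 0 < complex.Re z ->
  cintegrable (gamma_integrand z).
Proof.
move=> z0; apply: (cintegrable_dom _ (gamma_weight_integrable z0)).
  exact: pcontC_gamma_integrand.
by move=> x x0; rewrite cmodM cmod_cpowB1// cmodR ger0_norm ?expR_ge0.
Qed.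

Definition omega_integrand z x : R[i]^o :=
  ((2 * x ^+ 2 - 3 * x) * expR (- x))%:C * cpow x (z - 1).

Lemma pcontC_omega_integrand z : pcontC (omega_integrand z).
Proof.
apply: pcontCM; last exact: pcontC_cpow.
apply: pcontC_real; apply: pcontM; last exact: pcont_expRN.
apply: pcontB; apply: pcontM; try exact: pcont_cst; last exact: pcont_id.
by apply: pcontX; exact: pcont_id.
Qed.

Lemma omega_integrand_cintegrable z : 0 < complex.Re z ->
  cintegrable (omega_integrand z).
Proof.
move=> z0; have z1 : 0 < complex.Re z + 1 by lra.
have z2 : 0 < complex.Re z + 2 by lra.
have mD := @measurable_halfline R.
have I1 := gamma_weight_integrable z1; have I2 := gamma_weight_integrable z2.
have Iw : mu.-integrable (@halfline R) (EFin \o (fun x =>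
    2 * gamma_weight (complex.Re z + 2) x + 3 * gamma_weight (complex.Re z + 1) x)).
  rewrite (_ : EFin \o _ = (fun x => 2%:E * (gamma_weight (complex.Re z + 2) x)%:E) \+
     (fun x => 3%:E * (gamma_weight (complex.Re z + 1) x)%:E))%E.
    by apply: integrableD => //; exact: integrableZl.
  by apply/funext => x; rewrite /= EFinD !EFinM.
apply: (cintegrable_dom _ Iw); first exact: pcontC_omega_integrand.
move=> x x0; rewrite cmodM cmod_cpowB1// cmodR normrM (ger0_norm (expR_ge0 _)).
have e2 : expR ((complex.Re z + 2) * ln x) = expR (complex.Re z * ln x) * x ^+ 2.
  by rewrite [_ * ln x]mulrDl expRD [expR (2 * _)]expRM_natl lnK ?posrE.
have e1 : expR ((complex.Re z + 1) * ln x) = expR (complex.Re z * ln x) * x.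
  by rewrite [_ * ln x]mulrDl expRD mul1r lnK ?posrE.
rewrite /gamma_weight e1 e2.
have h : `|2 * x ^+ 2 - 3 * x| <= 2 * x ^+ 2 + 3 * x.
  by have := sqr_ge0 x; rewrite ler_norml; lra.
have e0 : 0 <= expR (- x) * (expR (complex.Re z * ln x) / x).
  by rewrite mulr_ge0 ?expR_ge0// divr_ge0 ?expR_ge0// ltW.
rewrite -[leLHS]mulrA; apply: le_trans (ler_wpM2r e0 h) _.
by rewrite le_eqVlt; apply/orP; left; apply/eqP; field; rewrite gt_eqF.
Qed.

Lemma cvg_inv_sqrt : (fun n : nat => (Num.sqrt n.+2%:R)^-1) @ \oo --> (0 : R).
Proof.
have c1 : (fun n : nat => (Num.sqrt n.+1%:R)^-1) @ \oo --> (0 : R).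
  rewrite (_ : (fun n => _) = Num.sqrt \o @harmonic R); last first.
    by apply/funext => m; rewrite /= /harmonic sqrtrV.
  rewrite -(@sqrtr0 R); apply: continuous_cvg; first exact: sqrt_continuous.
  exact: cvg_harmonic.
by move: c1; rewrite -cvg_shiftS.
Qed.

(** The difference of the integrands is the derivative of
    [x^z e^(-x) (1 - 2 z - 2 x)], which tends to 0 at both ends; the sequences
    [1 / n] and [n] are used there, with the rate [1 / sqrt n]. *)
Lemma cint_omega_integrand z : 2^-1 < complex.Re z ->
  cint (omega_integrand z) = z * (2 * z - 1) * cGamma z.
Proof.
move=> zh; have z0 : 0 < complex.Re z by lra.
have Iom := omega_integrand_cintegrable z0; have Iga := gamma_integrand_cintegrable z0.
rewrite cGammaE -cintZ//; apply/eqP; rewrite -subr_eq0 -cintB//; last exact: cintegrableZ.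
pose H x : R[i]^o := cpow x z * ((expR (- x))%:C * ((- 2 * x)%:C + (1 - 2 * z))).
pose h x : R[i]^o := omega_integrand z x - z * (2 * z - 1) * gamma_integrand z x.
have dH x : 0 < x -> is_cderive H x (h x).
  move=> x0.
  have dN : is_derive x 1 (fun x : R => - x) (-1) by apply: is_derive_eq.
  have de : is_derive x 1 (fun x : R => expR (- x)) (expR (- x) * -1).
    exact: (@is_derive1_comp _ expR (fun x : R => - x) x _ _ (is_derive_expR _) dN).
  have dl : is_derive x 1 (fun x : R => - 2 * x) (- 2).
    by apply: is_derive_eq; rewrite /GRing.scale/= mulr1.
  apply: is_cderive_eq.
    apply: (is_cderiveM (is_cderive_cpow z x0) (is_cderiveM (is_cderive_real de)
      (is_cderiveD (is_cderive_real dl) (is_cderive_cst (1 - 2 * z) x)))).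
  rewrite /h /omega_integrand /gamma_integrand cpowD cpowN cpow1//.
  have X0 : x%:C != 0 :> R[i]^o by rewrite (inj_eq (@complexI R)) gt_eqF.
  move: (cpow x z) (expR (- x)) => c e.
  rewrite !(rmorphM, rmorphN, rmorphB, rmorphD, rmorphXn, fmorphV, rmorph1, rmorph_nat)/=.
  by field.
pose c := cmod (1 - 2 * z); have c0 : 0 <= c by exact: cmod_ge0.
have cH x : 0 < x -> cmod (H x) <= expR (complex.Re z * ln x) * expR (- x) * (2 * x + c).
  move=> x0; rewrite /H !cmodM cmod_cpow cmodR ger0_norm ?expR_ge0// -mulrA.
  rewrite ler_wpM2l ?expR_ge0// ler_wpM2l ?expR_ge0//; apply: le_trans (cmodD _ _) _.
  by rewrite cmodR -/c normrM normrN !ger0_norm// ltW.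
have H0 (n : nat) : cmod (H n.+2%:R^-1) <= (2 + c) * (Num.sqrt n.+2%:R)^-1.
  have n0 : 0 < n.+2%:R :> R by rewrite ltr0n.
  have nV : 0 < n.+2%:R^-1 :> R by rewrite invr_gt0.
  have n1 : n.+2%:R^-1 <= 1 :> R by rewrite invf_le1// ler1n.
  apply: le_trans (cH _ nV) _; rewrite mulrC; apply: ler_pM.
  - by rewrite addr_ge0// mulr_ge0// ltW.
  - by rewrite mulr_ge0 ?expR_ge0.
  - by rewrite lerD2r ler_piMr.
  apply: (@le_trans _ _ (expR (2^-1 * ln n.+2%:R^-1) * 1)).
    apply: ler_pM; rewrite ?expR_ge0 ?expR_le1 ?oppr_le0 ?(ltW nV)// ler_expR.
    by rewrite ler_wnM2r ?ln_le0// ltW.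
  rewrite mulr1 lnV ?posrE// mulrN expRN lef_pV2 ?posrE ?expR_gt0 ?sqrtr_gt0//.
  by rewrite -powR12_sqrt ?ler0n// /powR gt_eqF.
have [k zk] : exists k : nat, 0 <= complex.Re z <= k%:R.
  by exists (Num.bound (complex.Re z)); rewrite !ltW// archi_boundP// ltW.
have H1 (n : nat) : cmod (H n.+2%:R) <= 2 * (2 + c) * (k.+2)`!%:R * (Num.sqrt n.+2%:R)^-1.
  have n0 : 0 < n.+2%:R :> R by rewrite ltr0n.
  have n1 : 1 <= n.+2%:R :> R by rewrite ler1n.
  move: (n.+2%:R : R) n0 n1 => N n0 n1.
  have Nk : 1 <= N ^+ k by rewrite exprn_ege1.
  apply: le_trans (cH _ n0) _.
  have h1 : expR (complex.Re z * ln N) <= 2 * N ^+ k.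
    by apply: le_trans (expR_ln_le_Xn n0 zk) _; lra.
  have h2 : 2 * N + c <= (2 + c) * N by have := ler_wpM2l c0 n1; lra.
  have h3 := exprn_le_fact_exp k.+2 (ltW n0).
  have h4 : Num.sqrt N <= N.
    rewrite -(@ler_pXn2r _ 2)// ?nnegrE ?sqrtr_ge0 ?(ltW n0)// sqr_sqrtr ?(ltW n0)//.
    by rewrite expr2 ler_peMl// ltW.
  have s0 : 0 < Num.sqrt N by rewrite sqrtr_gt0.
  apply: (@le_trans _ _ (2 * N ^+ k * expR (- N) * ((2 + c) * N))).
    apply: ler_pM h2; last by rewrite ler_wpM2r ?expR_ge0.
      by rewrite mulr_ge0 ?expR_ge0.
    by rewrite addr_ge0// mulr_ge0// ltW.
  rewrite expRN ler_pdivlMr//.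
  have -> : 2 * N ^+ k / expR N * ((2 + c) * N) * Num.sqrt N =
     2 * (2 + c) * (N ^+ k * N * Num.sqrt N / expR N) by ring.
  have c2 : 0 <= 2 * (2 + c) by lra.
  rewrite ler_wpM2l// ler_pdivrMr ?expR_gt0//; apply: le_trans h3.
  by rewrite !exprSr ler_wpM2l// mulr_ge0 ?exprn_ge0// ltW.
have lim0 (v : nat -> R[i]^o) (K : R) :
    (forall n, cmod (v n) <= K * (Num.sqrt n.+2%:R)^-1) ->
    (fun n => complex.Re (v n)) @ \oo --> (0 : R) /\
    (fun n => complex.Im (v n)) @ \oo --> (0 : R).
  move=> vK; have cK : (fun n : nat => K * (Num.sqrt n.+2%:R)^-1) @ \oo --> (0 : R).
    by rewrite -(mulr0 K); apply: cvgM; [exact: cvg_cst|exact: cvg_inv_sqrt].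
  have cKN : (fun n : nat => - (K * (Num.sqrt n.+2%:R)^-1)) @ \oo --> (0 : R).
    by rewrite -oppr0; exact: cvgN.
  split; apply: (squeeze_cvgr _ cKN cK); apply: nearW => n.
    by rewrite -ler_norml; exact: le_trans (normr_Re_le _) (vK n).
  by rewrite -ler_norml; exact: le_trans (normr_Im_le _) (vK n).
have [r0 i0] := lim0 _ _ H0; have [r1 i1] := lim0 _ _ H1.
have [cr ci] : pcontC h.
  apply: pcontCB; first exact: pcontC_omega_integrand.
  by apply: pcontCM; [exact: pcontC_cst|exact: pcontC_gamma_integrand].
have [Ir Ii] : cintegrable h by apply: cintegrableB => //; exact: cintegrableZ.
rewrite /cint /cintegral.
rewrite (halfline_FTC cr Ir (fun x hx => (dH x hx).1) r0 r1).
by rewrite (halfline_FTC ci Ii (fun x hx => (dH x hx).2) i0 i1) subrr.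
Qed.

Lemma cpow_sqr x z : 0 < x -> cpow (x ^+ 2) z = cpow x (z + z).
Proof. by move=> x0; rewrite expr2 cpowM// cpowD. Qed.

(** With [a = pi m^2], the [k]-th term of [omega] is a function of [a x]; this is
    how the factors [pi^(-s/2)] and [m^(-s)] arise. *)
Lemma omega_term_integrandE z (k : nat) x : 0 < x ->
  let a := pi * k.+1%:R ^+ 2 in
  (omega_term x k)%:C * cpow x (z - 1)
  = cpow a (- z) * (omega_integrand z (a * x) * a%:C).
Proof.
move=> x0 a; have a0 : 0 < a by rewrite mulr_gt0 ?pi_gt0// exprn_gt0.
rewrite /omega_integrand cpowM// [cpow a (z - 1)]cpowD [cpow a (- 1)]cpowN cpow1// cpowN.
have -> : omega_term x k = (2 * (a * x) ^+ 2 - 3 * (a * x)) * expR (- (a * x)).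
  by rewrite /omega_term /a; congr (_ * _); ring.
have A0 : a%:C != 0 :> R[i]^o by rewrite (inj_eq (@complexI R)) gt_eqF.
have c0 := cpow_neq0 a z.
move: (cpow a z) c0 (cpow x (z - 1)) => c c0 d; move: (_ * expR _)%:C => e.
by field; rewrite A0 c0.
Qed.

(** The bound [omega_partial_le], multiplied by [|x^(z - 1)|]. *)
Definition omega_dominant z x : R :=
  304 * gamma_weight (complex.Re z - 2^-1) x.

Lemma omega_dominant_integrable z : 2^-1 < complex.Re z ->
  mu.-integrable (@halfline R) (EFin \o omega_dominant z).
Proof.
move=> zh; have z0 : 0 < complex.Re z - 2^-1 by lra.
have mD := @measurable_halfline R.
rewrite (_ : EFin \o _ =
    (fun x => 304%:E * (gamma_weight (complex.Re z - 2^-1) x)%:E)%E).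
  by apply: integrableZl => //; exact: gamma_weight_integrable.
by apply/funext => x; rewrite /= EFinM.
Qed.

Lemma omega_dominantE z x : 0 < x -> 304 * (expR (- x) / Num.sqrt x) *
  cmod (cpow x (z - 1)) = omega_dominant z x.
Proof.
move=> x0; rewrite cmod_cpowB1// /omega_dominant /gamma_weight mulrBl expRB.
have -> : Num.sqrt x = expR (2^-1 * ln x) by rewrite -powR12_sqrt ?ltW// /powR gt_eqF.
move: (304 : R) => c; field; by rewrite !gt_eqF ?expR_gt0.
Qed.

Lemma omega_partial_cmod_le z n x : 0 < x ->
  cmod ((\sum_(0 <= k < n) omega_term x k)%:C * cpow x (z - 1)) <= omega_dominant z x.
Proof.
move=> x0; rewrite cmodM cmodR -omega_dominantE// ler_wpM2r ?cmod_ge0//.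
by apply: le_trans (ler_norm_sum _ _ _) _; exact: omega_partial_le.
Qed.

Lemma omega_term_cmod_le z k x : 0 < x ->
  cmod ((omega_term x k)%:C * cpow x (z - 1)) <= omega_dominant z x.
Proof.
move=> x0; rewrite cmodM cmodR -omega_dominantE// ler_wpM2r ?cmod_ge0//.
apply: le_trans (omega_partial_le k.+1 x0).
by rewrite big_nat_recr//= lerDr sumr_ge0.
Qed.

Lemma pcont_omega_term k : pcont (fun x : R => omega_term x k).
Proof.
apply: pcontM.
  apply: pcontB; apply: pcontM; (try exact: pcont_cst); last exact: pcont_id.
  by apply: pcontX; exact: pcont_id.
apply: (@pcont_comp _ (fun x => - (pi * k.+1%:R ^+ 2 * x)) expR).
  exact: continuous_expR.
by apply: pcontN; apply: pcontM; [exact: pcont_cst|exact: pcont_id].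
Qed.

Lemma omega_term_cintegrable z k : 2^-1 < complex.Re z ->
  cintegrable (fun x => (omega_term x k)%:C * cpow x (z - 1)).
Proof.
move=> zh; apply: (cintegrable_dom _ (omega_dominant_integrable zh)).
  by apply: pcontCM; [apply: pcontC_real; exact: pcont_omega_term|exact: pcontC_cpow].
by move=> x x0; exact: omega_term_cmod_le.
Qed.

Lemma cint_scale (g : R -> R[i]^o) (a : R) : 0 < a -> pcontC g -> cintegrable g ->
  cintegrable (fun x => g (a * x) * a%:C) ->
  cint (fun x => g (a * x) * a%:C) = cint g.
Proof.
move=> a0 [cr ci] [Ir Ii] [Ira Iia].
have rE x : complex.Re (g (a * x) * a%:C) = complex.Re (g (a * x)) * a.
  by rewrite cReM /= mulr0 subr0.
have iE x : complex.Im (g (a * x) * a%:C) = complex.Im (g (a * x)) * a.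
  by rewrite cImM /= mulr0 add0r.
rewrite /cint /cintegral (halfline_scale a0 cr Ir); last first.
  by under eq_fun do rewrite -rE.
rewrite (halfline_scale a0 ci Ii); last by under eq_fun do rewrite -iE.
by congr (_ +i* _); apply: eq_Rintegral => x _; rewrite (rE, iE).
Qed.

Lemma cint_omega_term s k : 1 < complex.Re s ->
  cint (fun x => (omega_term x k)%:C * cpow x (s / 2 - 1)) =
  2^-1 * s * (s - 1) * cpow pi (- (s / 2)) * cGamma (s / 2) * cpow (k.+1%:R : R) (- s).
Proof.
move=> s1; set z := s / 2.
have zh : 2^-1 < complex.Re z.
  suff -> : complex.Re z = complex.Re s / 2 by lra.
  rewrite /z (_ : 2^-1 = (2^-1 : R)%:C); last by rewrite fmorphV/= rmorphMn.
  by rewrite cReM /= mulr0 subr0.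
pose a : R := pi * k.+1%:R ^+ 2.
have a0 : 0 < a by rewrite mulr_gt0 ?pi_gt0// exprn_gt0.
have It := omega_term_cintegrable k zh.
have E x : 0 < x -> (omega_term x k)%:C * cpow x (z - 1)
  = cpow a (- z) * (omega_integrand z (a * x) * a%:C).
  by move=> x0; exact: omega_term_integrandE.
have z0 : 0 < complex.Re z by lra.
have Ia : cintegrable (fun x => omega_integrand z (a * x) * a%:C).
  have := cintegrableZ (cpow a z) It; apply: eq_cintegrable => x x0.
  by rewrite E// mulrA cpowN mulfV ?mul1r// cpow_neq0.
rewrite (eq_cint E) cintZ// cint_scale//; last exact: omega_integrand_cintegrable.
  rewrite cint_omega_integrand// cpowM ?pi_gt0 ?exprn_gt0// cpow_sqr//.
  rewrite -/z (_ : - z - z = - s); last by rewrite /z; field.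
  by rewrite (_ : s = 2 * z) /z; [field|field].
exact: pcontC_omega_integrand.
Qed.

End GammaIntegrals.

(** * The Mellin transform of omega is the function xi *)

Section XiMellin.
Variable R : realType.
Notation mu := (@lebesgue_measure R).
Implicit Types (x y : R) (z s : R[i]^o).

Lemma cvg_cmodP (u : nat -> R[i]^o) (l : R[i]^o) : u @ \oo --> l <->
  forall e : R, 0 < e -> \forall n \near \oo, cmod (l - u n) <= e.
Proof.
split=> [/cvgrPdist_le H e e0|H].
  have e0' : 0 < e%:C :> R[i] by rewrite ltcR.
  by have := H _ e0'; apply: filterS => n; rewrite cmod_le.
apply/cvgrPdist_le => -[a b]; rewrite ltcE/= => /andP[/eqP -> a0].
by have := H a a0; apply: filterS => n; rewrite -cmod_le.
Qed.

Lemma cvg_ReImP (u : nat -> R[i]^o) (l : R[i]^o) : u @ \oo --> l <->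
  (fun n => complex.Re (u n)) @ \oo --> complex.Re l /\
  (fun n => complex.Im (u n)) @ \oo --> complex.Im l.
Proof.
split=> [/cvg_cmodP H|[/cvgrPdist_le Hr /cvgrPdist_le Hi]].
  split; apply/cvgrPdist_le => e e0; have := H e e0; apply: filterS => n.
    by apply: le_trans; rewrite -cReB normr_Re_le.
  by apply: le_trans; rewrite -cImB normr_Im_le.
apply/cvg_cmodP => e e0; have e2 : 0 < e / 2 by rewrite divr_gt0.
have := Hi _ e2; have := Hr _ e2; apply: filterS2 => n hr hi.
apply: le_trans (cmod_le_ReIm _) _; rewrite cReB cImB; lra.
Qed.

(** If [c <> 0] the convergence of [u] follows, and if [c = 0] both sides are 0.
    In this way the convergence of the integrals replaces a proof that the
    Dirichlet series of zeta converges. *)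
Lemma cvg_mul_lim (u : nat -> R[i]^o) (c l : R[i]^o) :
  (fun n => c * u n) @ \oo --> l -> l = c * limn u.
Proof.
have [->|c0] := eqVneq c 0.
  under eq_fun do rewrite mul0r; rewrite mul0r => H.
  exact: (cvg_unique (@norm_hausdorff _ _) H (@cvg_cst _ _ _ _ _)).
move=> H; have uE : u = (fun n => c^-1 * (c * u n)).
  by apply/funext => n; rewrite mulrA mulVf// mul1r.
have ul : u @ \oo --> c^-1 * l by rewrite uE; exact: cvgMl_tmp.
by rewrite (cvg_lim (@norm_hausdorff _ _) ul) mulrA mulfV// mul1r.
Qed.

Lemma halfline_dominated_cvg (f_ : nat -> R -> R) (f w : R -> R) :
  (forall n, pcont (f_ n)) -> pcont f ->
  mu.-integrable (@halfline R) (EFin \o w) ->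
  (forall n x, 0 < x -> `|f_ n x| <= w x) ->
  (forall x, 0 < x -> f_ ^~ x @ \oo --> f x) ->
  (fun n => \int[mu]_(x in @halfline R) f_ n x) @ \oo -->
    \int[mu]_(x in @halfline R) f x.
Proof.
move=> cf_ cf Iw fw fcv; have mD := @measurable_halfline R.
have fw' x : 0 < x -> `|f x| <= w x.
  move=> x0; apply: (@cvgr_to_le _ _ _ _ _ _ _ (cvg_norm (fcv x x0))).
  by apply: nearW => n; exact: fw.
have If : mu.-integrable (@halfline R) (EFin \o f).
  exact: (halfline_dominated_integrable _ fw' Iw).
have If_ n : mu.-integrable (@halfline R) (EFin \o f_ n).
  exact: (halfline_dominated_integrable _ (fw n) Iw).
apply: fine_cvg; rewrite fineK; last exact: integrable_fin_num.
have [] // := @dominated_convergence _ _ R mu (@halfline R) mD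
  (fun n x => (f_ n x)%:E) (EFin \o f) (EFin \o w).
- by move=> n; have /integrableP[] := If_ n.
- by have /integrableP[] := If.
- apply: aeW => x; rewrite halflineE => x0.
  by apply: cvg_EFin; [exact: nearW|exact: fcv].
- apply: aeW => x n; rewrite halflineE => x0.
  by rewrite lee_fin fw.
Qed.

Lemma cint_dominated_cvg (g_ : nat -> R -> R[i]^o) (g : R -> R[i]^o) (w : R -> R) :
  (forall n, pcontC (g_ n)) -> pcontC g ->
  mu.-integrable (@halfline R) (EFin \o w) ->
  (forall n x, 0 < x -> cmod (g_ n x) <= w x) ->
  (forall x, 0 < x -> g_ ^~ x @ \oo --> g x) ->
  (fun n => cint (g_ n)) @ \oo --> cint g.
Proof.
move=> cg_ [cr ci] Iw gw gcv; apply/cvg_ReImP; split.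
  apply: halfline_dominated_cvg Iw _ _ => // [n|n x x0|x x0].
  - by have [] := cg_ n.
  - exact: le_trans (normr_Re_le _) (gw n x x0).
  - by have /cvg_ReImP[] := gcv x x0.
apply: halfline_dominated_cvg Iw _ _ => // [n|n x x0|x x0].
- by have [] := cg_ n.
- exact: le_trans (normr_Im_le _) (gw n x x0).
- by have /cvg_ReImP[] := gcv x x0.
Qed.

Lemma pcont_omega : pcont (@omega R).
Proof. exact: continuous_omega. Qed.

Lemma pcont_omega_partial n : pcont (fun x : R => \sum_(0 <= k < n) omega_term x k).
Proof.
elim: n => [|n IH].
  by under eq_fun do rewrite big_geq//; exact: pcont_cst.
under eq_fun do rewrite big_nat_recr//=.
by apply: pcontD => //; exact: pcont_omega_term.
Qed.

Lemma cint_omega_partial s n : 1 < complex.Re s ->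
  cint (fun x => (\sum_(0 <= k < n) omega_term x k)%:C * cpow x (s / 2 - 1)) =
  2^-1 * s * (s - 1) * cpow pi (- (s / 2)) * cGamma (s / 2) *
    series (fun k => cpow (k.+1%:R : R) (- s)) n.
Proof.
move=> s1; have zh : 2^-1 < complex.Re (s / 2).
  suff -> : complex.Re (s / 2) = complex.Re s / 2 by lra.
  rewrite (_ : 2^-1 = (2^-1 : R)%:C); last by rewrite fmorphV/= rmorphMn.
  by rewrite cReM /= mulr0 subr0.
elim: n => [|n IH].
  rewrite /series/= big_geq// mulr0.
  have E0 x : 0 < x -> (\sum_(0 <= k < 0) omega_term x k)%:C * cpow x (s / 2 - 1)
      = 0 * ((omega_term x 0)%:C * cpow x (s / 2 - 1)).
    by move=> _; rewrite big_geq// !mul0r.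
  by rewrite (eq_cint E0) cintZ ?mul0r//; exact: omega_term_cintegrable.
have Ip : cintegrable
    (fun x => (\sum_(0 <= k < n) omega_term x k)%:C * cpow x (s / 2 - 1)).
  apply: (cintegrable_dom _ (omega_dominant_integrable zh)).
    by apply: pcontCM; [apply: pcontC_real; exact: pcont_omega_partial|exact: pcontC_cpow].
  by move=> x x0; exact: omega_partial_cmod_le.
have ES x : 0 < x -> (\sum_(0 <= k < n.+1) omega_term x k)%:C * cpow x (s / 2 - 1)
    = (\sum_(0 <= k < n) omega_term x k)%:C * cpow x (s / 2 - 1) +
      (omega_term x n)%:C * cpow x (s / 2 - 1).
  by move=> _; rewrite big_nat_recr//= rmorphD mulrDl.
rewrite (eq_cint ES) cintD//; last exact: omega_term_cintegrable.
by rewrite IH cint_omega_term// -mulrDr -seriesSr.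
Qed.

(** Dominated convergence for the partial sums of [omega]. *)
Lemma xi_mellin_zeta s : 1 < complex.Re s ->
  xi_mellin s =
  2^-1 * s * (s - 1) * cpow pi (- (s / 2)) * cGamma (s / 2) * czeta s.
Proof.
move=> s1; have zh : 2^-1 < complex.Re (s / 2).
  suff -> : complex.Re (s / 2) = complex.Re s / 2 by lra.
  rewrite (_ : 2^-1 = (2^-1 : R)%:C); last by rewrite fmorphV/= rmorphMn.
  by rewrite cReM /= mulr0 subr0.
apply: cvg_mul_lim.
under eq_fun do rewrite -cint_omega_partial//.
apply: (cint_dominated_cvg _ _ (omega_dominant_integrable zh)) => [n||n x x0|x x0].
- by apply: pcontCM; [apply: pcontC_real; exact: pcont_omega_partial|exact: pcontC_cpow].
- by apply: pcontCM; [apply: pcontC_real; exact: pcont_omega|exact: pcontC_cpow].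
- exact: omega_partial_cmod_le.
- have ocv := omega_cvg x0; apply/cvg_ReImP; split.
    under eq_fun do rewrite cReM /= mul0r subr0.
    by rewrite cReM /= mul0r subr0; apply: cvgMl.
  under eq_fun do rewrite cImM /= mul0r addr0.
  by rewrite cImM /= mul0r addr0; apply: cvgMl.
Qed.

Lemma is_riemann_xi_mellin : is_riemann_xi (@xi_mellin R).
Proof. by split; [exact: entire_xi_mellin|exact: xi_mellin_zeta]. Qed.

Lemma entire_eq (g1 g2 : R[i]^o -> R[i]^o) : entire g1 -> entire g2 ->
  (forall s, 1 < complex.Re s -> g1 s = g2 s) -> g1 = g2.
Proof.
move=> e1 e2 gg; apply/funext => a; apply/eqP; rewrite -subr_eq0; apply/eqP.
apply: (@entire_halfplane_eq0 R (g1 - g2)) => [z|s s1].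
  exact: derivableB (e1 z) (e2 z).
by apply/eqP; rewrite subr_eq0; apply/eqP; exact: gg.
Qed.

Lemma riemann_xiE : @riemann_xi R = @xi_mellin R.
Proof.
apply: xget_unique; first exact: is_riemann_xi_mellin.
move=> g [eg gE]; apply: (entire_eq eg (@entire_xi_mellin R)) => s s1.
by rewrite (gE s s1) (xi_mellin_zeta s1).
Qed.

End XiMellin.

(** * Uniform convergence on compact sets *)

Section CompactConvergence.
Variable R : realType.
Implicit Types (t z w : R[i]^o).

Lemma ler_dist_cmod z w : `|cmod z - cmod w| <= cmod (z - w).
Proof.
have h1 := cmodD (z - w) w; have h2 := cmodD (w - z) z.
rewrite ler_norml; rewrite !subrK in h1 h2.
by rewrite -(opprB z w) cmodN in h2; lra.
Qed.

Lemma continuous_cmod : continuous (@cmod R : R[i]^o -> R).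
Proof.
move=> z; apply/(@cvgrPdist_le _ _ _ _ (nbhs_filter z)) => e e0.
have e0' : 0 < e%:C :> R[i] by rewrite ltcR.
apply: filterS (nbhsx_ballx z _ e0') => w; rewrite -ball_normE/= ltc_cmod => /ltW.
exact: le_trans (ler_dist_cmod _ _).
Qed.

Lemma compact_cmod_le (K : set R[i]^o) : compact K ->
  exists2 T : R, 0 <= T & forall t, K t -> cmod t <= T.
Proof.
move=> cK.
have /compact_bounded[M [_ MK]] : compact ((@cmod R : R[i]^o -> R) @` K).
  apply: continuous_compact => //.
  by apply: continuous_subspaceT; exact: continuous_cmod.
exists (`|M| + 1) => [|t Kt]; first by rewrite addr_ge0.
rewrite -[leLHS]ger0_norm ?cmod_ge0//; apply: (MK (`|M| + 1)); last by exists t.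
by rewrite ltr_pwDr// ler_norm.
Qed.

Lemma riemann_Xi_expansion (T : R) : 0 <= T -> exists2 C : R, 0 <= C &
  forall t (N : nat), cmod t <= T ->
    cmod (riemann_Xi t - series (Xi_term t) N.+1) <=
      C * expR (- (2^-1 * Num.sqrt N%:R)).
Proof.
move=> T0; have [C C0 CP] := xi_mellin_expansion T0; exists C => // t N tT.
by rewrite /riemann_Xi riemann_xiE; exact: CP.
Qed.

Lemma cvg_expR_sqrt : (fun N : nat => expR (- (2^-1 * Num.sqrt N%:R))) @ \oo --> (0 : R).
Proof.
apply/cvgrPdist_le => e e0; near=> N.
rewrite sub0r normrN ger0_norm ?expR_ge0// -[leRHS]lnK ?posrE// ler_expR.
have h : `|2 * ln e| <= Num.sqrt N%:R.
  rewrite -sqrtr_sqr ler_wsqrtr//; near: N; exact: nbhs_infty_ger.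
by move: h; rewrite ler_norml; lra.
Unshelve. all: by end_near. Qed.

Lemma riemann_Xi_near (T e : R) : 0 <= T -> 0 < e ->
  \forall N \near \oo, forall t, cmod t <= T ->
    cmod (riemann_Xi t - series (Xi_term t) N) <= e.
Proof.
move=> T0 e0; have [C C0 CP] := riemann_Xi_expansion T0.
have : (fun N : nat => C * expR (- (2^-1 * Num.sqrt N%:R))) @ \oo --> (0 : R).
  by rewrite -(mulr0 C); apply: cvgMl_tmp; exact: cvg_expR_sqrt.
move=> /cvgrPdist_le /(_ e e0) [m _ mP]; exists m.+1 => // -[//|N] /= mN t tT.
apply: le_trans (CP t N tT) _; apply: le_trans (mP N mN).
by rewrite sub0r normrN ler_norm.
Qed.

End CompactConvergence.

Theorem theorem3p1 (R : realType) :
  [/\ forall t : R[i]^o, series (Xi_term t) @ \oo --> riemann_Xi t,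
      {family compact,
        (fun (N : nat) (t : R[i]^o) => series (Xi_term t) N) @ \oo
          --> @riemann_Xi R}
    & forall K : set R[i]^o, compact K ->
      exists C1 C2 : R, [/\ 0 < C1, 0 < C2 &
        forall (N : nat) (t : R[i]^o), K t ->
          `|riemann_Xi t - \sum_(0 <= n < N.+1) Xi_term t n|
            <= (C1 * expR (- C2 * Num.sqrt N%:R))%:C]].
Proof.
split.
- move=> t; apply/cvg_cmodP => e e0.
  by have := riemann_Xi_near (cmod_ge0 t) e0; apply: filterS => N; apply.
- apply/fam_cvgP => K cK P /uniform_nbhs[E [entE EP]].
  have [T T0 KT] := compact_cmod_le cK.
  have [e /= e0 eE] : entourage_ ball E by rewrite entourage_ballE.
  have [r r0 er] : exists2 r : R, 0 < r & e = r%:C.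
    by case: e e0 {eE} => a b; rewrite ltcE/= => /andP[/eqP -> a0]; exists a.
  have r2 : 0 < r / 2 by rewrite divr_gt0.
  have := riemann_Xi_near T0 r2; apply: filterS => N NP.
  apply: EP => t Kt; apply: eE => /=; rewrite -ball_normE/= er ltc_cmod.
  by apply: le_lt_trans (NP t (KT t Kt)) _; rewrite ltr_pdivrMr//; lra.
- move=> K cK; have [T T0 KT] := compact_cmod_le cK.
  have [C C0 CP] := riemann_Xi_expansion T0.
  exists (C + 1), 2^-1; split; rewrite ?invr_gt0 ?ltr_wpDl// => N t Kt.
  rewrite cmod_le mulNr; apply: le_trans (CP t N (KT t Kt)) _.
  by rewrite ler_wpM2r ?expR_ge0// lerDl.
Qed.
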